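(* Let $Q_1$ be a fixed lifted cylinder, let $\nu>0$, and let $(G_j,b_j)$ solve, in the sense of distributions on $Q_1$, $$\partial_tG_j+b_j\cdot\nabla G_j=\nu\Delta_5G_j+S_j.$$ Assume that on every $Q_\rho$ with $0<\rho<1$ $$\sup_j\left(\|G_j\|_{L^\infty_tL^2_x}+\|\nabla G_j\|_{L^2_{t,x}}+\|b_j\|_{L^2_tL^{10/3}_x}+\|\operatorname{div}_5b_j\|_{L^2_tL^{10/3}_x}\right)<\infty,$$ and that $S_j\to0$ in $L^1_tH^{-m}_x$ on every such $Q_\rho$ for some sufficiently large $m$. Then, after passage to a subsequence, $$G_j\to G_\infty\quad\text{strongly in }L^2_{\rm loc}(Q_1),$$ and the limit satisfies the source-free equation $$\partial_tG_\infty+b_\infty\cdot\nabla G_\infty=\nu\Delta_5G_\infty$$ in distributions, provided $b_j\to b_\infty$ strongly in the local topology needed for the product, i.e. in a local topology for which $b_j\cdot\nabla G_j\to b_\infty\cdot\nabla G_\infty$ in distributions along the subsequence.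
   Context: Functions of $(r,z)$ are identified with functions of $x=(y,z)\in\mathbb R^4\times\mathbb R=\mathbb R^5$ radial in $y$, $r=|y|$. $Q_\rho=\{r<\rho,\ |z|<\rho,\ -\rho^2<t<0\}$. The drift $b_j=(b_j^r,b_j^z)$ is identified with the vector field $b_j^r\,y/|y|+b_j^z e_z$ on $\mathbb R^5$, $\nabla$ and $\Delta_5=\partial_r^2+\frac3r\partial_r+\partial_z^2$ are the gradient and Laplacian of $\mathbb R^5$, and $\operatorname{div}_5b=r^{-3}\partial_r(r^3b^r)+\partial_zb^z$ is the five-dimensional divergence. Spatial norms are with respect to Lebesgue measure on $\mathbb R^5$ (equivalently, up to a constant, $d\mu_5=r^3\,dr\,dz$). $L^2_{\rm loc}(Q_1)$ convergence means convergence in $L^2(Q_\rho)$ for every $\rho<1$. *)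

(* Defs.v *)
From HB Require Import structures.
From mathcomp Require Import all_boot all_order all_algebra.
From mathcomp Require Import all_classical all_reals all_analysis.

Set Implicit Arguments.
Unset Strict Implicit.
Unset Printing Implicit Defensive.

Import Order.TTheory GRing.Theory Num.Theory numFieldNormedType.Exports.

Local Open Scope classical_set_scope.
Local Open Scope ring_scope.

(* The space R^5 = R^4 x R: a point is ((((y1, y2), y3), y4), z).  It carries
   the Borel sigma-algebra, so "measurable function" means Borel
   representative of an almost-everywhere class. *)
Notation space5 R := (R * R * R * R * R)%type.
Notation spacetime5 R := (R * (R * R * R * R * R))%type.

(* The library declares the product of two sigma-finite measures as a measure,
   but its sigma-finite instance is shadowed by the subprobability one; the
   alias [prodm] carries it. *)
Section product_of_sigma_finite.
Context d1 d2 (T1 : measurableType d1) (T2 : measurableType d2) (R : realType).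
Variables (m1 : {sigma_finite_measure set T1 -> \bar R})
          (m2 : {sigma_finite_measure set T2 -> \bar R}).

Definition prodm : set (T1 * T2) -> \bar R := (m1 \x m2)%E.

HB.instance Definition _ := Measure.on prodm.

Lemma prodm_sigma_finite : sigma_finite setT prodm.
Proof.
have /sigma_finiteP[F [TF ndF Foo]] := sigma_finiteT m1.
have /sigma_finiteP[G [TG ndG Goo]] := sigma_finiteT m2.
exists (fun n => F n `*` G n).
  rewrite -setXTT TF TG predeqE => -[x y]; split.
    move=> [/= [n _ Fnx] [k _ Gky]]; exists (maxn n k) => //; split.
    - by move: x Fnx; exact/subsetPset/ndF/leq_maxl.
    - by move: y Gky; exact/subsetPset/ndG/leq_maxr.
  by move=> [n _ []/= ? ?]; split; exists n.
move=> k; have [? ?] := Foo k; have [? ?] := Goo k.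
split; first exact: measurableX.
by rewrite /prodm product_measure1E// lte_mul_pinfty// ge0_fin_numE.
Qed.

HB.instance Definition _ :=
  Measure_isSigmaFinite.Build _ _ _ prodm prodm_sigma_finite.

End product_of_sigma_finite.

Section axisymmetric_lift.
Context {R : realType}.
Implicit Types (x : space5 R) (p : spacetime5 R).

Definition leb1 : {sigma_finite_measure set (measurableTypeR R) -> \bar R} :=
  @lebesgue_measure R.

Definition leb5 := prodm (prodm (prodm (prodm leb1 leb1) leb1) leb1) leb1.

Definition leb6 := prodm leb1 leb5.

Definition coord5 x (i : 'I_5) : R :=
  nth 0 [:: x.1.1.1.1; x.1.1.1.2; x.1.1.2; x.1.2; x.2] i.

Definition basis5 (i : 'I_5) : space5 R :=
  ((i == 0 :> nat)%N%:R, (i == 1 :> nat)%N%:R, (i == 2 :> nat)%N%:R,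
   (i == 3 :> nat)%N%:R, (i == 4 :> nat)%N%:R).

(* r = |y| *)
Definition rad5 x : R := Num.sqrt (\sum_(i < 5 | (i < 4)%N) coord5 x i ^+ 2).

Definition Dcyl (rho : R) : set (space5 R) :=
  [set x | rad5 x < rho /\ `|x.2| < rho].

Definition tI (rho : R) : set R := [set t | - rho ^+ 2 < t < 0].

Definition Qcyl (rho : R) : set (spacetime5 R) :=
  [set p | Dcyl rho p.2 /\ tI rho p.1].

(* A function g of (t, r, z), read on R x R^5. *)
Definition axi (g : R -> R -> R -> R) p : R := g p.1 (rad5 p.2) p.2.2.

(* The field b^r y/|y| + b^z e_z; on the null set y = 0 its y-components are 0
   because 0^-1 = 0. *)
Definition axi_field (br bz : R -> R -> R -> R) (i : 'I_5) p : R :=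
  if (i < 4)%N then axi br p * (coord5 p.2 i / rad5 p.2) else axi bz p.

End axisymmetric_lift.

Section distributions.
Context {R : realType}.

Definition iter_derive (V : normedModType R) (s : seq V) (f : V -> R) :
    V -> R :=
  foldr (fun v h => 'D_v h) f s.

(* f is C^oo: every iterated directional derivative is Frechet
   differentiable. *)
Definition smooth (V : normedModType R) (f : V -> R) : Prop :=
  forall (s : seq V) (x : V), differentiable (iter_derive s f) x.

Definition supp (V : normedModType R) (f : V -> R) : set V :=
  closure [set x | f x != 0].

(* C_c^oo(U) *)
Definition test_fun (V : normedModType R) (U : set V) (f : V -> R) : Prop :=
  [/\ smooth f, compact (supp f) & supp f `<=` U].

(* Coordinate directions of R x R^5: None is time, Some i is x_i. *)
Definition dir (o : option 'I_5) : spacetime5 R :=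
  if o is Some i then (0, basis5 i) else (1, 0).

Definition partial_t (phi : spacetime5 R -> R) := 'D_(dir None) phi.
Definition partial (i : 'I_5) (phi : spacetime5 R -> R) :=
  'D_(dir (Some i)) phi.
Definition laplacian (phi : spacetime5 R -> R) (p : spacetime5 R) : R :=
  \sum_(i < 5) partial i (partial i phi) p.

Definition test_linear (V : normedModType R) (U : set V)
    (T : (V -> R) -> R) : Prop :=
  forall (a : R) (f g : V -> R), test_fun U f -> test_fun U g ->
    T (fun x => a * f x + g x) = a * T f + T g.

(* Distributions on U: linear functionals on C_c^oo(U) that on every compact
   subset of U are bounded by a C^N norm.  Only the values of T on C_c^oo(U)
   matter. *)
Definition is_distribution (U : set (spacetime5 R))
    (T : (spacetime5 R -> R) -> R) : Prop :=
  test_linear U T /\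
  forall K : set (spacetime5 R), compact K -> K `<=` U ->
    exists (C : R) (N : nat), forall phi (M : R),
      test_fun U phi -> supp phi `<=` K ->
      (forall (w : seq (option 'I_5)) p, (size w <= N)%N ->
         `|iter_derive (map dir w) phi p| <= M) ->
      `|T phi| <= C * M.

Definition loc_int (U : set (spacetime5 R)) (f : spacetime5 R -> R) : Prop :=
  measurable_fun U f /\
  forall K : set (spacetime5 R), K `<=` U -> compact K ->
    (\int[leb6]_(p in K) (`|f p|)%:E < +oo)%E.

(* <f, phi> for f in L^1_loc(U) and phi in C_c^oo(U) *)
Definition pairing (U : set (spacetime5 R)) (f phi : spacetime5 R -> R) : R :=
  Rintegral leb6 U (fun p => f p * phi p).

Definition weak_gradient (U : set (spacetime5 R)) (f : spacetime5 R -> R)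
    (df : 'I_5 -> spacetime5 R -> R) : Prop :=
  [/\ loc_int U f, forall i, loc_int U (df i) &
      forall i phi, test_fun U phi ->
        pairing U f (partial i phi) = - pairing U (df i) phi].

Definition weak_div5 (U : set (spacetime5 R)) (b : 'I_5 -> spacetime5 R -> R)
    (h : spacetime5 R -> R) : Prop :=
  [/\ forall i, loc_int U (b i), loc_int U h &
      forall phi, test_fun U phi ->
        \sum_(i < 5) pairing U (b i) (partial i phi) = - pairing U h phi].

Definition dotf (b c : 'I_5 -> spacetime5 R -> R) (p : spacetime5 R) : R :=
  \sum_(i < 5) b i p * c i p.

(* d_t G + b . grad G = nu Delta_5 G + S in D'(U), where dG is the weak
   gradient of G. *)
Definition solves (U : set (spacetime5 R)) (nu : R) (G : spacetime5 R -> R)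
    (dG b : 'I_5 -> spacetime5 R -> R) (S : (spacetime5 R -> R) -> R) : Prop :=
  forall phi, test_fun U phi ->
    - pairing U G (partial_t phi) + pairing U (dotf b dG) phi =
    nu * pairing U G (laplacian phi) + S phi.

End distributions.

Section norms.
Context {R : realType}.
Local Open Scope ereal_scope.

Definition vnorm (b : 'I_5 -> spacetime5 R -> R) (p : spacetime5 R) : R :=
  Num.sqrt (\sum_(i < 5) b i p ^+ 2)%R.

Definition normLL (q r : \bar R) (rho : R) (f : spacetime5 R -> R) : \bar R :=
  Lnorm leb1 q
    (fun t => Lnorm leb5 r (fun x => (f (t, x) * \1_(Qcyl rho) (t, x))%:E)).

Definition normL2 (rho : R) (f : spacetime5 R -> R) : \bar R :=
  Lnorm leb6 2%:E (fun p => (f p * \1_(Qcyl rho) p)%:E).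

(* Square of the H^m norm on D_rho: the sum of |D^k psi|^2_{L^2}, k <= m, where
   D^k psi is the tensor of all k-th order partial derivatives. *)
Definition sqHnorm (m : nat) (rho : R) (psi : space5 R -> R) : R :=
  (\sum_(k < m.+1) \sum_(w : k.-tuple 'I_5)
     Rintegral leb5 (Dcyl rho)
       (fun x => iter_derive (map basis5 w) psi x ^+ 2))%R.

(* H^{-m}(D_rho) is the dual of H^m_0(D_rho), the H^m-closure of
   C_c^oo(D_rho): a functional is given by its values on C_c^oo(D_rho), and its
   norm is the supremum over the unit ball of that dense subspace. *)
Definition Hneg_norm (m : nat) (rho : R) (l : (space5 R -> R) -> R) : \bar R :=
  ereal_sup [set (`|l psi|)%:E | psi in
    [set psi | test_fun (Dcyl rho) psi /\ (sqHnorm m rho psi <= 1)%R]].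

Definition normL1Hneg (m : nat) (rho : R) (s : R -> (space5 R -> R) -> R) :
    \bar R :=
  \int[leb1]_(t in tI rho) Hneg_norm m rho (s t).

(* On Q_rho the distribution S is the element t |-> s t of
   L^1(-rho^2, 0; H^{-m}(D_rho)).  Weak measurability in t is equivalent to
   strong measurability because H^{-m}(D_rho) is separable and reflexive. *)
Definition represents_L1Hneg (m : nat) (rho : R)
    (S : (spacetime5 R -> R) -> R) (s : R -> (space5 R -> R) -> R) : Prop :=
  [/\ forall t, tI rho t -> test_linear (Dcyl rho) (s t),
      forall psi, test_fun (Dcyl rho) psi ->
        measurable_fun (tI rho) (s ^~ psi),
      normL1Hneg m rho s < +oo &
      forall phi, test_fun (Qcyl rho) phi ->
        S phi = Rintegral leb1 (tI rho) (fun t => s t (fun x => phi (t, x)))].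

Definition cvg0_L1Hneg (m : nat) (rho : R)
    (S : nat -> (spacetime5 R -> R) -> R) : Prop :=
  exists s : nat -> R -> (space5 R -> R) -> R,
    (forall j, represents_L1Hneg m rho (S j) (s j)) /\
    normL1Hneg m rho (s j) @[j --> \oo] --> 0.

End norms.

(* Main.v *)
(* The differences u = G_j - G_k are estimated directly on a fine grid.  Cut a
   cylinder slightly larger than Q_rho into cells of side h in space and tau in
   time.  Every test function f of a cell is the sum of J wt(t) w(x), of spatial
   derivatives of functions of L^2 norm at most C h |f|_2, and of the time
   derivative of alpha(t) w(x) with |alpha| <= C tau^(1/2) |f|_2, where w and wt
   are fixed weights.  Testing u against f and using the weak gradient and the
   equation, duality bounds the L^2 norm of u on the cell by one number
   <u, wt w>, by h |grad u|_2, and by tau^(1/2) times the L^1 norms of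
   b . grad G and G and the L^1 H^{-m} norm of the source; b . grad G is in L^1
   because L^2 L^{10/3} is locally contained in L^2 L^2.  After squaring and
   summing over the cells, the gradients contribute O(h^2) and the L^1 norms
   O(tau), with a constant depending on h; choose h first, then tau.  The
   finitely many remaining numbers converge along an ultrafilter on the indices,
   so G_j is Cauchy along it in L^2(Q_rho) for every rho < 1.

   A rapidly converging subsequence converges almost everywhere, hence the limit
   can be taken pointwise in (t, r, z) and is again axisymmetric.  Its weak
   gradient is an L^2_loc limit of iterated midpoints of the gradients (Mazur),
   and the equation passes to the limit term by term. *)
Require Import Defs.
From HB Require Import structures.
From mathcomp Require Import all_boot all_order all_algebra.
From mathcomp Require Import ring lra zify.
From mathcomp Require Import all_classical all_reals all_analysis.
From mathcomp Require Import measurable_realfun ess_sup_inf.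

Set Implicit Arguments.
Unset Strict Implicit.
Unset Printing Implicit Defensive.

Import Order.TTheory GRing.Theory Num.Theory numFieldNormedType.Exports.

Local Open Scope classical_set_scope.
Local Open Scope ring_scope.

(** * Smooth functions and test functions *)

(** The time derivative of [G j] is controlled only in L^1 in time with values in a negative Sobolev
    space, so the equation is tested only against products alpha(t) w(x) with alpha bounded and w
    one of finitely many fixed smooth weights. This dictates the decomposition: the oscillation of a
    test function in space is moved into spatial derivatives, paid for by the gradient bound, and
    what remains is a function of time times w. The operators doing this are averages and primitives
    in one variable. They act coordinate by coordinate on finite sums of products of one-dimensional
    test functions, where slices stay in the class and Tonelli transfers the L^2 bounds; density
    makes these sums sufficient for duality. The weight w belongs to the spatial cell and not to the
    time step, which is why tau can be chosen after h. Summed over cells, the L^1 terms do not grow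
    with the number of cells, since a sum of squares is at most the square of the sum; the source
    norm is multiplied by that number, but tends to 0. Cells depend on the radius and on the
    accuracy; a single ultrafilter makes all their numbers converge, so one diagonal extraction is
    enough. *)

Section smooth_functions.
Context {R : realType}.
Implicit Types V W : normedModType R.

Lemma iter_derive_rcons V (s : seq V) v (f : V -> R) :
  iter_derive (rcons s v) f = iter_derive s ('D_v f).
Proof. by rewrite /iter_derive foldr_rcons. Qed.

(** Coinduction principle: a class of differentiable functions stable under directional derivatives
    consists of smooth functions. Choosing a good class replaces explicit formulas for iterated
    derivatives. *)
Lemma smooth_coind V (P : (V -> R) -> Prop) :
  (forall f x, P f -> differentiable f x) ->
  (forall f v, P f -> P ('D_v f)) -> forall f, P f -> smooth f.
Proof.
move=> Pd PD f Pf s x; apply: Pd.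
by elim: s => //= v s IH; exact: PD.
Qed.

Lemma smooth_diff V (f : V -> R) x : smooth f -> differentiable f x.
Proof. by move=> /(_ [::] x). Qed.

Lemma smooth_derivable V (f : V -> R) x v : smooth f -> derivable f x v.
Proof. by move=> sf; apply/diff_derivable/smooth_diff. Qed.

Lemma smooth_continuous V (f : V -> R) : smooth f -> continuous f.
Proof. by move=> sf x; apply/differentiable_continuous/smooth_diff. Qed.

Lemma smooth_derive V (f : V -> R) v : smooth f -> smooth ('D_v f).
Proof. by move=> sf s x; rewrite -iter_derive_rcons; exact: sf. Qed.

Lemma smooth_iter_derive V (f : V -> R) s : smooth f -> smooth (iter_derive s f).
Proof. by move=> sf; elim: s => //= v s; exact: smooth_derive. Qed.

Lemma smooth_cst V (c : R) : smooth (fun _ : V => c).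
Proof.
apply: (@smooth_coind V (fun f => exists c : R, f = cst c)); last by exists c.
- by move=> f x [k ->]; exact: differentiable_cst.
- by move=> f v [k ->]; exists 0; apply/funext => x; rewrite derive_cst.
Qed.

Lemma smooth_add V (f g : V -> R) :
  smooth f -> smooth g -> smooth (fun x => f x + g x).
Proof.
move=> sf sg.
apply: (@smooth_coind V (fun h => exists f g, [/\ smooth f, smooth g & h = f + g]));
  last by exists f, g.
- move=> _ x [f' [g' [sf' sg' ->]]].
  by apply: differentiableD; exact: smooth_diff.
- move=> _ v [f' [g' [sf' sg' ->]]].
  exists ('D_v f'), ('D_v g'); split; [exact: smooth_derive..|].
  by apply/funext => x; rewrite deriveD//; exact: smooth_derivable.
Qed.

(** The derivative of a product is a sum of two products, so the stable class is the union over n of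
    the sums of 2^n products of smooth functions; a derivative leads from level [n] to level
    [n.+1]. *)
Lemma smooth_mul V (f g : V -> R) :
  smooth f -> smooth g -> smooth (fun x => f x * g x).
Proof.
pose P := fix P (n : nat) (h : V -> R) : Prop := if n is n'.+1 then
  exists f g, [/\ P n' f, P n' g & h = f + g] else
  exists f g, [/\ smooth f, smooth g & h = f * g].
have Pd n h x : P n h -> differentiable h x.
  elim: n h => [|n IH] h /= [f' [g' [Pf Pg ->]]].
    by apply: differentiableM; exact: smooth_diff.
  by apply: differentiableD; exact: IH.
move=> sf sg.
apply: (@smooth_coind V (fun h => exists n, P n h)); last by exists 0%N, f, g.
- by move=> h x [n /Pd].
- move=> h v [n Ph]; exists n.+1.
  elim: n h Ph => [|n IH] h [f' [g' [Pf Pg ->]]].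
    exists (f' * 'D_v g'), ('D_v f' * g'); split.
    + by exists f', ('D_v g'); split => //; exact: smooth_derive.
    + by exists ('D_v f'), g'; split => //; exact: smooth_derive.
    + apply/funext => x; rewrite deriveM//; try exact: smooth_derivable.
      by rewrite /GRing.scale/= [g' x * _]mulrC.
  exists ('D_v f'), ('D_v g'); split; [exact: IH..|].
  apply/funext => x; rewrite deriveD//; apply: diff_derivable; [exact: Pd Pf | exact: Pd Pg].
Qed.

Lemma smooth_scale V (c : R) (f : V -> R) :
  smooth f -> smooth (fun x => c * f x).
Proof. by move=> sf; apply: smooth_mul => //; exact: smooth_cst. Qed.

(** Here [L] is affine with linear part [l]. The two difference quotients are the same function of
    the increment, so the identity does not go through the chain rule. *)
Lemma derive_comp_affine V W (L : V -> W) (l : V -> W) (f : W -> R) v x :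
  (forall h v x, L (h *: v + x) = h *: l v + L x) ->
  'D_v (fun x => f (L x)) x = 'D_(l v) f (L x).
Proof.
move=> Ll; rewrite /derive.
suff -> : (fun h : R => h^-1 *: (((fun x => f (L x)) \o shift x) (h *: v) - f (L x)))
  = (fun h => h^-1 *: ((f \o shift (L x)) (h *: l v) - f (L x))) by [].
by apply/funext => h /=; rewrite Ll.
Qed.

Lemma iter_derive_comp_affine V W (L : V -> W) (l : V -> W) (f : W -> R) s :
  (forall h v x, L (h *: v + x) = h *: l v + L x) ->
  iter_derive s (fun x => f (L x)) = (fun x => iter_derive (map l s) f (L x)).
Proof.
move=> Ll; elim: s => //= v s ->; apply/funext => x.
by rewrite (derive_comp_affine _ _ _ Ll).
Qed.

Lemma smooth_comp_affine V W (L : V -> W) (l : V -> W) (f : W -> R) :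
  (forall h v x, L (h *: v + x) = h *: l v + L x) ->
  (forall x, differentiable L x) ->
  smooth f -> smooth (fun x => f (L x)).
Proof.
move=> Ll dL sf s x; rewrite (iter_derive_comp_affine _ _ Ll).
by apply: differentiable_comp => //; exact: smooth_iter_derive.
Qed.

Lemma smooth_fst V W (f : V -> R) : smooth f -> smooth (fun p : V * W => f p.1).
Proof.
by apply: (@smooth_comp_affine _ _ fst fst) => // x; apply: linear_differentiable => y; exact: cvg_fst.
Qed.

Lemma smooth_snd V W (f : W -> R) : smooth f -> smooth (fun p : V * W => f p.2).
Proof.
by apply: (@smooth_comp_affine _ _ snd snd) => // x; apply: linear_differentiable => y; exact: cvg_snd.
Qed.

Lemma smooth_slice V W (f : V * W -> R) t : smooth f -> smooth (fun x => f (t, x)).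
Proof.
apply: (@smooth_comp_affine W (V * W)%type (fun x => (t, x)) (fun v => (0, v))).
- by move=> h v x; congr (_, _); rewrite /= scaler0 add0r.
- by move=> x; apply: differentiable_pair => //; exact: differentiable_cst.
Qed.

Lemma smooth_affine (k a : R) (f : R -> R) :
  smooth f -> smooth (fun x : R => f (k * (x - a))).
Proof.
apply: (@smooth_comp_affine R R (fun x => k * (x - a)) (fun v => k * v)).
- by move=> h v x; rewrite /GRing.scale/= -addrA mulrDr mulrCA.
- move=> x; apply/derivable1_diffP.
  by apply: derivableM => //; apply: derivableB => //.
Qed.

Lemma iter_derive_scale V (c : R) (f : V -> R) s :
  smooth f -> iter_derive s (fun x => c * f x) = (fun x => c * iter_derive s f x).
Proof.
move=> sf; elim: s => //= v s ->; apply/funext => x.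
have -> : (fun x => c * iter_derive s f x) = c \*: iter_derive s f by [].
by rewrite deriveZ//; apply: smooth_derivable; exact: smooth_iter_derive.
Qed.

End smooth_functions.

Section test_functions.
Context {R : realType}.
Implicit Types V W : normedModType R.

(** Vanishing outside some compact subset of [U] is easier to propagate through sums, products and
    derivatives than a statement about the closure of the nonvanishing set. *)
Lemma test_funP V (U : set V) (f : V -> R) : test_fun U f <->
  smooth f /\
  exists K, [/\ compact K, K `<=` U & forall x, ~ K x -> f x = 0].
Proof.
split=> [[sf cf fU]|[sf [K [cK KU f0]]]].
  split => //; exists (supp f); split => // x nfx.
  by apply: contrapT => /eqP fx0; apply: nfx; apply: subset_closure.
have fK : supp f `<=` K.
  have -> : K = closure K.
    by apply/closure_id; apply: compact_closed => //; exact: norm_hausdorff.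
  apply: closure_subset => x /=; apply: contraNP => nKx; exact/eqP/f0.
split => //; last exact: subset_trans KU.
by apply: subclosed_compact cK fK; exact: closed_closure.
Qed.

Lemma test_fun_smooth V (U : set V) f : test_fun U f -> smooth f.
Proof. by case. Qed.

Lemma test_fun0 V (U : set V) f x : test_fun U f -> ~ U x -> f x = 0.
Proof.
by move=> /test_funP[_ [K [_ KU f0]]] nUx; apply: f0 => Kx; exact/nUx/KU.
Qed.

Lemma test_fun_add V (U : set V) f g :
  test_fun U f -> test_fun U g -> test_fun U (fun x => f x + g x).
Proof.
move=> /test_funP[sf [K [cK KU f0]]] /test_funP[sg [L [cL LU g0]]].
apply/test_funP; split; first exact: smooth_add.
exists (K `|` L); split.
- exact: compactU.
- by rewrite subUset.
- by move=> x /not_orP[? ?]; rewrite f0// g0// addr0.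
Qed.

Lemma test_fun_scale V (U : set V) c f :
  test_fun U f -> test_fun U (fun x => c * f x).
Proof.
move=> /test_funP[sf [K [cK KU f0]]]; apply/test_funP.
split; first exact: smooth_scale.
by exists K; split => // x /f0 ->; rewrite mulr0.
Qed.

Lemma test_fun_cst0 V (U : set V) : test_fun U (fun=> 0 : R).
Proof.
apply/test_funP; split; first exact: smooth_cst.
by exists set0; split => //; exact: compact0.
Qed.

Lemma test_fun_derive V (U : set V) v f :
  test_fun U f -> test_fun U ('D_v f).
Proof.
move=> /test_funP[sf [K [cK KU f0]]]; apply/test_funP.
split; first exact: smooth_derive.
exists K; split => // x nKx.
have /closed_openC oK : closed K.
  by apply: compact_closed => //; exact: norm_hausdorff.
rewrite (@near_eq_derive _ _ _ _ (cst 0)) ?derive_cst//.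
by apply: filterS (open_nbhs_nbhs (conj oK nKx)) => y /f0.
Qed.

Lemma test_fun_sub V (U U' : set V) f :
  U `<=` U' -> test_fun U f -> test_fun U' f.
Proof. by move=> UU' [sf cf fU]; split => //; exact: subset_trans UU'. Qed.

Lemma test_fun_tensor V W (U : set V) (U' : set W) f g :
  test_fun U f -> test_fun U' g ->
  test_fun (U `*` U') (fun p : V * W => f p.1 * g p.2).
Proof.
move=> /test_funP[sf [K [cK KU f0]]] /test_funP[sg [L [cL LU g0]]].
apply/test_funP; split.
  by apply: smooth_mul; [exact: smooth_fst|exact: smooth_snd].
exists (K `*` L); split.
- exact: compact_setX.
- by move=> [x y] /= [Kx Ly]; split; [exact: KU|exact: LU].
- move=> [x y] /= /not_andP[/f0 ->|/g0 ->]; by rewrite ?mul0r ?mulr0.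
Qed.

Lemma test_fun_bounded V (U : set V) f :
  test_fun U f -> exists2 M, 0 < M & forall x, `|f x| <= M.
Proof.
move=> /test_funP[sf [K [cK KU f0]]].
have : compact [set f x | x in K].
  apply: continuous_compact => //.
  exact/continuous_subspaceT/smooth_continuous.
move=> /compact_bounded[M [_ /(_ (`|M| + 1))]].
rewrite (le_lt_trans (ler_norm _)) ?ltrDl// => /(_ isT) bM.
exists (`|M| + 1); first by rewrite ltr_wpDl.
move=> x; have [Kx|/f0 ->] := pselect (K x); first by apply: bM; exists x.
by rewrite normr0 addr_ge0.
Qed.

Lemma derive1R (f : R -> R) x v :
  differentiable f x -> 'D_v f x = v * f^`()%classic x.
Proof.
move=> df; rewrite derive1E !deriveE//.
by have -> : v = v *: (1 : R) :> R by [rewrite /GRing.scale/= mulr1]; rewrite linearZ /GRing.scale/= mulr1.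
Qed.

End test_functions.

(** * Functions flat at the origin, built from exp(-1/x) *)

Section flat_functions.
Context {R : realType}.
Implicit Types p : {poly R}.

(* The functions x |-> p(1/x) exp(-1/x), extended by 0 to x <= 0, form a class
   of smooth functions because it is stable under derivation. *)
Definition flat p (x : R) : R :=
  if 0 < x then p.[x^-1] * expR (- x^-1) else 0.

Lemma poly_le_expR p : exists2 C : R, 0 <= C &
  forall y : R, 0 <= y -> `|p.[y]| <= C * expR y.
Proof.
have E n : exists C : R, 0 <= C /\ forall y : R, 0 <= y -> y ^+ n <= C * expR y.
  case: n => [|n].
    exists 1; split => // y y0; rewrite expr0 mul1r.
    by apply: le_trans (expR_ge1Dx _); rewrite lerDl.
  exists (n.+1)`!%:R; split => // y y0.
  rewrite mulrC -ler_pdivrMr ?ltr0n ?fact_gt0//.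
  by apply: le_trans (expR_ge1Dxn n y0); rewrite lerDr.
have [C HC] := choice E.
exists (\sum_(i < size p) `|p`_i| * C i).
  by apply: sumr_ge0 => i _; rewrite mulr_ge0//; exact: (HC i).1.
move=> y y0; rewrite horner_coef mulr_suml.
apply: le_trans (ler_norm_sum _ _ _) _; apply: ler_sum => i _.
rewrite normrM -mulrA ler_wpM2l// (ger0_norm (exprn_ge0 _ y0)).
exact: (HC i).2.
Qed.

(** The exponential bound is applied to ['X^2 * p] at y = 1/x, and the extra y^2 turns into x^2.
    Quadratic decay is what makes the difference quotient at 0 tend to 0. *)
Lemma flat_sq p : exists2 C : R, 0 <= C & forall x : R, `|flat p x| <= C * x ^+ 2.
Proof.
have [C C0 HC] := poly_le_expR ('X^2 * p).
exists C => // x; rewrite /flat; case: ifPn => [x0|_]; last first.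
  by rewrite normr0 mulr_ge0// sqr_ge0.
have /HC : 0 <= x^-1 by rewrite invr_ge0 ltW.
rewrite hornerM hornerXn [in X in X -> _]normrM [in X in _ -> X]normrM exprVn.
rewrite (ger0_norm (expR_ge0 _)) (@ger0_norm _ (x ^- 2)); last first.
  by rewrite invr_ge0 exprn_ge0// ltW.
rewrite ler_pdivrMl ?exprn_gt0// => h.
by rewrite expRN ler_pdivrMr ?expR_gt0// (le_trans h)// mulrCA mulrA.
Qed.

(** With y = 1/x one has dy/dx = - y^2, so differentiating p(y) exp(-y) gives y^2 (p - p')(y)
    exp(-y), which is again of the form [flat]. *)
Lemma is_derive_flat p x :
  is_derive x (1 : R) (flat p) (flat ('X^2 * (p - p^`())) x).
Proof.
have [x0|x0|<-] := ltgtP 0 x.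
- have xn0 : x != 0 by rewrite gt_eqF.
  apply: (@near_eq_is_derive R R R (fun y : R => p.[y^-1] * expR (- y^-1))).
    near=> y; rewrite /flat ifT//; near: y; exact: lt_nbhsr.
  have dV : is_derive x (1 : R) (fun y : R => y^-1) (- x ^- 2).
    have := @is_deriveV R id x 1 1 xn0 (is_derive_id _ _).
    by rewrite /GRing.scale/= mulr1.
  have dp := is_derive1_comp (is_derive_poly p x^-1) dV.
  have dN : is_derive x (1 : R) (fun y : R => - y^-1) (- - x ^- 2) by exact: is_deriveN.
  have de := @is_derive1_comp R expR (fun y : R => - y^-1) x _ _ (is_derive_expR (- x^-1)) dN.
  have dpe := is_deriveM dp de.
  suff -> : flat ('X^2 * (p - p^`())) x = p.[x^-1] * (expR (- x^-1) * - - x ^- 2) +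
    expR (- x^-1) * (p^`().[x^-1] * - x ^- 2) by exact: dpe.
  by rewrite /flat x0 hornerM hornerXn hornerD hornerN exprVn; ring.
- apply: (@near_eq_is_derive R R R (cst 0)).
    near=> y; rewrite /flat ifF//; apply/negbTE; rewrite -leNgt ltW//.
    by near: y; exact: lt_nbhsl.
  by rewrite /flat (lt_gtF x0); exact: is_derive_cst.
(* At the origin the slope function is [flat p z / z]. It takes the value 0 at z = 0 because
   [flat p] vanishes there, and by [flat_sq] it is bounded by C |z|. *)
- apply/is_derive1_caratheodory; exists (fun z => flat p z / z).
  have f00 q : flat q 0 = 0 by rewrite /flat ltxx.
  split.
  + move=> z; rewrite f00 !subr0; have [->|z0] := eqVneq z 0.
      by rewrite f00 mul0r mulr0.
    by rewrite divfK.
  + have [C C0 HC] := flat_sq p.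
    rewrite /prop_for /continuous_at f00 mul0r.
    suff h : `|flat p z / z| @[z --> (0 : R)] --> (0 : R) by exact: norm_cvg0 h.
    apply: (@squeeze_cvgr _ (nbhs (0 : R)) _ R (cst 0) (fun z => C * `|z|)).
    * near=> z; rewrite normr_ge0/= normrM normfV.
      have [->|z0] := eqVneq z 0; first by rewrite normr0 invr0 !mulr0.
      rewrite ler_pdivrMr ?normr_gt0//; apply: le_trans (HC z) _.
      by rewrite -mulrA -expr2 real_normK ?num_real.
    * exact: cvg_cst.
    * rewrite -[X in _ --> X](mulr0 C); apply: cvgMr.
      rewrite -[X in _ --> X](normr0 R); apply: cvg_norm; exact: cvg_id.
  + by rewrite !f00 mul0r.
Unshelve. all: by end_near.
Qed.

Lemma smooth_flat p : smooth (flat p).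
Proof.
have df q x : differentiable (flat q) x.
  by apply/derivable1_diffP; have [] := is_derive_flat q x.
apply: (@smooth_coind _ _ (fun f => exists c q, f = fun x => c * flat q x)).
- move=> _ x [c [q ->]]; apply: differentiableM => //; exact: differentiable_cst.
- move=> _ v [c [q ->]]; exists (c * v), ('X^2 * (q - q^`())).
  apply/funext => x; have -> : (fun x => c * flat q x) = c \*: flat q by [].
  rewrite deriveZ; last exact/diff_derivable.
  rewrite derive1R// derive1E; have [_ ->] := is_derive_flat q x.
  by rewrite /GRing.scale/= mulrA.
- by exists 1, p; apply/funext => x; rewrite mul1r.
Qed.

End flat_functions.

(** * Square-integrable functions *)

Section integral_basics.
Context d (T : measurableType d) (R : realType).
Variable mu : {measure set T -> \bar R}.
Local Open Scope ereal_scope.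

(* No measurability: the integral of a nonnegative function is a supremum over
   the simple functions below it. *)
Lemma ge0_le_integralW (D : set T) (f g : T -> \bar R) :
  (forall x, D x -> 0 <= f x) -> (forall x, D x -> f x <= g x) ->
  \int[mu]_(x in D) f x <= \int[mu]_(x in D) g x.
Proof.
move=> f0 fg.
have g0 x : D x -> 0 <= g x by move=> Dx; exact: le_trans (f0 _ Dx) (fg _ Dx).
rewrite !ge0_integralE//; apply: le_ereal_sup => _ [h hf <-].
exists h => //= x; apply: le_trans (hf x) _.
by rewrite !patchE; case: ifPn => // /set_mem; exact: fg.
Qed.

Definition sqn (D : set T) (f : T -> R) : \bar R :=
  \int[mu]_(x in D) ((f x) ^+ 2)%:E.

Definition L2 (D : set T) (f : T -> R) : Prop :=
  measurable_fun D f /\ sqn D f < +oo.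

Lemma sqn_ge0 D f : 0 <= sqn D f.
Proof. by apply: integral_ge0 => x _; rewrite lee_fin sqr_ge0. Qed.

Lemma measurable_sqr (D : set T) (f : T -> R) : measurable_fun D f ->
  measurable_fun D (fun x => ((f x) ^+ 2)%:E).
Proof.
by move=> mf; apply/measurable_EFinP; apply: measurable_funX.
Qed.

Lemma L2_fin D f : L2 D f -> sqn D f = (fine (sqn D f))%:E.
Proof. by move=> [_ h]; rewrite fineK// ge0_fin_numE// sqn_ge0. Qed.

Variable D : set T.
Hypothesis mD : measurable D.
Implicit Types f g : T -> R.

Lemma sqn_add f g : measurable_fun D f -> measurable_fun D g ->
  sqn D (fun x => f x + g x)%R <= 2%:E * sqn D f + 2%:E * sqn D g.
Proof.
move=> mf mg.
have ? := measurable_sqr mf. have ? := measurable_sqr mg.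
have pos h x : D x -> 0 <= ((h x : R) ^+ 2)%:E by rewrite lee_fin sqr_ge0.
rewrite -ge0_integralZl//; last exact: pos.
rewrite -ge0_integralZl//; last exact: pos.
rewrite -ge0_integralD//; first last.
- exact: measurable_funeM.
- by move=> x Dx; rewrite mule_ge0// pos.
- exact: measurable_funeM.
- by move=> x Dx; rewrite mule_ge0// pos.
apply: ge0_le_integralW => [x Dx|x Dx]; first by rewrite lee_fin sqr_ge0.
by rewrite -!EFinM -EFinD lee_fin; have := sqr_ge0 (f x - g x)%R; nra.
Qed.

Lemma sqn_scale c f : measurable_fun D f ->
  sqn D (fun x => c * f x)%R = (c ^+ 2)%:E * sqn D f.
Proof.
move=> mf; rewrite -ge0_integralZl//; last 3 first.
- exact: measurable_sqr.
- by move=> x Dx; rewrite lee_fin sqr_ge0.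
- by rewrite lee_fin sqr_ge0.
by apply: eq_integral => x _; rewrite exprMn EFinM.
Qed.

Lemma L2_add f g : L2 D f -> L2 D g -> L2 D (fun x => f x + g x)%R.
Proof.
move=> [mf f2] [mg g2]; split; first exact: measurable_funD.
by apply: le_lt_trans (sqn_add mf mg) _; rewrite lte_add_pinfty// lte_mul_pinfty.
Qed.

Lemma L2_scale c f : L2 D f -> L2 D (fun x => c * f x)%R.
Proof.
move=> [mf f2]; split; first by apply: measurable_funM => //; exact: measurable_cst.
by rewrite sqn_scale// lte_mul_pinfty// lee_fin sqr_ge0.
Qed.

Lemma L2_sub f g : L2 D f -> L2 D g -> L2 D (fun x => f x - g x)%R.
Proof.
move=> Lf Lg; have h := L2_add Lf (L2_scale (-1) Lg).
suff -> : (fun x => f x - g x)%R = (fun x => f x + -1 * g x)%R by [].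
by apply/funext => x; rewrite mulN1r.
Qed.

Lemma L2_integrableM f g : L2 D f -> L2 D g ->
  mu.-integrable D (fun x => (f x * g x)%:E).
Proof.
move=> [mf f2] [mg g2].
have h : mu.-integrable D (fun x => ((f x) ^+ 2)%:E + ((g x) ^+ 2)%:E).
  apply: integrableD => //; apply/integrableP; split.
  - exact: measurable_sqr.
  - by under eq_integral do rewrite gee0_abs ?lee_fin ?sqr_ge0//.
  - exact: measurable_sqr.
  - by under eq_integral do rewrite gee0_abs ?lee_fin ?sqr_ge0//.
apply: le_integrable h => //.
- by apply/measurable_EFinP; exact: measurable_funM.
- move=> x Dx; rewrite -EFinD /= lee_fin normrM [leRHS]ger0_norm ?addr_ge0 ?sqr_ge0//.
  rewrite -(real_normK (num_real (f x))) -(real_normK (num_real (g x))).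
  by have := normr_ge0 (f x); have := normr_ge0 (g x); nra.
Qed.

End integral_basics.

(** The passage from Young with a free weight to Cauchy-Schwarz: the optimal weight is l =
    [X / F]. *)
Lemma sqr_le_of_scaled (R : realType) (X F G : R) : 0 <= X -> 0 <= F -> 0 <= G ->
  (forall l : R, 0 < l -> 2 * X <= l * F + G / l) -> X ^+ 2 <= F * G.
Proof.
move=> X0 F0 G0 h.
have [->|Xn0] := eqVneq X 0; first by rewrite expr0n mulr_ge0.
have {}X0 : 0 < X by rewrite lt_def Xn0.
have [F00|Fn0] := eqVneq F 0.
  (* For F = 0 this weight turns the hypothesis into 2 G + 2 X <= G, which contradicts X > 0. *)
  have l0 : 0 < G / X + 1 by rewrite ltr_wpDl// divr_ge0// ltW.
  have := h _ l0; rewrite F00 mulr0 add0r ler_pdivlMr// mulrDr.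
  have -> : 2 * X * (G / X) = 2 * G by field.
  by nra.
have {}F0 : 0 < F by rewrite lt_def Fn0.
have := h (X / F) (divr_gt0 X0 F0).
have -> : X / F * F + G / (X / F) = X + G * F / X by field; rewrite Xn0 Fn0.
by rewrite -lerBlDl ler_pdivlMr//; nra.
Qed.

Section cauchy_schwarz.
Context d (T : measurableType d) (R : realType).
Variables (mu : {measure set T -> \bar R}) (D : set T).
Hypothesis mD : measurable D.

Lemma cauchy_schwarz (f g : T -> R) : L2 mu D f -> L2 mu D g ->
  (\int[mu]_(x in D) `|f x * g x|) ^+ 2 <= fine (sqn mu D f) * fine (sqn mu D g).
Proof.
move=> Lf Lg.
have ifg := L2_integrableM mD Lf Lg.
have iff := L2_integrableM mD Lf Lf.
have igg := L2_integrableM mD Lg Lg.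
apply: sqr_le_of_scaled.
- exact: Rintegral_ge0.
- by rewrite fine_ge0// sqn_ge0.
- by rewrite fine_ge0// sqn_ge0.
move=> l l0.
have -> : fine (sqn mu D f) = \int[mu]_(x in D) (f x * f x) by [].
have -> : fine (sqn mu D g) = \int[mu]_(x in D) (g x * g x) by [].
rewrite [_ / l]mulrC -!RintegralZl//; last exact: integrable_norm.
have i1 : mu.-integrable D (EFin \o (fun x => l * (f x * f x))).
  exact: (integrableZl mD l iff).
have i2 : mu.-integrable D (EFin \o (fun x => l^-1 * (g x * g x))).
  exact: (integrableZl mD l^-1 igg).
rewrite -RintegralD//; apply: le_Rintegral => //.
- exact: (integrableZl mD 2 (integrable_norm ifg)).
- exact: (integrableD mD i1 i2).
move=> x Dx; rewrite normrM.
have -> : l * (f x * f x) + l^-1 * (g x * g x) =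
  ((l * `|f x|) ^+ 2 + `|g x| ^+ 2) / l.
  rewrite exprMn !real_normK ?num_real//; by field; rewrite gt_eqF.
rewrite ler_pdivlMr//.
have := sqr_ge0 (l * `|f x| - `|g x|); nra.
Qed.

Lemma cauchy_schwarzW (f g : T -> R) : L2 mu D f -> L2 mu D g ->
  `|\int[mu]_(x in D) (f x * g x)| <=
    Num.sqrt (fine (sqn mu D f)) * Num.sqrt (fine (sqn mu D g)).
Proof.
move=> Lf Lg.
have ifg := L2_integrableM mD Lf Lg.
apply: le_trans (le_normr_Rintegral mD ifg) _.
rewrite -sqrtrM ?fine_ge0 ?sqn_ge0// -[leLHS]ger0_norm ?Rintegral_ge0// -sqrtr_sqr.
by rewrite ler_wsqrtr// cauchy_schwarz.
Qed.

Lemma L2_bounded (f : T -> R) (M : R) : (mu D < +oo)%E -> measurable_fun D f ->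
  (forall x, D x -> `|f x| <= M) -> L2 mu D f.
Proof.
move=> Doo mf fM; split => //.
apply: (@le_lt_trans _ _ (\int[mu]_(x in D) (M ^+ 2)%:E)%E).
  apply: ge0_le_integralW => x Dx; rewrite lee_fin ?sqr_ge0//.
  by rewrite -(real_normK (num_real (f x))) lerXn2r ?nnegrE// ?(le_trans _ (fM x Dx))// fM.
by rewrite integral_cst// lte_mul_pinfty// lee_fin sqr_ge0.
Qed.

End cauchy_schwarz.

(** * Bump functions on an interval *)

Section bounded_support.
Context d (T : measurableType d) (R : realType).
Variable mu : {measure set T -> \bar R}.

Lemma indic_integrable (D E : set T) : measurable D -> (mu D < +oo)%E ->
  measurable E -> mu.-integrable E (EFin \o (\1_D : T -> R)).
Proof.
move=> mD Doo mE; apply/integrableP; split.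
  exact/measurable_EFinP/measurable_funTS/measurable_indic.
apply: le_lt_trans Doo.
under eq_integral do rewrite gee0_abs ?lee_fin//.
by rewrite integral_indic// le_measure// ?inE//; exact: measurableI.
Qed.

Lemma bounded_support_integrable (D E : set T) (f : T -> R) (M : R) :
  measurable D -> (mu D < +oo)%E -> measurable E -> measurable_fun E f ->
  (forall x, E x -> `|f x| <= M) -> (forall x, E x -> ~ D x -> f x = 0) ->
  mu.-integrable E (EFin \o f).
Proof.
move=> mD Doo mE mf fM f0.
have h : mu.-integrable E (EFin \o (fun x => M * \1_D x)).
  exact: (integrableZl mE M (indic_integrable mD Doo mE)).
apply: le_integrable h => //; first exact/measurable_EFinP.
move=> x Ex /=; rewrite lee_fin; have [Dx|nDx] := pselect (D x).
  by rewrite indicE mem_set// mulr1; apply: le_trans (ler_norm _); exact: fM.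
by rewrite f0// normr0.
Qed.

End bounded_support.

Section bumps.
Context {R : realType}.
Implicit Types (a b x y t : R) (n : nat).

(** Each point of a compact set inside the interval keeps a margin from both ends that also serves
    its neighbours; compactness yields one margin for the whole set. *)
Lemma test_fun_itv a b (f : R -> R) : test_fun `]a, b[%classic f ->
  exists c d, [/\ a < c, d < b & forall x, ~ (c <= x <= d) -> f x = 0].
Proof.
move=> /test_funP[_ [K [cK KU f0]]].
have hK : \forall e \near 0^'+, K `<=` (fun x => is_true (a + e <= x <= b - e)).
  apply: ((compact_near_coveringP K).1 cK R (0^'+) (fun e x => is_true (a + e <= x <= b - e))).
  move=> x /KU; rewrite /= in_itv/= => /andP[ax xb].
  pose e := Num.min (x - a) (b - x) / 2.
  have [e1 e2] : e <= (x - a) / 2 /\ e <= (b - x) / 2.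
    by rewrite !ler_pM2r// !ge_min !lexx orbT.
  have e0 : 0 < e by rewrite divr_gt0// lt_min !subr_gt0 ax.
  exists (ball x e, [set e' | e' < e]).
    by split; [exact: nbhsx_ballx|exact: nbhs_right_lt].
  move=> [x' e'] /= [+ e'e]; rewrite /ball/= ltr_distl => /andP[x1 x2].
  by apply/andP; split; lra.
near (0 : R)^'+ => e.
have e0 : 0 < e by near: e; exact: nbhs_right_gt.
have he : forall x, K x -> a + e <= x <= b - e by near: e.
exists (a + e), (b - e); split; [by lra|by lra|].
by move=> x nx; apply: f0 => /he.
Unshelve. all: by end_near. Qed.

Lemma flat1_ge0 t : 0 <= flat 1 t.
Proof. by rewrite /flat; case: ifP => // _; rewrite hornerC mul1r expR_ge0. Qed.

Lemma flat1_le1 t : flat 1 t <= 1.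
Proof.
rewrite /flat; case: ifPn => // t0.
by rewrite hornerC mul1r -expR0 ler_expR oppr_le0 invr_ge0 ltW.
Qed.

Lemma flat1_gt t : 0 < t -> 1 - t^-1 <= flat 1 t.
Proof. by move=> t0; rewrite /flat t0 hornerC mul1r; exact: expR_ge1Dx. Qed.

(** A smooth approximation of the indicator of ]x, y[ from below. The support is inset by (y - x)/(n
    + 3), at most a third of the length, so the two ends never cross; the slope n drives the
    arguments of [flat 1] to infinity, since n times the inset stays below y - x. *)
Definition flat_bump x y n t : R :=
  flat 1 (n%:R * (t - (x + (y - x) / n.+3%:R))) *
  flat 1 (- n%:R * (t - (y - (y - x) / n.+3%:R))).

Lemma bump_ge0 x y n t : 0 <= flat_bump x y n t.
Proof. by rewrite mulr_ge0// flat1_ge0. Qed.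

Lemma bump_le1 x y n t : flat_bump x y n t <= 1.
Proof. by rewrite mulr_ile1// ?flat1_ge0 ?flat1_le1. Qed.

Lemma bump_test a b x y n : a <= x -> x < y -> y <= b ->
  test_fun `]a, b[%classic (flat_bump x y n).
Proof.
move=> ax xy yb; apply/test_funP; split.
  by apply: smooth_mul; apply: smooth_affine; exact: smooth_flat.
have e0 : 0 < (y - x) / n.+3%:R by rewrite divr_gt0// subr_gt0.
rewrite /flat_bump; move: e0; set e := (y - x) / n.+3%:R => e0.
exists `[x + e, y - e]%classic; split.
- exact: segment_compact.
- by move=> t; rewrite /= !in_itv/= => /andP[? ?]; apply/andP; split; lra.
- move=> t; rewrite /= in_itv/= => /negP; rewrite negb_and -!ltNge => /orP[h|h].
  + rewrite [X in X * _](_ : _ = 0) ?mul0r// /flat ifF//; apply/negbTE.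
    by rewrite -leNgt mulr_ge0_le0// subr_le0 ltW.
  + rewrite [X in _ * X](_ : _ = 0) ?mulr0// /flat ifF//; apply/negbTE.
    by rewrite -leNgt mulNr oppr_le0 mulr_ge0// subr_ge0 ltW.
Qed.

Lemma bump_cvg x y t : x < y ->
  flat_bump x y n t @[n --> \oo] --> (\1_(`]x, y[%classic) t : R).
Proof.
move=> xy; rewrite indicE; case: (boolP (t \in _)) => [|nt]; last first.
  rewrite (_ : (fun n => _) = cst 0); first exact: cvg_cst.
  apply/funext => n /=; apply: (test_fun0 (U := `]x, y[%classic)).
    exact: bump_test.
  by move=> ?; move: nt; rewrite mem_set.
rewrite inE/= in_itv/= => /andP[xt ty].
apply/cvgrPdist_le => e0' e0'0; have [e [ee e0]] : exists e : R, e = e0' /\ 0 < e by exists e0'.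
rewrite -{}ee {e0' e0'0}.
pose m := Num.min (t - x) (y - t).
have m0 : 0 < m by rewrite lt_min !subr_gt0 xt.
near=> n.
(* Past this threshold both arguments of [flat 1] are at least 2 / e even after losing n times the
   inset; each factor is then at least 1 - e / 2 and the product at least 1 - e. *)
have hn : (y - x + 2 / e) / m <= n%:R by near: n; exact: nbhs_infty_ger.
have {}hn : y - x + 2 / e <= n%:R * m by rewrite -ler_pdivrMr.
have hd : n%:R * ((y - x) / n.+3%:R) <= y - x.
  rewrite mulrCA ler_piMr//; first by rewrite subr_ge0 ltW.
  by rewrite ler_pdivrMr// mul1r ler_nat; lia.
have n0 : 0 <= n%:R :> R by [].
have mx : n%:R * m <= n%:R * (t - x) by rewrite ler_wpM2l// ge_min lexx.
have my : n%:R * m <= n%:R * (y - t) by rewrite ler_wpM2l// ge_min lexx orbT.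
have e2 : 0 < 2 / e by rewrite divr_gt0.
have H s : 2 / e <= s -> 1 - e / 2 <= flat 1 s.
  move=> hs; have s0 : 0 < s by exact: lt_le_trans hs.
  apply: le_trans (flat1_gt s0); rewrite lerD2l lerN2 -[leRHS]invrK lef_pV2 ?posrE//.
    by rewrite invf_div.
  by rewrite invr_gt0 divr_gt0.
have := H (n%:R * (t - (x + (y - x) / n.+3%:R))).
have := H (- n%:R * (t - (y - (y - x) / n.+3%:R))).
rewrite ger0_norm ?subr_ge0 ?bump_le1//.
set s1 := (X in 2 / e <= X -> _); set s2 := (X in _ -> (2 / e <= X -> _) -> _).
have -> : s1 = n%:R * (y - t) - n%:R * ((y - x) / n.+3%:R) by rewrite /s1; ring.
have -> : s2 = n%:R * (t - x) - n%:R * ((y - x) / n.+3%:R) by rewrite /s2; ring.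
rewrite /flat_bump -/s1 -/s2.
move: (flat1_ge0 s1) (flat1_le1 s1) (flat1_ge0 s2) (flat1_le1 s2).
move: (flat 1 s1) (flat 1 s2) => u v u0 u1 v0 v1 h2 h1.
move: hn hd mx my h1 h2; move: (n%:R * m) (n%:R * ((y - x) / n.+3%:R)) (n%:R * (t - x)).
move: (n%:R * (y - t)) (2 / e) => A B C D E hn hd mx my h1 h2.
have {}h1 : 1 - e / 2 <= v by apply: h1; lra.
have {}h2 : 1 - e / 2 <= u by apply: h2; lra.
nra.
Unshelve. all: by end_near. Qed.

Lemma measurable_bump x y n : x < y -> measurable_fun setT (flat_bump x y n).
Proof.
move=> xy; apply: continuous_measurable_fun; apply: smooth_continuous.
exact: test_fun_smooth (bump_test n (lexx x) xy (lexx y)).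
Qed.

Lemma bump_le_indic x y n t : x < y -> flat_bump x y n t <= \1_(`]x, y[%classic) t.
Proof.
move=> xy; rewrite indicE; case: (boolP (t \in _)) => [_|nt].
  exact: bump_le1.
rewrite (test_fun0 (bump_test n (lexx x) xy (lexx y)))// => h.
by move: nt; rewrite mem_set.
Qed.

Lemma leb1_oo x y : x < y -> leb1 `]x, y[%classic = (y - x)%:E.
Proof.
move=> xy; have := @lebesgue_measure_itv R `]x, y[.
by rewrite /= lte_fin xy -EFinD; apply.
Qed.

Lemma leb1_oo_lty x y : (leb1 `]x, y[%classic < +oo)%E.
Proof.
have := @lebesgue_measure_itv R `]x, y[; rewrite /= => ->.
by case: ifP => _; rewrite -?EFinD ltry.
Qed.

Lemma test_fun_measurable a b (f : R -> R) :
  test_fun `]a, b[%classic f -> measurable_fun [set: measurableTypeR R] f.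
Proof.
by move=> tf; apply: continuous_measurable_fun; apply: smooth_continuous; case: tf.
Qed.

Lemma test_fun_integrable a b (f : R -> R) :
  test_fun `]a, b[%classic f -> leb1.-integrable setT (EFin \o f).
Proof.
move=> tf; have [M M0 fM] := test_fun_bounded tf.
apply: (@bounded_support_integrable _ (measurableTypeR R) R leb1
  `]a, b[%classic setT f M) => //.
- exact: leb1_oo_lty.
- exact: test_fun_measurable tf.
- by move=> x _ nx; exact: test_fun0 tf nx.
Qed.

Lemma bump_integral_cvg x y : x < y ->
  \int[leb1]_t flat_bump x y n t @[n --> \oo] --> y - x.
Proof.
move=> xy; apply: fine_cvg.
rewrite -(leb1_oo xy) -[leb1 _]/(leb1 `]x, y[%classic) -[X in leb1 X]setIT.
rewrite -integral_indic//.
apply: (@dominated_cvg _ _ _ leb1 setT measurableT (fun n t => (flat_bump x y n t)%:E)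
  (fun t => (\1_(`]x, y[%classic) t)%:E) (fun t => (\1_(`]x, y[%classic) t)%:E)) => //.
- by move=> n; apply/measurable_EFinP; exact: measurable_bump.
- by move=> t _; apply: cvg_EFin; [exact: nearW|exact: bump_cvg].
- exact: integrable_indic_itv.
- by move=> n t _ /=; rewrite lee_fin ger0_norm ?bump_ge0// bump_le_indic.
Qed.

(** The integrals of the bumps tend to b - a, so one of them exceeds (b - a)/2. Dividing that bump,
    which is at most 1, by its integral gives the bound 2/(b - a). *)
Lemma weight_exists a b : a < b -> exists w : R -> R,
  [/\ test_fun `]a, b[%classic w, forall x, 0 <= w x <= 2 / (b - a) &
      \int[leb1]_x w x = 1].
Proof.
move=> ab; have ba : 0 < b - a by rewrite subr_gt0.
have h : (b - a) / 2 < b - a by rewrite gtr_pMr// invf_lt1// ltr1n.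
have /(cvgr_gt (b - a))/(_ _ h)[N _ /(_ N (leqnn N))/= hN] := bump_integral_cvg ab.
set I := \int[leb1]_t flat_bump a b N t in hN.
have I0 : 0 < I by apply: lt_trans hN; rewrite divr_gt0.
exists (fun x => I^-1 * flat_bump a b N x); split.
- by apply: test_fun_scale; exact: bump_test.
- have I10 : 0 <= I^-1 by rewrite invr_ge0 ltW.
  move=> x; apply/andP; split; first by rewrite mulr_ge0// bump_ge0.
  apply: (@le_trans _ _ I^-1); first by rewrite ler_piMr// bump_le1.
  rewrite -[2 / _]invf_div lef_pV2 ?posrE ?divr_gt0//; exact: ltW.
- rewrite RintegralZl// -/I ?mulVf ?gt_eqF//.
  exact: test_fun_integrable (bump_test N (lexx a) ab (lexx b)).
Qed.

Lemma bump_sqn x y (e : R) : x < y -> 0 < e -> exists n,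
  (sqn leb1 setT (fun t => (\1_(`]x, y[%classic) t - flat_bump x y n t)%R) < e%:E)%E.
Proof.
move=> xy e0.
have h : sqn leb1 setT (fun t => \1_(`]x, y[%classic) t - flat_bump x y n t)
    @[n --> \oo] --> (\int[leb1]_(t in setT) (cst 0 t))%E.
  apply: (@dominated_cvg _ _ _ leb1 setT measurableT
    (fun n t => ((\1_(`]x, y[%classic) t - flat_bump x y n t) ^+ 2)%:E) (fun=> 0%E)
    (fun t => (\1_(`]x, y[%classic) t)%:E)) => //.
  - move=> n; apply: measurable_sqr; apply: measurable_funB => //.
    exact: measurable_bump.
  - move=> t _; apply: cvg_EFin; first exact: nearW.
    rewrite -[0](expr0n _ 2) -(subrr (\1_(`]x, y[%classic) t)).
    by rewrite expr2; apply: cvgM; apply: cvgB; (exact: cvg_cst || exact: bump_cvg).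
  - exact: integrable_indic_itv.
  - move=> n t _ /=; rewrite lee_fin ger0_norm ?sqr_ge0//.
    have := bump_le_indic n t xy; have := bump_ge0 x y n t.
    by rewrite indicE; case: (_ \in _) => /=; nra.
rewrite integral0 in h.
have [N _ /(_ N (leqnn N)) hN] : \forall n \near \oo,
    (sqn leb1 setT (fun t => (\1_(`]x, y[%classic) t - flat_bump x y n t)%R) < e%:E)%E.
  have [h1 h2] := (fine_cvgP _ _).1 h; near=> n.
  have hn : (sqn leb1 setT (fun t => \1_(`]x, y[%classic) t - flat_bump x y n t)) \is a fin_num.
    by near: n.
  rewrite -(fineK hn) lte_fin; near: n; exact: (cvgr_lt _ h2).
by exists N.
Unshelve. all: by end_near. Qed.

End bumps.

(** * Decomposition of test functions on products *)

Section restrict.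
Context d (T : measurableType d) (R : realType).
Variable mu : {measure set T -> \bar R}.

Lemma sqn_restrict (D E : set T) (f : T -> R) : D `<=` E ->
  (forall x, E x -> ~ D x -> f x = 0) -> sqn mu D f = sqn mu E f.
Proof.
move=> DE f0; rewrite /sqn integral_mkcond [RHS]integral_mkcond.
apply: eq_integral => x _; rewrite !patchE.
have [Dx|nDx] := pselect (D x); first by rewrite !mem_set//; exact: DE.
rewrite memNset//; case: ifPn => // /set_mem Ex.
by rewrite f0// expr0n.
Qed.

Lemma Rintegral_restrict (D E : set T) (f : T -> R) : D `<=` E ->
  (forall x, E x -> ~ D x -> f x = 0) ->
  \int[mu]_(x in D) f x = \int[mu]_(x in E) f x.
Proof.
move=> DE f0; rewrite Rintegral_mkcond [RHS]Rintegral_mkcond.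
apply: eq_Rintegral => x _; rewrite !patchE.
have [Dx|nDx] := pselect (D x); first by rewrite !mem_set//; exact: DE.
rewrite memNset//; case: ifPn => // /set_mem Ex.
by rewrite f0.
Qed.

End restrict.

Section operators.
Context d (T : measurableType d) (R : realType).
Implicit Types (V : (T -> R) -> Prop) (M : (T -> R) -> (T -> R)).

(** Linearity is required on [V] only: the operators below contain integrals, which are additive on
    integrable functions but not on arbitrary ones. *)
Definition linop V M :=
  [/\ forall f, V f -> V (M f),
      forall f g, V f -> V g ->
        M (fun x => f x + g x) = (fun x => M f x + M g x) &
      forall c f, V f -> M (fun x => c * f x) = (fun x => c * M f x)].

Definition l2bd (mu : {measure set T -> \bar R}) V M (C : R) :=
  forall f, V f -> (sqn mu setT (M f) <= C%:E * sqn mu setT f)%E.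

Definition vclass V :=
  [/\ forall f g, V f -> V g -> V (fun x => f x + g x),
      forall (c : R) f, V f -> V (fun x => c * f x) &
      forall f, V f -> measurable_fun setT f].

Lemma linop_comp V M N : linop V M -> linop V N -> linop V (fun f => M (N f)).
Proof.
move=> [M1 M2 M3] [N1 N2 N3]; split.
- by move=> f /N1/M1.
- by move=> f g Vf Vg; rewrite N2// M2//; exact: N1.
- by move=> c f Vf; rewrite N3// M3//; exact: N1.
Qed.

Lemma l2bd_comp mu V M N (C K : R) : 0 <= C -> linop V N ->
  l2bd mu V M C -> l2bd mu V N K -> l2bd mu V (fun f => M (N f)) (C * K).
Proof.
move=> C0 [N1 _ _] bM bN f Vf; apply: le_trans (bM _ (N1 _ Vf)) _.
by rewrite EFinM -muleA lee_wpmul2l ?lee_fin//; exact: bN.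
Qed.

Lemma l2bd_le mu V M (C K : R) : C <= K -> l2bd mu V M C -> l2bd mu V M K.
Proof.
move=> CK bM f Vf; apply: le_trans (bM _ Vf) _.
by rewrite lee_wpmul2r ?lee_fin// sqn_ge0.
Qed.

(* [D i], [A i] (i < n): coordinate derivatives and averaged primitives;
   [P] replaces a function by a multiple of the weight [w]. *)
Definition poinc mu V n (D A : nat -> (T -> R) -> T -> R) P (w : T -> R) (h : R) :=
  [/\ forall i, (i < n)%N -> linop V (A i) /\ l2bd mu V (A i) (4 ^+ n * h ^+ 2),
      linop V P /\ l2bd mu V P (4 ^+ n),
      forall f x, V f -> f x - P f x = \sum_(i < n) D i (A i f) x,
      forall f, V f -> exists J : R, P f = (fun x => J * w x) &
      V w].

End operators.

Section products.
Context d1 d2 (T1 : measurableType d1) (T2 : measurableType d2) (R : realType).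
Variables (m1 : {sigma_finite_measure set T1 -> \bar R})
          (m2 : {sigma_finite_measure set T2 -> \bar R}).

(** The algebraic tensor product. On finite sums of products an operator in one variable visibly
    returns a function of the same class; for general test functions this would need differentiation
    under the integral sign. *)
Inductive tens (V1 : (T1 -> R) -> Prop) (V2 : (T2 -> R) -> Prop) :
  (T1 * T2 -> R) -> Prop :=
| tens_prod f g of V1 f & V2 g : tens V1 V2 (fun p => f p.1 * g p.2)
| tens_add f g of tens V1 V2 f & tens V1 V2 g :
    tens V1 V2 (fun p => f p + g p).

Definition lf (M : (T1 -> R) -> (T1 -> R)) (f : T1 * T2 -> R) : T1 * T2 -> R :=
  fun p => M (fun x => f (x, p.2)) p.1.

Definition ls (M : (T2 -> R) -> (T2 -> R)) (f : T1 * T2 -> R) : T1 * T2 -> R :=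
  fun p => M (fun y => f (p.1, y)) p.2.

Lemma measurable_tensor (f : T1 -> R) (g : T2 -> R) : measurable_fun setT f ->
  measurable_fun setT g -> measurable_fun setT (fun p : T1 * T2 => f p.1 * g p.2).
Proof. by move=> mf mg; apply: measurable_funM; exact: measurableT_comp. Qed.

Lemma vclass_tens V1 V2 : vclass V1 -> vclass V2 -> vclass (tens V1 V2).
Proof.
move=> [V1D V1Z V1m] [V2D V2Z V2m]; split.
- by move=> f g; exact: tens_add.
- move=> c f; elim=> [f' g' Vf Vg|f' g' _ If _ Ig].
    rewrite [X in tens _ _ X](_ : _ = fun p => (c * f' p.1) * g' p.2).
      by apply: (tens_prod (f := fun x => c * f' x)) => //; exact: V1Z.
    by apply/funext => p; rewrite mulrA.
  rewrite [X in tens _ _ X](_ : _ = fun p => c * f' p + c * g' p).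
    exact: tens_add.
  by apply/funext => p; rewrite mulrDr.
- move=> f; elim=> [f' g' /V1m mf /V2m mg|f' g' _ If _ Ig].
    exact: measurable_tensor.
  exact: measurable_funD.
Qed.

Lemma tens_slice1 V1 V2 f y : vclass V1 -> tens V1 V2 f ->
  V1 (fun x => f (x, y)).
Proof.
move=> [VD VZ _]; elim=> [f' g' Vf Vg|f' g' _ If _ Ig] /=; last exact: VD.
rewrite [X in V1 X](_ : _ = fun x => g' y * f' x); first exact: VZ.
by apply/funext => x; rewrite mulrC.
Qed.

Lemma tens_slice2 V1 V2 f x : vclass V2 -> tens V1 V2 f ->
  V2 (fun y => f (x, y)).
Proof.
move=> [VD VZ _]; elim=> [f' g' Vf Vg|f' g' _ If _ Ig] /=; last exact: VD.
exact: VZ.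
Qed.

Lemma linop_lf V1 V2 M : vclass V1 -> linop V1 M -> linop (tens V1 V2) (lf M).
Proof.
move=> V1c [M1 M2 M3]; have Madd f g : tens V1 V2 f -> tens V1 V2 g ->
    lf M (fun p => f p + g p) = (fun p => lf M f p + lf M g p).
  by move=> tf tg; apply/funext => p; rewrite /lf M2//; [exact: tens_slice1 V1c tf|exact: tens_slice1 V1c tg].
split => //.
- move=> f; elim=> [f' g' Vf Vg|f' g' tf If tg Ig].
    rewrite [X in tens _ _ X](_ : _ = fun p => M f' p.1 * g' p.2).
      by apply: tens_prod => //; exact: M1.
    apply/funext => p; rewrite /lf/=.
    rewrite [X in M X](_ : _ = fun x => g' p.2 * f' x) ?M3// 1?mulrC//.
    by apply/funext => x; rewrite mulrC.
  by rewrite Madd//; exact: tens_add.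
- by move=> c f tf; apply/funext => p; rewrite /lf M3//; exact: tens_slice1 V1c tf.
Qed.

Lemma linop_ls V1 V2 M : vclass V2 -> linop V2 M -> linop (tens V1 V2) (ls M).
Proof.
move=> V2c [M1 M2 M3]; have Madd f g : tens V1 V2 f -> tens V1 V2 g ->
    ls M (fun p => f p + g p) = (fun p => ls M f p + ls M g p).
  by move=> tf tg; apply/funext => p; rewrite /ls M2//; [exact: tens_slice2 V2c tf|exact: tens_slice2 V2c tg].
split => //.
- move=> f; elim=> [f' g' Vf Vg|f' g' tf If tg Ig].
    rewrite [X in tens _ _ X](_ : _ = fun p => f' p.1 * M g' p.2).
      by apply: tens_prod => //; exact: M1.
    by apply/funext => p; rewrite /ls/= M3.
  by rewrite Madd//; exact: tens_add.
- by move=> c f tf; apply/funext => p; rewrite /ls M3//; exact: tens_slice2 V2c tf.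
Qed.

Lemma sqn_prod1 (f : T1 * T2 -> R) : measurable_fun setT f ->
  sqn (prodm m1 m2) setT f =
  (\int[m2]_y sqn m1 setT (fun x => f (x, y)))%E.
Proof.
move=> mf; rewrite /sqn.
apply: (@fubini_tonelli2 _ _ _ _ _ m1 m2 (fun p => ((f p) ^+ 2)%:E)).
  exact: measurable_sqr.
by move=> p; rewrite lee_fin sqr_ge0.
Qed.

Lemma sqn_prod2 (f : T1 * T2 -> R) : measurable_fun setT f ->
  sqn (prodm m1 m2) setT f =
  (\int[m1]_x sqn m2 setT (fun y => f (x, y)))%E.
Proof.
move=> mf; rewrite /sqn.
apply: (@fubini_tonelli1 _ _ _ _ _ m1 m2 (fun p => ((f p) ^+ 2)%:E)).
  exact: measurable_sqr.
by move=> p; rewrite lee_fin sqr_ge0.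
Qed.

Lemma measurable_sqn_slice1 (f : T1 * T2 -> R) : measurable_fun setT f ->
  measurable_fun setT (fun y => sqn m1 setT (fun x => f (x, y))).
Proof.
move=> mf; apply: (@measurable_fun_fubini_tonelli_G _ _ _ _ _ m1 (fun p => ((f p) ^+ 2)%:E)).
  exact: measurable_sqr.
by move=> p; rewrite lee_fin sqr_ge0.
Qed.

Lemma measurable_sqn_slice2 (f : T1 * T2 -> R) : measurable_fun setT f ->
  measurable_fun setT (fun x => sqn m2 setT (fun y => f (x, y))).
Proof.
move=> mf; apply: (@measurable_fun_fubini_tonelli_F _ _ _ _ _ m2 (fun p => ((f p) ^+ 2)%:E)).
  exact: measurable_sqr.
by move=> p; rewrite lee_fin sqr_ge0.
Qed.

(** By Tonelli the squared norm is the integral of the squared norms of the slices; the bound holds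
    on each slice, so the constant does not change. *)
Lemma l2bd_lf V1 V2 M C : 0 <= C -> vclass V1 -> vclass V2 -> linop V1 M ->
  l2bd m1 V1 M C -> l2bd (prodm m1 m2) (tens V1 V2) (lf M) C.
Proof.
move=> C0 V1c V2c lM bM f tf.
have [Mt _ _] := linop_lf V2 V1c lM.
have [_ _ Vm] := vclass_tens V1c V2c.
rewrite (sqn_prod1 (Vm _ tf)) (sqn_prod1 (Vm _ (Mt _ tf))).
rewrite -ge0_integralZl//; last 2 first.
- by apply: measurable_sqn_slice1; exact: Vm.
- by move=> z _; exact: sqn_ge0.
apply: ge0_le_integralW => y _; first exact: sqn_ge0.
exact: (bM _ (tens_slice1 y V1c tf)).
Qed.

Lemma l2bd_ls V1 V2 M C : 0 <= C -> vclass V1 -> vclass V2 -> linop V2 M ->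
  l2bd m2 V2 M C -> l2bd (prodm m1 m2) (tens V1 V2) (ls M) C.
Proof.
move=> C0 V1c V2c lM bM f tf.
have [Mt _ _] := linop_ls V1 V2c lM.
have [_ _ Vm] := vclass_tens V1c V2c.
rewrite (sqn_prod2 (Vm _ tf)) (sqn_prod2 (Vm _ (Mt _ tf))).
rewrite -ge0_integralZl//; last 2 first.
- by apply: measurable_sqn_slice2; exact: Vm.
- by move=> z _; exact: sqn_ge0.
apply: ge0_le_integralW => x _; first exact: sqn_ge0.
exact: (bM _ (tens_slice2 x V2c tf)).
Qed.

(** On a product the lifted operator yields J w(x) g(y); the scalar J is absorbed into g, and the
    resulting functions of the second variable add up. *)
Lemma lf_weight V1 V2 P w : vclass V1 -> vclass V2 -> linop V1 P ->
  (forall f, V1 f -> exists J : R, P f = (fun x => J * w x)) ->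
  forall f, tens V1 V2 f ->
  exists g, V2 g /\ lf P f = (fun p => w p.1 * g p.2).
Proof.
move=> V1c [V2D V2Z _] lP PJ f.
elim=> [f' g' Vf Vg|f' g' tf [g1 [Vg1 E1]] tg [g2 [Vg2 E2]]].
  have [_ _ P3] := lP.
  have [J PfJ] := PJ _ Vf; exists (fun y => J * g' y); split; first exact: V2Z.
  apply/funext => p; rewrite /lf/=.
  rewrite [X in P X](_ : _ = fun x => g' p.2 * f' x); last first.
    by apply/funext => x; rewrite mulrC.
  by rewrite P3// PfJ; ring.
exists (fun y => g1 y + g2 y); split; first exact: V2D.
have [_ lfD _] := linop_lf V2 V1c lP.
by rewrite lfD// E1 E2; apply/funext => p; rewrite mulrDr.
Qed.

Lemma ls_weight V1 V2 P w : vclass V1 -> vclass V2 -> linop V2 P ->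
  (forall f, V2 f -> exists J : R, P f = (fun x => J * w x)) ->
  forall f, tens V1 V2 f ->
  exists g, V1 g /\ ls P f = (fun p => g p.1 * w p.2).
Proof.
move=> [V1D V1Z _] V2c lP PJ f.
elim=> [f' g' Vf Vg|f' g' tf [g1 [Vg1 E1]] tg [g2 [Vg2 E2]]].
  have [_ _ P3] := lP.
  have [J PfJ] := PJ _ Vg; exists (fun y => J * f' y); split; first exact: V1Z.
  by apply/funext => p; rewrite /ls/= P3// PfJ; ring.
exists (fun y => g1 y + g2 y); split; first exact: V1D.
have [_ lsD _] := linop_ls V1 V2c lP.
by rewrite lsD// E1 E2; apply/funext => p; rewrite mulrDl.
Qed.

(** Insert the partially averaged function: f - P' P f = (f - P f) + (P f - P' P f). The first
    bracket is decomposed by the operators of the first factor, the second by the one new operator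
    applied to [lf P f]. That composition costs 4^n times 4 h^2, whence the constant 4^(n+1) h^2. *)
Lemma poinc_prod V1 V2 n D A P w D' A' P' w' h :
  vclass V1 -> vclass V2 ->
  poinc m1 V1 n D A P w h -> poinc m2 V2 1 D' A' P' w' h ->
  poinc (prodm m1 m2) (tens V1 V2) n.+1
    (fun i => if (i < n)%N then lf (D i) else ls (D' 0%N))
    (fun i => if (i < n)%N then lf (A i) else (fun f => ls (A' 0%N) (lf P f)))
    (fun f => ls P' (lf P f)) (fun p => w p.1 * w' p.2) h.
Proof.
move=> V1c V2c [Ai [lP bP] DA PJ Vw] [A'0 [lP' bP'] D'A' P'J Vw'].
have [lA' bA'] := A'0 0%N isT.
have p4 k : 0 <= 4 ^+ k :> R by rewrite exprn_ge0.
have ph k : 0 <= 4 ^+ k * h ^+ 2 :> R by rewrite mulr_ge0// sqr_ge0.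
have llP := linop_lf V2 V1c lP.
split.
- move=> i _; case: ifPn => iltn.
    have [lAi bAi] := Ai i iltn; split; first exact: linop_lf.
    apply: (@l2bd_le _ _ _ _ _ _ (4 ^+ n * h ^+ 2)).
      by rewrite ler_wpM2r ?sqr_ge0// ler_weXn2l// ler1n.
    exact: l2bd_lf.
  split; first by apply: linop_comp => //; exact: linop_ls.
  have -> : 4 ^+ n.+1 * h ^+ 2 = (4 ^+ 1 * h ^+ 2) * 4 ^+ n :> R by rewrite exprS; ring.
  apply: (l2bd_comp (M := ls (A' 0%N))) => //; [exact: l2bd_ls|exact: l2bd_lf].
- split; first by apply: linop_comp => //; exact: linop_ls.
  rewrite exprS; apply: (l2bd_comp (M := ls P')) => //; last exact: l2bd_lf.
  rewrite -[4%R]expr1; exact: l2bd_ls.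
- move=> f p tf; rewrite big_ord_recr/= ltnn.
  under eq_bigr do rewrite ltn_ord.
  rewrite -[LHS](subrKA (lf P f p)); congr (_ + _).
    have := DA _ p.1 (tens_slice1 p.2 V1c tf).
    by rewrite -surjective_pairing.
  have tlf : tens V1 V2 (lf P f) by have [] := llP => + _ _; apply.
  have := D'A' _ p.2 (tens_slice2 p.1 V2c tlf).
  by rewrite -surjective_pairing big_ord_recl big_ord0 addr0.
- move=> f tf; have [g [Vg ->]] := lf_weight V1c V2c lP PJ tf.
  have [J P'g] := P'J _ Vg; exists J; apply/funext => p; rewrite /ls/=.
  have [_ _ P'Z] := lP'.
  by rewrite P'Z// P'g; ring.
- exact: tens_prod.
Qed.

End products.

(** * Averages and primitives on an interval *)

Section one_dimensional.
Context {R : realType}.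
Variables (a b : R) (w : R -> R).
Hypotheses (ab : a < b) (tw : test_fun `]a, b[%classic w)
  (w_bound : forall x, 0 <= w x <= 2 / (b - a)) (w_int : \int[leb1]_x w x = 1).
Let B : (measurableTypeR R -> R) -> Prop := test_fun `]a, b[%classic.

Definition avg_op (f : R -> R) (s : R) : R := (\int[leb1]_x f x) * w s.

(** A primitive of a test function is constant to the right of the support. Subtracting the multiple
    of [w] with the same integral makes this constant 0, so that the primitive is again a test
    function of the interval. *)
Definition prim_op (f : R -> R) (s : R) : R :=
  \int[leb1]_(u in `]-oo, s]) (f u - avg_op f u).

Lemma smoothS (f : R -> R) : (forall x, differentiable f x) ->
  (forall v, smooth ('D_v f)) -> smooth f.
Proof.
move=> df Df s x; case/lastP: s => [//|s v].
by rewrite iter_derive_rcons; exact: Df.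
Qed.

Lemma B_add f g : B f -> B g -> B (fun x => f x + g x).
Proof. exact: test_fun_add. Qed.

Lemma B_scale c f : B f -> B (fun x => c * f x).
Proof. exact: test_fun_scale. Qed.

Lemma vclass_B : vclass B.
Proof.
split; [exact: B_add|exact: B_scale|].
by move=> f; exact: test_fun_measurable.
Qed.

Lemma B_integrable f : B f -> leb1.-integrable setT (EFin \o f).
Proof. exact: test_fun_integrable. Qed.

Lemma int_add f g : B f -> B g ->
  \int[leb1]_x (f x + g x) = \int[leb1]_x f x + \int[leb1]_x g x.
Proof. by move=> Bf Bg; rewrite RintegralD//; exact: B_integrable. Qed.

Lemma int_scale c f : B f -> \int[leb1]_x (c * f x) = c * \int[leb1]_x f x.
Proof. by move=> Bf; rewrite RintegralZl//; exact: B_integrable. Qed.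

Lemma avg_opB f : B f -> B (avg_op f).
Proof. by move=> Bf; exact: B_scale. Qed.

Lemma linop_avg : linop B avg_op.
Proof.
split; first exact: avg_opB.
- by move=> f g Bf Bg; apply/funext => s; rewrite /avg_op int_add// mulrDl.
- by move=> c f Bf; apply/funext => s; rewrite /avg_op int_scale// mulrA.
Qed.

Let res (f : R -> R) : R -> R := fun u => f u - avg_op f u.

Lemma resB f : B f -> B (res f).
Proof.
move=> Bf; have := B_add Bf (B_scale (-1) (avg_opB Bf)).
by congr B; apply/funext => x; rewrite /res mulN1r.
Qed.

Lemma res_int f : B f -> \int[leb1]_x res f x = 0.
Proof.
move=> Bf; rewrite RintegralB//; [|exact: B_integrable|exact/B_integrable/avg_opB].
by rewrite int_scale// w_int mulr1 subrr.
Qed.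

Lemma prim_derive f x : B f -> derivable (prim_op f) x 1 /\ 'D_1 (prim_op f) x = res f x.
Proof.
move=> Bf; have xu : x < x + 1 by rewrite ltrDl.
have ires : leb1.-integrable `]-oo, (x + 1)%R] (EFin \o res f).
  by apply: (integrableS _ _ _ (B_integrable (resB Bf))).
have cres : {for x, continuous (res f)}.
  by apply: smooth_continuous; case: (resB Bf).
have [|h1 h2] := @continuous_FTC1 R (res f) -oo%O x (x + 1) xu ires _ cres.
  by rewrite ltNyr.
by split; [exact: h1|rewrite -derive1E; exact: h2].
Qed.

Lemma prim_opB f : B f -> B (prim_op f).
Proof.
move=> Bf; have dp x : differentiable (prim_op f) x.
  by apply/derivable1_diffP; exact: (prim_derive x Bf).1.
apply/test_funP; split.
  apply: smoothS => // v.
  rewrite (_ : 'D_v _ = fun x => v * res f x).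
    by apply: smooth_scale; case: (resB Bf).
  by apply/funext => x; rewrite derive1R// derive1E (prim_derive x Bf).2.
have [c [e [ac eb r0]]] := test_fun_itv (resB Bf).
exists `[c, e]%classic; split.
- exact: segment_compact.
- by move=> x /=; rewrite !in_itv/= => /andP[? ?]; apply/andP; split; lra.
move=> x /=; rewrite in_itv/= => nx.
have [xc|cx] := ltP x c.
  rewrite /prim_op /Rintegral integral0_eq// => u; rewrite /= in_itv/= => ux.
  by rewrite [X in X%:E](r0 u)// => /andP[cu _]; move: (le_lt_trans ux xc); rewrite ltNge cu.
rewrite /prim_op (@Rintegral_restrict _ (measurableTypeR R) R leb1 `]-oo, x]%classic setT (res f))//.
  exact: res_int.
move=> u _ nu; apply: r0 => /andP[cu ue]; apply: nx; rewrite cx/=.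
by move: nu; rewrite /= in_itv/= => /negP; rewrite -ltNge => /ltW /le_trans; apply.
Qed.

Lemma linop_prim : linop B prim_op.
Proof.
have ires s f : B f -> leb1.-integrable `]-oo, s]%classic (EFin \o res f).
  by move=> Bf; apply: (integrableS _ _ _ (B_integrable (resB Bf))).
split; first exact: prim_opB.
- move=> f g Bf Bg; apply/funext => s; rewrite /prim_op.
  rewrite -RintegralD//; [|exact: ires..].
  apply: eq_Rintegral => u _; rewrite /avg_op int_add//; ring.
- move=> c f Bf; apply/funext => s; rewrite /prim_op.
  rewrite -RintegralZl//; last exact: ires.
  apply: eq_Rintegral => u _; rewrite /avg_op int_scale//; ring.
Qed.

Lemma B_norm_integrable f : B f -> leb1.-integrable setT (EFin \o (fun x => `|f x|)).
Proof. by move=> Bf; apply: integrable_norm; exact: B_integrable. Qed.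

(** The factor 2 counts [f] once and its average once more: the average has L^1 norm at most that of
    [f], because [w] is nonnegative with integral 1. *)
Lemma prim_bound f s : B f -> `|prim_op f s| <= 2 * \int[leb1]_x `|f x|.
Proof.
move=> Bf; have iT := B_integrable (resB Bf).
have is_ : leb1.-integrable `]-oo, s]%classic (EFin \o res f).
  by apply: (integrableS _ _ _ iT).
apply: le_trans (le_normr_Rintegral _ is_) _ => //.
apply: (@le_trans _ _ (\int[leb1]_x `|res f x|)).
  rewrite -lee_fin !fineK.
  - apply: ge0_subset_integral => //=.
    by have /integrableP[] := integrable_norm iT.
  - by apply: integrable_fin_num => //; exact: integrable_norm.
  - by apply: integrable_fin_num => //; exact: integrable_norm.
have aB := avg_opB Bf.
apply: (@le_trans _ _ (\int[leb1]_x (`|f x| + `|avg_op f x|))).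
  apply: le_Rintegral => //; first exact: B_norm_integrable (resB Bf).
    exact: (integrableD _ (B_norm_integrable Bf) (B_norm_integrable aB)).
  by move=> x _; exact: ler_normB.
rewrite RintegralD//; [|exact: B_norm_integrable..].
rewrite mulrDl mul1r lerD2l.
have -> : \int[leb1]_x `|avg_op f x| = `|\int[leb1]_x f x| * \int[leb1]_x w x.
  rewrite -RintegralZl//; last exact: B_integrable tw.
  apply: eq_Rintegral => x _; rewrite normrM [X in _ * X]ger0_norm//.
  by have /andP[] := w_bound x.
by rewrite w_int mulr1; apply: le_normr_Rintegral => //; exact: B_integrable.
Qed.

Lemma B_L2 f : B f -> L2 leb1 setT f.
Proof.
move=> Bf; have [M M0 fM] := test_fun_bounded Bf.
split; first exact: test_fun_measurable Bf.
rewrite -(sqn_restrict leb1 (D := `]a, b[%classic))//; last first.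
  by move=> x _ nx; exact: test_fun0 Bf nx.
apply: (L2_bounded (mu := leb1) (M := M) _ _ _ _).2 => //.
- exact: leb1_oo_lty.
- by apply: measurable_funTS; exact: test_fun_measurable Bf.
Qed.

Lemma int_norm_sqr f : B f ->
  (\int[leb1]_x `|f x|) ^+ 2 <= (b - a) * fine (sqn leb1 setT f).
Proof.
move=> Bf; have nB x : setT x -> ~ `]a, b[%classic x -> f x = 0.
  by move=> _ nx; exact: test_fun0 Bf nx.
rewrite -(Rintegral_restrict leb1 (D := `]a, b[%classic))//; last first.
  by move=> x _ nx; rewrite nB// normr0.
rewrite -(sqn_restrict leb1 (D := `]a, b[%classic))//.
have L2f : L2 leb1 `]a, b[%classic f.
  split; first by apply: measurable_funTS; exact: test_fun_measurable Bf.
  by rewrite (sqn_restrict leb1 (E := setT))//; exact: (B_L2 Bf).2.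
have L21 : L2 leb1 `]a, b[%classic (fun=> 1).
  by apply: (@L2_bounded _ _ _ _ _ _ _ 1) => //; [exact: leb1_oo_lty|rewrite normr1].
have := cauchy_schwarz _ L2f L21.
under eq_Rintegral do rewrite mulr1.
move=> /(_ _)/le_trans -> //; rewrite mulrC ler_wpM2r ?fine_ge0 ?sqn_ge0//.
rewrite /sqn; under eq_integral do rewrite expr1n.
by rewrite integral_cst//= mul1e leb1_oo.
Qed.

(** The constant: the squared integral of [f] is at most (b - a) |f|^2 by Cauchy-Schwarz, and |w|^2
    is at most (2/(b - a))^2 (b - a) = 4/(b - a). *)
Lemma l2bd_avg : l2bd leb1 B avg_op 4.
Proof.
move=> f Bf; have ba : 0 < b - a by rewrite subr_gt0.
rewrite (L2_fin (B_L2 Bf)) /avg_op sqn_scale//; last exact: test_fun_measurable tw.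
rewrite (L2_fin (B_L2 tw)) -!EFinM lee_fin.
have wB : fine (sqn leb1 setT w) <= 4 / (b - a).
  have Wx x : setT x -> ~ `]a, b[%classic x -> w x = 0.
    by move=> _ nx; exact: test_fun0 tw nx.
  rewrite -lee_fin -(L2_fin (B_L2 tw)) -(sqn_restrict leb1 (D := `]a, b[%classic))//.
  apply: (@le_trans _ _ (\int[leb1]_(x in `]a, b[%classic) ((2 / (b - a)) ^+ 2)%:E)%E).
    apply: ge0_le_integralW => x _; rewrite lee_fin ?sqr_ge0//.
    by have /andP[w0 w1] := w_bound x; rewrite lerXn2r ?nnegrE// (le_trans w0).
  rewrite integral_cst//= leb1_oo// -EFinM lee_fin expr_div_n.
  rewrite le_eqVlt; apply/orP; left; apply/eqP; by field; rewrite gt_eqF.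
have If : (\int[leb1]_x f x) ^+ 2 <= (b - a) * fine (sqn leb1 setT f).
  apply: le_trans (int_norm_sqr Bf); rewrite -(real_normK (num_real (\int[leb1]_x f x))).
  by rewrite lerXn2r ?nnegrE ?Rintegral_ge0//; apply: le_normr_Rintegral => //; exact: B_integrable.
apply: (@le_trans _ _ ((b - a) * fine (sqn leb1 setT f) * (4 / (b - a)))).
  by apply: ler_pM => //; rewrite ?sqr_ge0 ?fine_ge0 ?sqn_ge0.
rewrite le_eqVlt; apply/orP; left; apply/eqP; by field; rewrite gt_eqF.
Qed.

(** The primitive is bounded pointwise by 2 (b - a)^(1/2) |f|; squaring and integrating over a
    length b - a gives 4 (b - a)^2. This is the source of the gain h in the cell estimate. *)
Lemma l2bd_prim : l2bd leb1 B prim_op (4 * (b - a) ^+ 2).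
Proof.
move=> f Bf; have ba : 0 < b - a by rewrite subr_gt0.
rewrite (L2_fin (B_L2 Bf)) -(sqn_restrict leb1 (D := `]a, b[%classic))//; last first.
  by move=> x _ nx; exact: test_fun0 (prim_opB Bf) nx.
apply: (@le_trans _ _ (\int[leb1]_(x in `]a, b[%classic) ((2 * \int[leb1]_x `|f x|) ^+ 2)%:E)%E).
  apply: ge0_le_integralW => x _; rewrite lee_fin ?sqr_ge0//.
  rewrite -(real_normK (num_real (prim_op f x))) lerXn2r ?nnegrE//.
    by rewrite mulr_ge0// Rintegral_ge0.
  exact: prim_bound.
rewrite integral_cst//= leb1_oo// -!EFinM lee_fin.
have := int_norm_sqr Bf; rewrite exprMn; nra.
Qed.

Lemma poinc1 : poinc leb1 B 1 (fun _ (f : R -> R) => 'D_(1 : R) f) (fun=> prim_op) avg_op w (b - a).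
Proof.
split.
- move=> i _; split; [exact: linop_prim|rewrite expr1; exact: l2bd_prim].
- split; [exact: linop_avg|rewrite expr1; exact: l2bd_avg].
- move=> f x Bf; rewrite big_ord_recl big_ord0 addr0.
  by rewrite (prim_derive x Bf).2.
- by move=> f _; exists (\int[leb1]_x f x).
- exact: tw.
Qed.

End one_dimensional.

(** * Density and duality in L^2 *)

Import HBNNSimple.
Section minkowski.
Context d (T : measurableType d) (R : realType).
Variables (mu : {measure set T -> \bar R}) (D : set T).
Hypothesis mD : measurable D.
Implicit Types f g : T -> R.

Definition nrm f : R := Num.sqrt (fine (sqn mu D f)).

Lemma nrm_ge0 f : 0 <= nrm f. Proof. exact: sqrtr_ge0. Qed.

Lemma nrm_sqr f : nrm f ^+ 2 = fine (sqn mu D f).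
Proof. by rewrite sqr_sqrtr// fine_ge0// sqn_ge0. Qed.

Lemma minkowski2 f g : L2 mu D f -> L2 mu D g ->
  nrm (fun x => f x + g x) <= nrm f + nrm g.
Proof.
move=> Lf Lg; rewrite -[leRHS]ger0_norm ?addr_ge0 ?nrm_ge0// -sqrtr_sqr ler_wsqrtr//.
have Lfg := L2_add mD Lf Lg.
have iff := L2_integrableM mD Lf Lf.
have igg := L2_integrableM mD Lg Lg.
have ifg := L2_integrableM mD Lf Lg.
have -> : fine (sqn mu D (fun x => f x + g x)) =
    \int[mu]_(x in D) (f x * f x) + \int[mu]_(x in D) (2 * (f x * g x)) +
    \int[mu]_(x in D) (g x * g x).
  have i2 : mu.-integrable D (EFin \o (fun x => 2 * (f x * g x))).
    exact: (integrableZl mD 2 ifg).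
  rewrite -RintegralD// -RintegralD//; last exact: (integrableD mD iff i2).
  by apply: eq_Rintegral => x _; rewrite /=; ring.
rewrite RintegralZl// -[X in X + _ + _]/(fine (sqn mu D f)) -[X in _ + X]/(fine (sqn mu D g)).
rewrite -!nrm_sqr.
have := cauchy_schwarzW mD Lf Lg; rewrite -/(nrm f) -/(nrm g).
by move=> /(le_trans (ler_norm _)); nra.
Qed.

End minkowski.

Section density.
Context d (T : measurableType d) (R : realType).
Variables (mu : {measure set T -> \bar R}) (D : set T) (V : (T -> R) -> Prop).
Hypotheses (mD : measurable D) (Doo : (mu D < +oo)%E) (Vc : vclass V).
Implicit Types f g : T -> R.

Definition l2approx f := forall e : R, 0 < e ->
  exists2 g, V g & (sqn mu D (fun x => (f x - g x)%R) < e%:E)%E.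

(** Density is recorded on indicators, the form in which Dynkin's theorem and rectangles deliver it;
    [approx_L2] extends it to all of L^2. *)
Definition dense2 := forall A, measurable A -> l2approx (\1_A).

Lemma approx_lim f : measurable_fun D f ->
  (forall e : R, 0 < e -> exists g, [/\ measurable_fun D g, l2approx g &
     (sqn mu D (fun x => (f x - g x)%R) < e%:E)%E]) -> l2approx f.
Proof.
move=> mf H e e0; have e4 : 0 < e / 4 by rewrite divr_gt0.
have [g [mg ag fg]] := H _ e4; have [k Vk gk] := ag _ e4.
exists k => //; have mk : measurable_fun D k by apply: measurable_funTS; case: Vc => _ _; apply.
have -> : (fun x => f x - k x) = (fun x => (f x - g x) + (g x - k x)).
  by apply/funext => x; ring.
apply: le_lt_trans (sqn_add mu mD _ _) _; [exact: measurable_funB..|].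
have -> : e%:E = (2%:E * (e / 4)%:E + 2%:E * (e / 4)%:E)%E.
  by rewrite -!EFinM -EFinD; congr EFin; field.
by rewrite lteD// lte_pmul2l.
Qed.

Lemma approx_add f g : measurable_fun D f -> measurable_fun D g ->
  l2approx f -> l2approx g -> l2approx (fun x => f x + g x).
Proof.
move=> mf mg af ag e e0; have e4 : 0 < e / 4 by rewrite divr_gt0.
have [k Vk fk] := af _ e4; have [l Vl gl] := ag _ e4.
have [VD _ Vm] := Vc.
exists (fun x => k x + l x); first exact: VD.
have -> : (fun x => f x + g x - (k x + l x)) = (fun x => (f x - k x) + (g x - l x)).
  by apply/funext => x; ring.
apply: le_lt_trans (sqn_add mu mD _ _) _.
- by apply: measurable_funB => //; apply: measurable_funTS; exact: Vm.
- by apply: measurable_funB => //; apply: measurable_funTS; exact: Vm.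
have -> : e%:E = (2%:E * (e / 4)%:E + 2%:E * (e / 4)%:E)%E.
  by rewrite -!EFinM -EFinD; congr EFin; field.
by rewrite lteD// lte_pmul2l.
Qed.

Lemma approx_scale c f : measurable_fun D f -> l2approx f -> l2approx (fun x => c * f x).
Proof.
move=> mf af e e0; have c1 : 0 < c ^+ 2 + 1 by rewrite ltr_wpDl// sqr_ge0.
have [k Vk fk] := af _ (divr_gt0 e0 c1).
have [_ VZ Vm] := Vc.
exists (fun x => c * k x); first exact: VZ.
have -> : (fun x => c * f x - c * k x) = (fun x => c * (f x - k x)).
  by apply/funext => x; ring.
have mfk : measurable_fun D (fun x => f x - k x).
  by apply: measurable_funB => //; apply: measurable_funTS; exact: Vm.
rewrite sqn_scale//.
apply: (@le_lt_trans _ _ ((c ^+ 2)%:E * (e / (c ^+ 2 + 1))%:E)%E).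
  by rewrite lee_wpmul2l ?lee_fin ?sqr_ge0// ltW.
rewrite -EFinM lte_fin mulrCA gtr_pMr// ltr_pdivrMr// mul1r; lra.
Qed.

Lemma approx0 : dense2 -> l2approx (fun=> 0).
Proof.
move=> dV; have := @approx_scale 0 _ _ (dV _ measurableT).
rewrite (_ : (fun _ => _) = fun=> 0); last by apply/funext => x; rewrite mul0r.
by apply; apply: measurable_funTS; exact: measurable_indic.
Qed.

Lemma approx_sum (I : eqType) (s : seq I) (F : I -> T -> R) : l2approx (fun=> 0) ->
  (forall i, measurable_fun D (F i)) -> (forall i, l2approx (F i)) ->
  l2approx (fun x => \sum_(i <- s) F i x).
Proof.
move=> a0 mF aF; elim: s => [|i s IH].
  by rewrite (_ : (fun x => _) = fun=> 0)//; apply/funext => x; rewrite big_nil.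
rewrite (_ : (fun x => _) = fun x => F i x + \sum_(j <- s) F j x); last first.
  by apply/funext => x; rewrite big_cons.
by apply: approx_add => //; exact: measurable_sum.
Qed.

(** The sets with approximable indicator form a Dynkin system: complements come from 1 - 1_S,
    disjoint unions from dominated convergence. An intersection-stable generator is therefore
    enough. *)
Lemma dense_dynkin (G : set (set T)) :
  @measurable d T = <<s G >> -> setI_closed G -> l2approx (fun=> 1) ->
  (forall A, G A -> l2approx (\1_A)) -> dense2.
Proof.
move=> mG GI a1 aG A; rewrite mG.
have mind B : measurable B -> measurable_fun D (\1_B : T -> R).
  by move=> mB; apply: measurable_funTS; exact: measurable_indic.
have a0 : l2approx (fun=> 0).
  have -> : (fun=> 0) = (fun x : T => 0 * 1 : R) by apply/funext => x; rewrite mul0r.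
  by apply: approx_scale.
apply: (@dynkin_induction _ T G (fun A => l2approx (\1_A))) => //.
- by rewrite (_ : \1_setT = fun=> 1)//; apply/funext => x; rewrite indicT.
- move=> S mS aS; rewrite (_ : \1_(~` S) = fun x => 1 + -1 * \1_S x); last first.
    by apply/funext => x; rewrite !indicE in_setC; case: (x \in S); rewrite /= ?mulr1 ?mulr0 ?subrr ?addr0.
  have mS' : measurable_fun D (fun x => -1 * \1_S x : R).
    by apply: measurable_funM => //; exact: mind.
  apply: (approx_add (f := fun=> 1) (g := fun x => -1 * \1_S x)) => //.
  by apply: approx_scale => //; exact: mind.
- move=> F mF tF aF; have mU : measurable (\bigcup_k F k) by exact: bigcup_measurable.
  apply: approx_lim; first exact: mind.
  move=> e e0.
  pose g n x : R := \sum_(i <- iota 0 n) \1_(F i) x.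
  have mg n : measurable_fun D (g n) by apply: measurable_sum => i; exact: mind.
  (* Disjointness makes every partial sum 0 or 1, so the squared error is at most 1, an integrable
     majorant on the set [D] of finite measure. *)
  have gval n x : g n x = 0 \/ exists k, [/\ (k < n)%N, F k x & g n x = 1].
    have [[k [kn Fkx]]|nF] := pselect (exists k, (k < n)%N /\ F k x); last first.
      left; rewrite /g big_seq big1// => i; rewrite mem_iota/= add0n => ni.
      by rewrite indicE memNset// => Fix; apply: nF; exists i.
    right; exists k; split => //.
    rewrite /g (bigD1_seq k) ?iota_uniq ?mem_iota//= indicE mem_set//.
    rewrite big1 ?addr0// => i ik; rewrite indicE memNset// => Fix.
    have E : i = k by apply: tF => //; exists x.
    by move: ik; rewrite E eqxx.
  have h : sqn mu D (fun x => \1_(\bigcup_k F k) x - g n x) @[n --> \oo] -->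
      (\int[mu]_(x in D) (cst 0 x))%E.
    apply: (@dominated_cvg _ _ _ mu D mD
      (fun n x => ((\1_(\bigcup_k F k) x - g n x) ^+ 2)%:E) (fun=> 0%E)
      (fun x => (\1_D x)%:E)) => //.
    + by move=> n; apply: measurable_sqr; apply: measurable_funB => //; exact: mind.
    + move=> x Dx; apply: cvg_EFin; first exact: nearW.
      apply: cvg_near_cst; have [[k _ Fkx]|nU] := pselect ((\bigcup_k F k) x).
        near=> n; have kn : (k < n)%N by near: n; exact: nbhs_infty_gt.
        have gn : g n x = 1.
          have [g0|[? [_ _ ->//]]] := gval n x.
          move: g0; rewrite /g (bigD1_seq k) ?iota_uniq ?mem_iota//= indicE mem_set//.
          move=> /eqP; rewrite paddr_eq0// ?oner_eq0//.
          by apply: sumr_ge0 => i _; rewrite indicE.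
        by rewrite /= gn indicE mem_set ?subrr ?expr0n//; exists k.
      near=> n; rewrite /= indicE memNset//.
      have [->|[k [_ Fkx _]]] := gval n x; first by rewrite subrr expr0n.
      by exfalso; apply: nU; exists k.
    + exact: indic_integrable.
    + move=> n x Dx /=; rewrite lee_fin ger0_norm ?sqr_ge0// [in leRHS]indicE mem_set//.
      have [->|[k [_ Fkx ->]]] := gval n x; rewrite indicE; case: (_ \in _) => /=.
      * by rewrite subr0 expr1n.
      * by rewrite subr0 expr0n.
      * by rewrite subrr expr0n.
      * by rewrite sub0r sqrrN expr1n.
  rewrite integral0 in h.
  have [h1 h2] := (fine_cvgP _ _).1 h.
  have [N _ /(_ N (leqnn N)) hN] : \forall n \near \oo,
      (sqn mu D (fun x => (\1_(\bigcup_k F k) x - g n x)%R) < e%:E)%E.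
    near=> n.
    have hn : (sqn mu D (fun x => (\1_(\bigcup_k F k) x - g n x)%R)) \is a fin_num.
      by near: n.
    rewrite -(fineK hn) lte_fin; near: n; exact: (cvgr_lt _ h2).
  exists (g N); split => //.
  by apply: approx_sum => // i; exact: mind.
Unshelve. all: by end_near. Qed.

Lemma approx_nnsfun (h : {nnsfun T >-> R}) : dense2 -> l2approx h.
Proof.
move=> dV.
rewrite (_ : (h : T -> R) = fun x => \sum_(y <- finmap.enum_fset (fset_set (range h))) y * \1_(h @^-1` [set y]) x).
  have mind y : measurable_fun D (\1_(h @^-1` [set y]) : T -> R).
    by apply: measurable_funTS; apply: measurable_indic; exact: measurable_sfunP.
  apply: approx_sum; first exact: approx0.
  - by move=> y; apply: measurable_funM.
  - by move=> y; apply: approx_scale => //; apply: dV.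
by apply/funext => x; rewrite fimfunE fsbig_finite.
Qed.

Lemma approx_ge0 f : dense2 -> L2 mu D f -> (forall x, 0 <= f x) -> l2approx f.
Proof.
move=> dV [mf f2] f0.
have mEf : measurable_fun D (EFin \o f) by exact/measurable_EFinP.
have Ef0 x : D x -> (0%R <= (EFin \o f) x)%E by rewrite lee_fin.
have [g [ndg gf]] := approximation mD mEf Ef0.
apply: approx_lim => // e e0.
have h : sqn mu D (fun x => f x - g n x) @[n --> \oo] --> (\int[mu]_(x in D) (cst 0 x))%E.
  apply: (@dominated_cvg _ _ _ mu D mD (fun n x => ((f x - g n x) ^+ 2)%:E)
    (fun=> 0%E) (fun x => ((f x) ^+ 2)%:E)) => //.
  - move=> n; apply: measurable_sqr; apply: measurable_funB => //.
    exact: measurable_funTS.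
  - move=> x Dx; apply: cvg_EFin; first exact: nearW.
    have gx : g n x @[n --> \oo] --> f x by have /fine_cvgP[] := gf x Dx.
    rewrite -[0](expr0n _ 2) -(subrr (f x)) expr2.
    by apply: cvgM; apply: cvgB => //; exact: cvg_cst.
  - apply/integrableP; split; first exact: measurable_sqr.
    by under eq_integral do rewrite gee0_abs ?lee_fin ?sqr_ge0//.
  - move=> n x Dx /=; rewrite lee_fin ger0_norm ?sqr_ge0//.
    have gx : g n x <= f x.
      have ndgx : {homo (fun n => (g n x)%:E) : n m / (n <= m)%N >-> (n <= m)%E}.
        by move=> i j ij; rewrite lee_fin; have /lefP := ndg i j ij; apply.
      have := ereal_nondecreasing_cvgn ndgx => /(cvg_unique _ (gf x Dx)).
      move=> /(_ (@ereal_hausdorff _)) E.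
      by rewrite -lee_fin -[(f x)%:E]/((EFin \o f) x) E; apply: ereal_sup_ubound; exists n.
    have g0 : 0 <= g n x by [].
    nra.
rewrite integral0 in h.
have [h1 h2] := (fine_cvgP _ _).1 h.
have [N _ /(_ N (leqnn N)) hN] : \forall n \near \oo,
    (sqn mu D (fun x => (f x - g n x)%R) < e%:E)%E.
  near=> n.
  have hn : (sqn mu D (fun x => (f x - g n x)%R)) \is a fin_num by near: n.
  rewrite -(fineK hn) lte_fin; near: n; exact: (cvgr_lt _ h2).
exists (g N); split => //; first exact: measurable_funTS.
exact: approx_nnsfun.
Unshelve. all: by end_near. Qed.

Lemma approx_L2 f : dense2 -> L2 mu D f -> l2approx f.
Proof.
move=> dV [mf f2].
have mp : measurable_fun D (fun x => Num.max (f x) 0) by exact: measurable_maxr.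
have mn : measurable_fun D (fun x => Num.max (- f x) 0).
  by apply: measurable_maxr => //; exact: measurableT_comp.
rewrite (_ : f = fun x => Num.max (f x) 0 + -1 * Num.max (- f x) 0); last first.
  apply/funext => x; rewrite mulN1r; have [x0|x0] := leP (f x) 0.
    by rewrite max_l ?oppr_ge0// add0r opprK.
  by rewrite max_r ?oppr_le0 1?ltW// subr0.
have sq (g : T -> R) : (forall x, g x ^+ 2 <= f x ^+ 2) -> (sqn mu D g < +oo)%E.
  move=> gf; apply: le_lt_trans f2; apply: ge0_le_integralW => x _; rewrite lee_fin//.
  exact: sqr_ge0.
apply: approx_add => //; first by apply: measurable_funM.
  apply: approx_ge0 => //; last by move=> x; rewrite le_max lexx orbT.
  split => //; apply: sq => x; have [x0|x0] := leP (f x) 0; last by [].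
  by rewrite expr0n sqr_ge0.
apply: approx_scale => //.
apply: approx_ge0 => //; last by move=> x; rewrite le_max lexx orbT.
split => //; apply: sq => x; have [x0|x0] := leP (- f x) 0; last by rewrite sqrrN.
by rewrite expr0n sqr_ge0.
Qed.

(** Since [f] itself need not lie in [V], it is approximated by some g in [V] within t. Then N^2 =
    <f, f - g> + <f, g> is at most N t + M (N + t), and t is chosen with t (N + M) <= e. *)
Lemma dual_bound f (M : R) : dense2 -> L2 mu D f -> 0 <= M ->
  (forall g, V g -> `|\int[mu]_(x in D) (f x * g x)| <= M * nrm mu D g) ->
  nrm mu D f <= M.
Proof.
move=> dV Lf M0 H.
set N := nrm mu D f.
have N0 : 0 <= N by exact: nrm_ge0.
suff : N ^+ 2 <= M * N.
  have [->|Nn0] := eqVneq N 0; first by [].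
  by rewrite expr2 ler_pM2r// lt_def Nn0.
apply/ler_addgt0Pr => e e0.
have c0 : 0 < N + M + 1 by rewrite ltr_wpDl// addr_ge0.
pose t := e / (N + M + 1); have t0 : 0 < t by rewrite divr_gt0.
have t20 : 0 < t ^+ 2 by rewrite exprn_gt0.
have [g Vg fg] := approx_L2 dV Lf t20.
have [_ _ Vm] := Vc.
have mg : measurable_fun D g by apply: measurable_funTS; exact: Vm.
have Lfg : L2 mu D (fun x => f x - g x).
  by split; [apply: measurable_funB => //; case: Lf|exact: lt_trans fg (ltry _)].
have Lg : L2 mu D g.
  have := L2_sub mD Lf Lfg; rewrite (_ : (fun x => f x - (f x - g x)) = g)//.
  by apply/funext => x; ring.
have nfg : nrm mu D (fun x => f x - g x) <= t.
  rewrite -[leRHS]gtr0_norm// -sqrtr_sqr ler_wsqrtr// -lee_fin -L2_fin//.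
  exact: ltW.
have ng : nrm mu D g <= N + t.
  have Lgf : L2 mu D (fun x => -1 * (f x - g x)) by exact: L2_scale.
  have -> : g = fun x => f x + -1 * (f x - g x) by apply/funext => x; ring.
  apply: le_trans (minkowski2 mD Lf Lgf) _; rewrite lerD2l.
  apply: le_trans nfg; rewrite /nrm sqn_scale ?sqrrN ?expr1n ?mul1e//.
  by case: Lfg.
have EN : N ^+ 2 = \int[mu]_(x in D) (f x * (f x - g x)) + \int[mu]_(x in D) (f x * g x).
  rewrite -RintegralD//; [|exact: (L2_integrableM mD Lf Lfg)|exact: (L2_integrableM mD Lf Lg)].
  rewrite nrm_sqr /sqn -[LHS]/(Rintegral mu D (fun x => f x ^+ 2)).
  by apply: eq_Rintegral => x _; ring.
have h1 := le_trans (ler_norm _) (cauchy_schwarzW mD Lf Lfg).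
have h2 := le_trans (ler_norm _) (H _ Vg).
rewrite -/(nrm mu D f) -/(nrm mu D _) -/N in h1.
have h3 : N * nrm mu D (fun x => f x - g x) <= N * t by rewrite ler_wpM2l.
have h4 : M * nrm mu D g <= M * (N + t) by rewrite ler_wpM2l.
have h5 : t * (N + M) <= e.
  by rewrite /t mulrAC ler_pdivrMr// ler_wpM2l 1?ltW//; lra.
rewrite EN; lra.
Qed.

End density.

Section dense1.
Context {R : realType}.

Lemma sqn_itv_co_oo (a b : R) (f : R -> R) : measurable_fun [set: measurableTypeR R] f ->
  sqn leb1 `[a, b[%classic f = sqn leb1 `]a, b[%classic f.
Proof.
move=> mf; rewrite /sqn.
apply: (@integral_itv_bndoo R a b (fun x => ((f x) ^+ 2)%:E) true true).
by apply: measurable_sqr; exact: measurable_funTS.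
Qed.

Lemma leb1_co_lty (a b : R) : (leb1 `[a, b[%classic < +oo)%E.
Proof.
have := @lebesgue_measure_itv R `[a, b[; rewrite /= => ->.
by case: ifP => _; rewrite -?EFinD ltry.
Qed.

Lemma sqn_subset d (T : measurableType d) (mu : {measure set T -> \bar R})
  (D E : set T) (f : T -> R) : D `<=` E -> measurable D -> measurable E ->
  measurable_fun E f -> (sqn mu D f <= sqn mu E f)%E.
Proof.
move=> DE mD mE mf; apply: ge0_subset_integral => //; first exact: measurable_sqr.
by move=> x _; rewrite lee_fin sqr_ge0.
Qed.

(** The rays ]x, +oo[ generate the Borel sets and are stable under intersection. Inside the interval
    a ray that meets it is some ]x, b[, approximated by bumps; the left endpoint that distinguishes
    the half-open from the open interval is a null set. *)
Lemma dense_test_fun (a b : R) : a < b ->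
  dense2 leb1 `[a, b[%classic (test_fun `]a, b[%classic).
Proof.
move=> ab.
have mD : measurable (`[a, b[%classic : set (measurableTypeR R)) by exact: measurable_itv.
have Vc : @vclass _ (measurableTypeR R) R (test_fun `]a, b[%classic) by exact: vclass_B.
have key (A : set R) x : a <= x -> x < b -> measurable A ->
    (forall t, a < t < b -> A t <-> x < t) ->
    l2approx leb1 `[a, b[%classic (test_fun `]a, b[%classic) (\1_A).
  move=> ax xb mA Ax e e0.
  have [n hn] := bump_sqn xb e0.
  exists (flat_bump x b n); first exact: bump_test.
  have mf : measurable_fun [set: measurableTypeR R] (fun t => \1_A t - flat_bump x b n t : R).
    apply: measurable_funB; [exact: measurable_indic|exact: measurable_bump].
  rewrite sqn_itv_co_oo//; apply: le_lt_trans hn.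
  have mf' : measurable_fun [set: measurableTypeR R]
      (fun t => \1_(`]x, b[%classic) t - flat_bump x b n t : R).
    apply: measurable_funB; [exact: measurable_indic|exact: measurable_bump].
  have sub : (`]a, b[%classic : set (measurableTypeR R)) `<=` setT by [].
  apply: le_trans (sqn_subset leb1 sub _ measurableT mf') => //.
  apply: ge0_le_integralW => t; first by rewrite lee_fin sqr_ge0.
  rewrite /= in_itv/= => tab; rewrite lee_fin.
  suff -> : \1_A t = \1_(`]x, b[%classic) t :> R by [].
  rewrite !indicE; congr (_%:R); congr nat_of_bool.
  apply/idP/idP; rewrite !inE/= in_itv/=.
    by move=> /(Ax _ tab) ->; case/andP: tab.
  by move=> /andP[xt _]; apply/(Ax _ tab).
apply: (dense_dynkin mD (leb1_co_lty a b) Vc (RGenOInfty.measurableE R)).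
- move=> _ _ [x ->] [y ->]; exists (Num.max x y).
  apply/seteqP; split => t; rewrite /= !in_itv/= !andbT gt_max.
    by move=> [-> ->].
  by move=> /andP[].
- have := key setT a (lexx a) ab measurableT.
  rewrite (_ : \1_setT = fun=> 1); last by apply/funext => x; rewrite indicT.
  by apply => t /andP[at_ _].
- move=> _ [x ->]; have [xb|bx] := ltP x b.
    apply: (key _ (Num.max a x)).
    + by rewrite le_max lexx.
    + by rewrite gt_max ab xb.
    + exact: measurable_itv.
    + move=> t /andP[at_ tb]; rewrite /= in_itv/= andbT gt_max at_/=.
      by split.
  move=> e e0; exists (fun=> 0); first exact: test_fun_cst0.
  rewrite sqn_itv_co_oo; last first.
    by apply: measurable_funB; [exact: measurable_indic|exact: measurable_cst].
  rewrite /sqn integral0_eq ?lte_fin// => t; rewrite /= in_itv/= => /andP[at_ tb].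
  rewrite indicE memNset ?subrr ?expr0n//= in_itv/= andbT => xt.
  by move: (lt_trans tb (le_lt_trans bx xt)); rewrite ltxx.
Qed.

End dense1.

Section dense_product.
Context d1 d2 (T1 : measurableType d1) (T2 : measurableType d2) (R : realType).
Variables (m1 : {sigma_finite_measure set T1 -> \bar R})
          (m2 : {sigma_finite_measure set T2 -> \bar R}).
Variables (D1 : set T1) (D2 : set T2).
Hypotheses (mD1 : measurable D1) (mD2 : measurable D2)
  (D1oo : (m1 D1 < +oo)%E) (D2oo : (m2 D2 < +oo)%E).

Lemma prodm_rect : prodm m1 m2 (D1 `*` D2) = (m1 D1 * m2 D2)%E.
Proof. by rewrite /prodm product_measure1E. Qed.

Lemma prodm_rect_lty : (prodm m1 m2 (D1 `*` D2) < +oo)%E.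
Proof. by rewrite prodm_rect lte_mul_pinfty// ge0_fin_numE. Qed.

Lemma sqn_indic (d : measure_display) (T : measurableType d) (mu : {measure set T -> \bar R})
  (D : set T) (f : T -> R) : sqn mu D f = sqn mu setT (fun x => f x * \1_D x).
Proof.
rewrite /sqn integral_mkcond; apply: eq_integral => x _.
rewrite patchE indicE; case: (x \in D); first by rewrite mulr1.
by rewrite mulr0 expr0n.
Qed.

Lemma sqn_tensor (f : T1 -> R) (g : T2 -> R) :
  measurable_fun setT f -> measurable_fun setT g ->
  sqn (prodm m1 m2) (D1 `*` D2) (fun p => f p.1 * g p.2) =
  (sqn m1 D1 f * sqn m2 D2 g)%E.
Proof.
move=> mf mg; rewrite sqn_indic.
have mf1 : measurable_fun setT (fun x => f x * \1_D1 x).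
  by apply: measurable_funM => //; exact: measurable_indic.
have mg1 : measurable_fun setT (fun x => g x * \1_D2 x).
  by apply: measurable_funM => //; exact: measurable_indic.
rewrite (_ : (fun p => _) = fun p => (f p.1 * \1_D1 p.1) * (g p.2 * \1_D2 p.2)); last first.
  apply/funext => -[x y]; rewrite /= !indicE in_setX/=.
  by case: (x \in D1); case: (y \in D2); rewrite /= ?(mulr0, mulr1, mul0r).
rewrite sqn_prod2; last first.
  exact: (measurable_tensor mf1 mg1).
rewrite (sqn_indic m1 D1) (sqn_indic m2 D2) {2}/sqn.
rewrite -ge0_integralZr//; last 3 first.
- exact: measurable_sqr.
- by move=> x _; rewrite lee_fin sqr_ge0.
- exact: sqn_ge0.
by apply: eq_integral => x _; rewrite /= sqn_scale.
Qed.

(** Measurable rectangles generate the product sigma-algebra. On a rectangle the error splits as 1_A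
    (1_B - psi) + (1_A - phi) psi, and the norm of each product factorises. *)
Lemma dense_product (V1 : (T1 -> R) -> Prop) (V2 : (T2 -> R) -> Prop) :
  vclass V1 -> vclass V2 ->
  dense2 m1 D1 V1 -> dense2 m2 D2 V2 ->
  dense2 (prodm m1 m2) (D1 `*` D2) (tens V1 V2).
Proof.
move=> V1c V2c dV1 dV2.
have Vc := vclass_tens V1c V2c.
have mD : measurable (D1 `*` D2) by exact: measurableX.
have key (A : set T1) (B : set T2) : measurable A -> measurable B ->
    l2approx (prodm m1 m2) (D1 `*` D2) (tens V1 V2) (\1_(A `*` B)).
  move=> mA mB e e0.
  have indL2 : forall d (T : measurableType d) (mu : {measure set T -> \bar R})
      (D S : set T), measurable D -> (mu D < +oo)%E -> measurable S ->
      L2 mu D (\1_S).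
    move=> d T mu D S mD' Doo mS; apply: (@L2_bounded _ _ _ _ _ mD' _ 1) => //.
    by move=> x _; rewrite indicE; case: (_ \in _); rewrite /= ?normr1 ?normr0.
  have LA := indL2 _ _ m1 D1 A mD1 D1oo mA.
  have LB := indL2 _ _ m2 D2 B mD2 D2oo mB.
  pose s := fine (sqn m1 D1 (\1_A)); have s0 : 0 <= s by rewrite fine_ge0// sqn_ge0.
  have s4 : 0 < 4 * (s + 1) by rewrite mulr_gt0// ltr_wpDl.
  have [psi Vpsi hpsi] := dV2 B mB _ (divr_gt0 e0 s4).
  have [_ _ V1m] := V1c; have [_ _ V2m] := V2c.
  have mpsi := V2m _ Vpsi.
  have mBpsi : measurable_fun setT (fun x => \1_B x - psi x).
    by apply: measurable_funB => //; exact: measurable_indic.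
  have Lpsi : L2 m2 D2 psi.
    have Lh : L2 m2 D2 (fun x => \1_B x - psi x).
      by split; [exact: measurable_funTS|exact: lt_trans hpsi (ltry _)].
    have := L2_sub mD2 LB Lh; rewrite (_ : (fun x => _) = psi)//.
    by apply/funext => x; ring.
  (* The approximation phi is chosen after psi, because its error is multiplied by the norm of
     psi. *)
  pose c := fine (sqn m2 D2 psi); have c0 : 0 <= c by rewrite fine_ge0// sqn_ge0.
  have c4 : 0 < 4 * (c + 1) by rewrite mulr_gt0// ltr_wpDl.
  have [phi Vphi hphi] := dV1 A mA _ (divr_gt0 e0 c4).
  have mphi := V1m _ Vphi.
  have mAphi : measurable_fun setT (fun x => \1_A x - phi x).
    by apply: measurable_funB => //; exact: measurable_indic.
  have mIA : measurable_fun setT (\1_A : T1 -> R) by exact: measurable_indic.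
  exists (fun p => phi p.1 * psi p.2); first exact: tens_prod.
  rewrite (_ : (fun p => _) = fun p => \1_A p.1 * (\1_B p.2 - psi p.2) +
      (\1_A p.1 - phi p.1) * psi p.2); last first.
    apply/funext => -[x y]; rewrite /= !indicE in_setX/=.
    by case: (x \in A); case: (y \in B) => /=; ring.
  apply: le_lt_trans (sqn_add _ mD _ _) _.
  - by apply: measurable_funTS; exact: (measurable_tensor mIA mBpsi).
  - by apply: measurable_funTS; exact: (measurable_tensor mAphi mpsi).
  rewrite (sqn_tensor mIA mBpsi) (sqn_tensor mAphi mpsi).
  rewrite (L2_fin LA) (L2_fin Lpsi) -/s -/c.
  have hp : (2%:E * (s%:E * sqn m2 D2 (fun x => (\1_B x - psi x)%R)) <=
      (2 * (s * (e / (4 * (s + 1)))))%:E)%E.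
    by rewrite !EFinM lee_wpmul2l// lee_wpmul2l ?lee_fin// ltW.
  have hq : (2%:E * (sqn m1 D1 (fun x => (\1_A x - phi x)%R) * c%:E) <=
      (2 * (e / (4 * (c + 1)) * c))%:E)%E.
    by rewrite !EFinM lee_wpmul2l// lee_wpmul2r ?lee_fin// ltW.
  apply: le_lt_trans (leeD hp hq) _; rewrite -EFinD lte_fin.
  have aux t : 0 <= t -> 2 * (t * (e / (4 * (t + 1)))) < e / 2.
    move=> t0; have t1 : 0 < t + 1 by rewrite ltr_wpDl.
    have -> : 2 * (t * (e / (4 * (t + 1)))) = (e / 2) * (t / (t + 1)).
      by field; rewrite gt_eqF.
    rewrite gtr_pMr ?divr_gt0// ltr_pdivrMr// mul1r; lra.
  have := aux _ s0; have := aux _ c0; rewrite [e / _ * c]mulrC; lra.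
have mP := measurable_prod_measurableType T1 T2.
apply: (dense_dynkin mD prodm_rect_lty Vc mP).
- move=> _ _ [A mA [B mB <-]] [A' mA' [B' mB' <-]]; rewrite -setXI.
  exists (A `&` A'); first exact: measurableI.
  by exists (B `&` B') => //; exact: measurableI.
- have := key setT setT measurableT measurableT; rewrite setXTT.
  by rewrite (_ : \1_setT = fun=> 1)//; apply/funext => x; rewrite indicT.
- by move=> _ [A mA [B mB <-]]; exact: key.
Qed.

End dense_product.

(** * Space-time cells *)

Section cells.
Context {R : realType}.
Implicit Types (a : nat -> R) (h : R).

Definition Bcls (a h : R) : (measurableTypeR R -> R) -> Prop :=
  test_fun `]a, (a + h)[%classic.

Definition Vcell a h : (space5 (measurableTypeR R) -> R) -> Prop :=
  tens (tens (tens (tens (Bcls (a 0%N) h) (Bcls (a 1%N) h)) (Bcls (a 2%N) h))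
    (Bcls (a 3%N) h)) (Bcls (a 4%N) h).

(* Open and half-open cubes; only the latter tile the space. *)
Definition Ocell a h : set (space5 R) :=
  `]a 0%N, (a 0%N + h)[%classic `*` `]a 1%N, (a 1%N + h)[%classic `*`
  `]a 2%N, (a 2%N + h)[%classic `*` `]a 3%N, (a 3%N + h)[%classic `*`
  `]a 4%N, (a 4%N + h)[%classic.

Definition Ccell a h : set (space5 R) :=
  `[a 0%N, (a 0%N + h)[%classic `*` `[a 1%N, (a 1%N + h)[%classic `*`
  `[a 2%N, (a 2%N + h)[%classic `*` `[a 3%N, (a 3%N + h)[%classic `*`
  `[a 4%N, (a 4%N + h)[%classic.

Lemma derive_fst (U W : normedModType R) (f : U * W -> R) e p :
  'D_e (fun x => f (x, p.2)) p.1 = 'D_(e, 0) f p.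
Proof.
rewrite (@derive_comp_affine _ U (U * W)%type (fun x => (x, p.2)) (fun v => (v, 0))).
  by rewrite -surjective_pairing.
by move=> k v x; congr (_, _); rewrite /= scaler0 add0r.
Qed.

Lemma derive_snd (U W : normedModType R) (f : U * W -> R) e p :
  'D_e (fun y => f (p.1, y)) p.2 = 'D_(0, e) f p.
Proof.
rewrite (@derive_comp_affine _ W (U * W)%type (fun y => (p.1, y)) (fun v => (0, v))).
  by rewrite -surjective_pairing.
by move=> k v x; congr (_, _); rewrite /= scaler0 add0r.
Qed.

Lemma Bcls_vclass (a h : R) : vclass (Bcls a h).
Proof. exact: vclass_B. Qed.

Lemma Vcell_vclass a h : vclass (Vcell a h).
Proof. by do 4 (apply: vclass_tens; last exact: Bcls_vclass); exact: Bcls_vclass. Qed.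

Lemma Vcell_test a h (f : space5 R -> R) : Vcell a h f -> test_fun (Ocell a h) f.
Proof.
elim=> {f} [f g Vf Bg|f g _ If _ Ig]; last exact: test_fun_add.
apply: test_fun_tensor => //.
elim: Vf => {f} [f g' Vf Bg'|f g' _ If _ Ig]; last exact: test_fun_add.
apply: test_fun_tensor => //.
elim: Vf => {f} [f g'' Vf Bg''|f g'' _ If _ Ig]; last exact: test_fun_add.
apply: test_fun_tensor => //.
elim: Vf => {f} [f g3 Vf Bg3|f g3 _ If _ Ig]; last exact: test_fun_add.
exact: test_fun_tensor.
Qed.

Lemma Ocell_sub a h : Ocell a h `<=` Ccell a h.
Proof.
move=> [[[[x0 x1] x2] x3] x4]; rewrite /Ocell /Ccell /= !in_itv/=.
move=> [[[[/andP[/ltW -> ->] /andP[/ltW -> ->]] /andP[/ltW -> ->]] /andP[/ltW -> ->]] /andP[/ltW -> ->]].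
by [].
Qed.

Lemma Ccell_measurable a h : measurable (Ccell a h : set (space5 (measurableTypeR R))).
Proof. by rewrite /Ccell; do 4 (apply: measurableX; last exact: measurable_itv); exact: measurable_itv. Qed.

Let mI (x h : R) : measurable (`[x, (x + h)[%classic : set (measurableTypeR R)).
Proof. exact: measurable_itv. Qed.

Let lI (x h : R) : (leb1 `[x, (x + h)%R[%classic < +oo)%E.
Proof. exact: leb1_co_lty. Qed.

Lemma Ccell_lty a h : (leb5 (Ccell a h) < +oo)%E.
Proof.
have m2 := measurableX (mI (a 0%N) h) (mI (a 1%N) h).
have l2 := prodm_rect_lty (mI (a 0%N) h) (mI (a 1%N) h) (lI (a 0%N) h) (lI (a 1%N) h).
have m3 := measurableX m2 (mI (a 2%N) h).
have l3 := prodm_rect_lty m2 (mI (a 2%N) h) l2 (lI (a 2%N) h).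
have m4 := measurableX m3 (mI (a 3%N) h).
have l4 := prodm_rect_lty m3 (mI (a 3%N) h) l3 (lI (a 3%N) h).
exact: prodm_rect_lty m4 (mI (a 4%N) h) l4 (lI (a 4%N) h).
Qed.

Lemma Vcell_dense a h : 0 < h -> dense2 leb5 (Ccell a h) (Vcell a h).
Proof.
move=> h0; have dB i : dense2 leb1 `[a i, (a i + h)[%classic (Bcls (a i) h).
  by apply: dense_test_fun; rewrite ltrDl.
have m2 := measurableX (mI (a 0%N) h) (mI (a 1%N) h).
have l2 := prodm_rect_lty (mI (a 0%N) h) (mI (a 1%N) h) (lI (a 0%N) h) (lI (a 1%N) h).
have m3 := measurableX m2 (mI (a 2%N) h).
have l3 := prodm_rect_lty m2 (mI (a 2%N) h) l2 (lI (a 2%N) h).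
have m4 := measurableX m3 (mI (a 3%N) h).
have l4 := prodm_rect_lty m3 (mI (a 3%N) h) l3 (lI (a 3%N) h).
have c0 i := Bcls_vclass (a i) h.
have c2 := vclass_tens (c0 0%N) (c0 1%N).
have c3 := vclass_tens c2 (c0 2%N).
have c4 := vclass_tens c3 (c0 3%N).
have d2 := dense_product (mI _ h) (mI _ h) (lI _ h) (lI _ h) (c0 0%N) (c0 1%N) (dB 0%N) (dB 1%N).
have d3 := dense_product m2 (mI _ h) l2 (lI _ h) c2 (c0 2%N) d2 (dB 2%N).
have d4 := dense_product m3 (mI _ h) l3 (lI _ h) c3 (c0 3%N) d3 (dB 3%N).
have d5 := dense_product m4 (mI _ h) l4 (lI _ h) c4 (c0 4%N) d4 (dB 4%N).
exact: d5.
Qed.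

Let D1 (_ : nat) (f : measurableTypeR R -> R) : measurableTypeR R -> R := 'D_(1 : R) f.
Let Dn d (T : measurableType d) n (D : nat -> (T -> R) -> T -> R) (i : nat) :
    (T * measurableTypeR R -> R) -> T * measurableTypeR R -> R :=
  if (i < n)%N then lf (D i) else ls (D1 0%N).

Lemma basis5E : [/\ basis5 (inord 0) = (1, 0, 0, 0, 0) :> space5 R,
  basis5 (inord 1) = (0, 1, 0, 0, 0) :> space5 R,
  basis5 (inord 2) = ((0 : R * R), 1, 0, 0) :> space5 R,
  basis5 (inord 3) = ((0 : R * R * R), 1, 0) :> space5 R &
  basis5 (inord 4) = ((0 : R * R * R * R), 1) :> space5 R].
Proof. by rewrite /basis5 !inordK. Qed.

(** Four uses of [poinc_prod] leave the derivatives as nests of [lf] around at most one [ls];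
    peeling them coordinate by coordinate identifies each with a directional derivative on the
    product space. *)
Lemma space_derive i (f : space5 R -> R) x : (i < 5)%N ->
  Dn 4 (Dn 3 (Dn 2 (Dn 1 D1))) i f x = 'D_(basis5 (inord i)) f x.
Proof.
have [b0 b1 b2 b3 b4] := basis5E.
case: i => [|[|[|[|[|i]]]]] // _.
- by rewrite b0 -derive_fst -derive_fst -derive_fst -derive_fst.
- by rewrite b1 -derive_fst -derive_fst -derive_fst -derive_snd.
- by rewrite b2 -derive_fst -derive_fst -derive_snd.
- by rewrite b3 -derive_fst -derive_snd.
- by rewrite b4 -derive_snd.
Qed.

(** The weight has positive norm because each one-dimensional factor has integral 1, whose square is
    at most h times its squared norm. Positivity later permits recovering the size of a function of
    time from that of its product with [w]. *)
Lemma space_poinc a h : 0 < h ->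
  exists (A : nat -> (space5 R -> R) -> space5 R -> R) P (w : space5 R -> R),
  [/\ poinc leb5 (Vcell a h) 5
        (fun i f => 'D_(basis5 (inord i)) f) A P w h &
      0 < fine (sqn leb5 setT w)].
Proof.
move=> h0.
have W i : exists w : R -> R, [/\ poinc leb1 (Bcls (a i) h) 1
    (fun _ (f : R -> R) => 'D_(1 : R) f) (fun=> prim_op w) (avg_op w) w h,
    0 < fine (sqn leb1 setT w) & Bcls (a i) h w].
  have ai : a i < a i + h by rewrite ltrDl.
  have [w [tw wb wi]] := weight_exists ai; exists w; split => //.
    have := poinc1 ai tw wb wi.
    by rewrite [a i + h - a i](_ : _ = h)//; ring.
  have := int_norm_sqr ai tw.
  have -> : \int[leb1]_x `|w x| = 1.
    rewrite -wi; apply: eq_Rintegral => x _; rewrite ger0_norm//.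
    by have /andP[] := wb x.
  rewrite expr1n [a i + h - a i](_ : _ = h); last by ring.
  move=> h1; rewrite -(pmulr_rgt0 _ h0); exact: lt_le_trans h1.
have [w0 [p0 n0 B0]] := W 0%N; have [w1 [p1 n1 B1]] := W 1%N.
have [w2 [p2 n2 B2]] := W 2%N; have [w3 [p3 n3 B3]] := W 3%N.
have [w4 [p4 n4 B4]] := W 4%N.
have c0 i := Bcls_vclass (a i) h.
have c2 := vclass_tens (c0 0%N) (c0 1%N).
have c3 := vclass_tens c2 (c0 2%N).
have c4 := vclass_tens c3 (c0 3%N).
have q2 := poinc_prod (c0 0%N) (c0 1%N) p0 p1.
have q3 := poinc_prod c2 (c0 2%N) q2 p2.
have q4 := poinc_prod c3 (c0 3%N) q3 p3.
have q5 := poinc_prod c4 (c0 4%N) q4 p4.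
have pos d1 d2 (T1 : measurableType d1) (T2 : measurableType d2)
    (m1 : {sigma_finite_measure set T1 -> \bar R})
    (m2 : {sigma_finite_measure set T2 -> \bar R}) (f : T1 -> R) (g : T2 -> R) :
    measurable_fun setT f -> measurable_fun setT g ->
    0 < fine (sqn m1 setT f) -> 0 < fine (sqn m2 setT g) ->
    0 < fine (sqn (prodm m1 m2) setT (fun p => f p.1 * g p.2)).
  move=> mf mg f0 g0; rewrite -setXTT sqn_tensor//.
  have ff : sqn m1 setT f \is a fin_num by apply: contraTT f0 => /fin_numPn[]->; rewrite ltxx.
  have gf : sqn m2 setT g \is a fin_num by apply: contraTT g0 => /fin_numPn[]->; rewrite ltxx.
  by rewrite fineM// mulr_gt0.
have m0 i w : Bcls (a i) h w -> measurable_fun setT w by have [_ _] := c0 i; apply.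
have mw2 := measurable_tensor (m0 _ _ B0) (m0 _ _ B1).
have mw3 := measurable_tensor mw2 (m0 _ _ B2).
have mw4 := measurable_tensor mw3 (m0 _ _ B3).
have r2 := pos _ _ _ _ leb1 leb1 _ _ (m0 _ _ B0) (m0 _ _ B1) n0 n1.
have r3 := pos _ _ _ _ _ leb1 _ _ mw2 (m0 _ _ B2) r2 n2.
have r4 := pos _ _ _ _ _ leb1 _ _ mw3 (m0 _ _ B3) r3 n3.
have r5 := pos _ _ _ _ _ leb1 _ _ mw4 (m0 _ _ B4) r4 n4.
eexists; eexists; eexists; split; last exact: r5.
have [q51 q52 q53 q54 q55] := q5; split; [exact: q51|exact: q52| |exact: q54|exact: q55].
move=> f x Vf; rewrite (q53 _ _ Vf); apply: eq_bigr => -[i i5] _.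
exact: space_derive.
Qed.

End cells.

(** * Continuous functions are measurable for the product sigma-algebra *)

Section continuous_measurable.
Context {R : realType}.

Definition grid (n : nat) (s : R) : R := (Num.floor (s * n.+1%:R))%:~R / n.+1%:R.

Lemma grid_cvg s : grid n s @[n --> \oo] --> s.
Proof.
apply/cvgrPdist_le => /= e e0; near=> n.
have n0 : 0 < n.+1%:R :> R by [].
have hn : e^-1 <= n.+1%:R by near: n; apply: filterS (nbhs_infty_ger e^-1) => n /le_trans; apply; rewrite ler_nat.
have := floor_le_tmp (s * n.+1%:R); have := floorD1_gt (s * n.+1%:R).
rewrite /grid; set k := Num.floor _ => k1 k2.
have h1 : 1 <= e * n.+1%:R by rewrite -ler_pdivrMl ?mulr1.
rewrite -[s in `|s - _|](mulfK (lt0r_neq0 n0)) -mulrBl normrM normfV (gtr0_norm n0).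
rewrite ler_pdivrMr// ger0_norm ?subr_ge0//.
rewrite intrD in k1; lra.
Unshelve. all: by end_near. Qed.

(** The sigma-algebra here is a product of Borel algebras, not the Borel algebra of the product
    topology, so coordinates are added one at a time: rounding the last variable down to a grid
    gives functions that are measurable piece by piece, and by continuity they converge to the given
    one. *)
Lemma continuous_measurable_prodr d (T : measurableType d) (T' : topologicalType)
    (c : T -> T') (f : T' * R -> R) :
  (forall g : T' -> R, continuous g -> measurable_fun setT (g \o c)) ->
  continuous f ->
  measurable_fun setT (fun p : T * measurableTypeR R => f (c p.1, p.2)).
Proof.
move=> cm cf.
have cf2 x s : f (z.1, z.2) @[z --> (x, s)] --> f (x, s).
  by under eq_fun do rewrite -surjective_pairing; exact: cf.
have cfx x : continuous (fun s => f (x, s)).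
  by move=> s; apply: (continuous2_cvg _ (h := fun a b => f (a, b)) (cf2 x s)); [exact: cvg_cst|exact: cvg_id].
have cfs s : continuous (fun x => f (x, s)).
  by move=> x; apply: (continuous2_cvg _ (h := fun a b => f (a, b)) (cf2 x s)); [exact: cvg_id|exact: cvg_cst].
apply: (@measurable_fun_cvg _ _ _ setT
  (fun n (p : T * measurableTypeR R) => f (c p.1, grid n p.2))); last first.
  by move=> [x s] _ /=; apply: (@cvg_comp _ _ _ (fun n => grid n s) (fun r => f (c x, r)) \oo (nbhs s)); [exact: grid_cvg|exact: cfx].
move=> n _ Y mY; rewrite setTI.
(* The preimage is cut into countably many rectangles, one for each integer value of the floor;
   natural numbers that encode no integer contribute the empty set. *)
pose F m : set (T * measurableTypeR R) := if @unpickle int m is Some k then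
  ((fun x => f (c x, k%:~R / n.+1%:R)) @^-1` Y) `*`
  ((fun s => s * n.+1%:R) @^-1` `[k%:~R, (k + 1)%:~R[%classic) else set0.
have -> : (fun p : T * measurableTypeR R => f (c p.1, grid n p.2)) @^-1` Y = \bigcup_m F m.
  apply/seteqP; split => [[x s] /= Yf|[x s] [m _]].
    exists (pickle (Num.floor (s * n.+1%:R))); first exact: I.
    rewrite /F pickleK; split => //=.
    by rewrite in_itv/= floor_le_tmp floorD1_gt.
  rewrite /F; case: (unpickle m) => // k [/= Yf]; rewrite in_itv/= => ks.
  by rewrite /grid (floor_def ks).
apply: bigcup_measurable => m _; rewrite /F; case: (unpickle m) => // k.
apply: measurableX.
  by rewrite -[X in measurable X]setTI; apply: (cm (fun x => f (x, k%:~R / n.+1%:R)) (cfs _)).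
rewrite -[X in measurable X]setTI.
have ms : measurable_fun [set: measurableTypeR R] (fun s : R => s * n.+1%:R).
  by apply: measurable_funM.
by apply: ms => //; exact: measurable_itv.
Qed.

Lemma space_continuous_measurable (f : space5 R -> R) : continuous f ->
  measurable_fun [set: space5 (measurableTypeR R)] f.
Proof.
have step d (T : measurableType d) (T' : topologicalType) (c : T -> T') :
    (forall g : T' -> R, continuous g -> measurable_fun setT (g \o c)) ->
    forall g : T' * R -> R, continuous g -> measurable_fun setT
      (g \o (fun p : T * measurableTypeR R => (c p.1, p.2))).
  by move=> cm g cg; exact: (continuous_measurable_prodr cm cg).
have s1 (g : R -> R) : continuous g ->
    measurable_fun [set: measurableTypeR R] (g \o (fun x => x)).
  by move=> cg; exact: continuous_measurable_fun.
have s2 := step _ _ _ _ s1; have s3 := step _ _ _ _ s2; have s4 := step _ _ _ _ s3.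
have s5 := step _ _ _ _ s4.
move=> cf; have := s5 _ cf; congr (measurable_fun _ _).
by apply/funext => -[[[[x0 x1] x2] x3] x4].
Qed.

Lemma spacetime_continuous_measurable (f : spacetime5 R -> R) : continuous f ->
  measurable_fun [set: spacetime5 (measurableTypeR R)] f.
Proof.
move=> cf; have cg : continuous (fun p : space5 R * R => f (p.2, p.1)).
  move=> p; have cf2 : f (z.1, z.2) @[z --> (p.2, p.1)] --> f (p.2, p.1).
    by under eq_fun do rewrite -surjective_pairing; exact: cf.
  by apply: (continuous2_cvg _ (h := fun a b => f (a, b)) cf2); [exact: cvg_snd|exact: cvg_fst].
have mg := @continuous_measurable_prodr _ (space5 (measurableTypeR R)) (space5 R) id _ space_continuous_measurable cg.
have := measurableT_comp mg (@measurable_swap _ _ (measurableTypeR R) _).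
by congr (measurable_fun _ _); apply/funext => -[t x].
Qed.

Lemma test_fun_measurable6 (U : set (spacetime5 R)) (f : spacetime5 R -> R) :
  test_fun U f -> measurable_fun [set: spacetime5 (measurableTypeR R)] f.
Proof. by move=> [sf _ _]; apply: spacetime_continuous_measurable; exact: smooth_continuous. Qed.

End continuous_measurable.

Lemma Rintegral_sum d (T : measurableType d) (R : realType)
    (mu : {measure set T -> \bar R}) (D : set T) (I : Type) (s : seq I) (f : I -> T -> R) :
  measurable D -> (forall i, mu.-integrable D (EFin \o f i)) ->
  mu.-integrable D (EFin \o (fun x => \sum_(i <- s) f i x)) /\
  \int[mu]_(x in D) (\sum_(i <- s) f i x) = \sum_(i <- s) \int[mu]_(x in D) f i x.
Proof.
move=> mD fi; elim: s => [|i s [IH1 IH2]].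
  have E : (fun x => \sum_(i <- [::]) f i x) = fun=> 0 by apply/funext => x; rewrite big_nil.
  rewrite E big_nil; split; first exact: integrable0.
  by rewrite Rintegral_cst// mul0r.
have E : (fun x => \sum_(j <- i :: s) f j x) = fun x => f i x + \sum_(j <- s) f j x.
  by apply/funext => x; rewrite big_cons.
rewrite E big_cons; split; first exact: (integrableD mD (fi i) IH1).
by rewrite RintegralD// IH2.
Qed.

Lemma norm_integral_decomp d (T : measurableType d) (R : realType)
    (mu : {measure set T -> \bar R}) (C : set T) n (u f W t : T -> R)
    (g : 'I_n -> T -> R) (J : R) : measurable C ->
  L2 mu C u -> L2 mu C W -> L2 mu C t -> (forall i, L2 mu C (g i)) ->
  (forall p, f p = J * W p + (\sum_(i < n) g i p + t p)) ->
  `|\int[mu]_(p in C) (u p * f p)| <= `|J| * `|\int[mu]_(p in C) (u p * W p)| +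
    (\sum_(i < n) `|\int[mu]_(p in C) (u p * g i p)| +
     `|\int[mu]_(p in C) (u p * t p)|).
Proof.
move=> mC Lu LW Lt Lg Ef.
have iW : mu.-integrable C (EFin \o (fun p => J * (u p * W p))).
  exact: (integrableZl mC J (L2_integrableM mC Lu LW)).
have it : mu.-integrable C (EFin \o (fun p => u p * t p)) by exact: L2_integrableM.
have [iS ES] := Rintegral_sum (index_enum 'I_n) mC (fun i => L2_integrableM mC Lu (Lg i)).
have iSt := integrableD mC iS it.
have -> : \int[mu]_(p in C) (u p * f p) = J * \int[mu]_(p in C) (u p * W p) +
    (\sum_(i < n) \int[mu]_(p in C) (u p * g i p) + \int[mu]_(p in C) (u p * t p)).
  rewrite -ES -(RintegralD mC iS it) -RintegralZl//; last exact: L2_integrableM.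
  rewrite -(RintegralD mC iW iSt); apply: eq_Rintegral => p _.
  by rewrite Ef mulrDr [u p * (_ + t p)]mulrDr mulr_sumr mulrCA.
apply: le_trans (ler_normD _ _) _; rewrite normrM lerD2l.
apply: le_trans (ler_normD _ _) _; rewrite lerD2r.
exact: ler_norm_sum.
Qed.

Lemma norm_integral_by_parts d (T : measurableType d) (R : realType)
    (mu : {measure set T -> \bar R}) (C : set T) (u v f g : T -> R) (k c : R) :
  measurable C -> L2 mu C v -> L2 mu C g ->
  \int[mu]_(p in C) (u p * f p) = (- \int[mu]_(p in C) (v p * g p)) ->
  nrm mu C g <= c -> nrm mu C v <= k -> `|\int[mu]_(p in C) (u p * f p)| <= k * c.
Proof.
move=> mC Lv Lg -> gc vk; rewrite normrN.
apply: le_trans (cauchy_schwarzW mC Lv Lg) _.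
by apply: ler_pM => //; exact: nrm_ge0.
Qed.

Lemma combine_bounds (R : realType) n (I J N X kappa s h F K : R) (Y D : 'I_n -> R) :
  I <= J * N + (\sum_(i < n) Y i + X) -> 0 <= N -> J <= kappa * s * F ->
  (forall i, Y i <= D i * (h * F)) -> X <= K * (2 * (kappa * s * F)) ->
  I <= (kappa * s * N + h * \sum_(i < n) D i + 2 * kappa * s * K) * F.
Proof.
move=> IE N0 JE YE XE; apply: le_trans IE _.
have h1 : J * N <= kappa * s * F * N by rewrite ler_wpM2r.
have h2 : \sum_(i < n) Y i <= (\sum_(i < n) D i) * (h * F).
  by rewrite mulr_suml; apply: ler_sum.
apply: le_trans (lerD h1 (lerD h2 XE)) _.
by rewrite le_eqVlt; apply/orP; left; apply/eqP; ring.
Qed.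

(** * The estimate on one space-time cell *)

Section cell_estimate.
Context {R : realType}.
Variables (a : nat -> R) (h : R).
Hypothesis h0 : 0 < h.

Definition Ocell6 (t0 tau : R) : set (spacetime5 R) :=
  `]t0, (t0 + tau)[%classic `*` Ocell a h.
Definition Ccell6 (t0 tau : R) : set (spacetime5 R) :=
  `[t0, (t0 + tau)[%classic `*` Ccell a h.
Let V6 (t0 tau : R) : (spacetime5 (measurableTypeR R) -> R) -> Prop :=
  tens (Bcls t0 tau) (Vcell a h).

Lemma V6_vclass t0 tau : vclass (V6 t0 tau).
Proof. by apply: vclass_tens; [exact: Bcls_vclass|exact: Vcell_vclass]. Qed.

Lemma V6_test t0 tau (f : spacetime5 R -> R) :
  V6 t0 tau f -> test_fun (Ocell6 t0 tau) f.
Proof.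
elim=> {f} [f g Bf Vg|f g _ If _ Ig]; last exact: test_fun_add.
by apply: test_fun_tensor => //; exact: Vcell_test.
Qed.

Lemma Ocell6_sub t0 tau : Ocell6 t0 tau `<=` Ccell6 t0 tau.
Proof.
move=> [t x] [tI Ox]; split; last exact: Ocell_sub.
by move: tI; rewrite /= !in_itv/= => /andP[/ltW -> ->].
Qed.

Lemma Ccell6_measurable t0 tau :
  measurable (Ccell6 t0 tau : set (spacetime5 (measurableTypeR R))).
Proof. by apply: measurableX; [exact: measurable_itv|exact: Ccell_measurable]. Qed.

Let mI (x tau : R) : measurable (`[x, (x + tau)[%classic : set (measurableTypeR R)).
Proof. exact: measurable_itv. Qed.

Lemma Ccell6_lty t0 tau : (leb6 (Ccell6 t0 tau) < +oo)%E.
Proof.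
exact: (prodm_rect_lty (mI t0 tau) (Ccell_measurable a h) (leb1_co_lty _ _) (Ccell_lty a h)).
Qed.

Lemma V6_dense t0 tau : 0 < tau -> dense2 leb6 (Ccell6 t0 tau) (V6 t0 tau).
Proof.
move=> tau0; have dB : dense2 leb1 `[t0, (t0 + tau)[%classic (Bcls t0 tau).
  by apply: dense_test_fun; rewrite ltrDl.
exact: (dense_product (mI t0 tau) (Ccell_measurable a h) (leb1_co_lty _ _)
  (Ccell_lty a h) (Bcls_vclass _ _) (Vcell_vclass a h) dB (Vcell_dense a h0)).
Qed.

Lemma test_fun_L2 (U C : set (spacetime5 R)) (f : spacetime5 R -> R) :
  measurable (C : set (spacetime5 (measurableTypeR R))) -> (leb6 C < +oo)%E ->
  test_fun U f -> L2 leb6 C f.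
Proof.
move=> mC Coo tf; have [M _ fM] := test_fun_bounded tf.
apply: (L2_bounded (mu := leb6) (M := M) mC Coo) => //.
by apply: measurable_funTS; exact: test_fun_measurable6 tf.
Qed.

Lemma V6_sqn t0 tau f : V6 t0 tau f -> sqn leb6 (Ccell6 t0 tau) f = sqn leb6 setT f.
Proof.
move=> Vf; apply: sqn_restrict => // p _ nC.
by apply: (test_fun0 (V6_test Vf)) => /Ocell6_sub.
Qed.

Lemma V6_L2 t0 tau f : V6 t0 tau f -> L2 leb6 (Ccell6 t0 tau) f.
Proof.
move=> Vf; exact: (test_fun_L2 (Ccell6_measurable t0 tau) (Ccell6_lty t0 tau) (V6_test Vf)).
Qed.

Lemma V6_sqnT t0 tau f : V6 t0 tau f ->
  sqn leb6 setT f = (nrm leb6 (Ccell6 t0 tau) f ^+ 2)%:E.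
Proof. by move=> Vf; rewrite nrm_sqr -(V6_sqn Vf); exact: L2_fin (V6_L2 Vf). Qed.

Lemma V6_nrm_ls t0 tau M (c : R) f : 0 <= c -> linop (Vcell a h) M ->
  l2bd leb5 (Vcell a h) M (c ^+ 2) -> V6 t0 tau f ->
  nrm leb6 (Ccell6 t0 tau) (ls M f) <= c * nrm leb6 (Ccell6 t0 tau) f.
Proof.
move=> c0 lM bM Vf.
have [lsM _ _] := linop_ls (Bcls t0 tau) (Vcell_vclass a h) lM.
have VMf : V6 t0 tau (ls M f) by exact: lsM.
have H : (sqn leb6 setT (ls M f) <= (c ^+ 2)%:E * sqn leb6 setT f)%E.
  exact: (l2bd_ls leb1 (sqr_ge0 c) (Bcls_vclass t0 tau) (Vcell_vclass a h) lM bM Vf).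
move: H; rewrite (V6_sqnT VMf) (V6_sqnT Vf) -EFinM lee_fin -exprMn.
by rewrite ler_pXn2r// nnegrE ?nrm_ge0// mulr_ge0// nrm_ge0.
Qed.

Lemma V6_sqn_tensor t0 tau (f : R -> R) (w : space5 R -> R) :
  Bcls t0 tau f -> Vcell a h w ->
  fine (sqn leb1 setT f) * fine (sqn leb5 setT w) =
  nrm leb6 (Ccell6 t0 tau) (fun p => f p.1 * w p.2) ^+ 2.
Proof.
move=> Bf Vw; have V : V6 t0 tau (fun p => f p.1 * w p.2) by exact: tens_prod.
have Lw : L2 leb5 setT w.
  split; first by have [_ _] := Vcell_vclass a h; apply.
  rewrite -(@sqn_restrict _ _ _ leb5 (Ccell a h) setT)//; last first.
    by move=> x _ nC; apply: (test_fun0 (Vcell_test Vw)) => /Ocell_sub.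
  have [M _ fM] := test_fun_bounded (Vcell_test Vw).
  apply: (L2_bounded (mu := leb5) (M := M) (Ccell_measurable a h) (Ccell_lty a h) _ _).2 => //.
  by apply: measurable_funTS; have [_ _] := Vcell_vclass a h; apply.
apply/eqP; rewrite -eqe EFinM -(L2_fin (B_L2 Bf)) -(L2_fin Lw) -(V6_sqnT V).
have mf : measurable_fun [set: measurableTypeR R] f by have [_ _] := Bcls_vclass t0 tau; apply.
have mT : measurable [set: measurableTypeR R] by [].
have mT5 : measurable [set: space5 (measurableTypeR R)] by [].
have := sqn_tensor leb1 leb5 mT mT5 mf Lw.1.
by rewrite setXTT => <-.
Qed.

Lemma partial_ls (M : (space5 R -> R) -> space5 R -> R) (f : spacetime5 R -> R)
    (i : 'I_5) (t : R) (x : space5 R) :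
  'D_(basis5 i) (M (fun y => f (t, y))) x = partial i (ls M f) (t, x).
Proof. exact: (@derive_snd _ R (space5 R) (ls M f) (basis5 i) (t, x)). Qed.

Lemma partial_t_tensor (f : R -> R) (w : space5 R -> R) (t : R) (x : space5 R) :
  derivable f t 1 ->
  partial_t (fun p => f p.1 * w p.2) (t, x) = 'D_1 f t * w x.
Proof.
move=> df.
rewrite -[LHS](@derive_fst _ R (space5 R) (fun p => f p.1 * w p.2) 1 (t, x)) /=.
rewrite (_ : (fun y : R => _) = w x \*: f); last first.
  by apply/funext => y; rewrite /= mulrC.
by rewrite deriveZ// /GRing.scale/= mulrC.
Qed.

(** The order of quantifiers matters: [w] and [kappa] depend on the spatial cell alone, so they stay
    fixed while tau shrinks; only [W] depends on the time interval. The last hypothesis asks for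
    control by the supremum of alpha, which is all that an equation with terms in L^1 in time can
    give. *)
Lemma cell_estimate : exists (w : space5 R -> R) (kappa : R),
  [/\ test_fun (Ocell a h) w, 0 <= kappa &
  forall t0 tau, 0 < tau -> exists W : spacetime5 R -> R,
    test_fun (Ocell6 t0 tau) W /\
    forall (u : spacetime5 R -> R) (du : 'I_5 -> spacetime5 R -> R) (K : R),
    L2 leb6 (Ccell6 t0 tau) u -> (forall i, L2 leb6 (Ccell6 t0 tau) (du i)) ->
    (forall i phi, test_fun (Ocell6 t0 tau) phi ->
      \int[leb6]_(p in Ccell6 t0 tau) (u p * partial i phi p) =
      - \int[leb6]_(p in Ccell6 t0 tau) (du i p * phi p)) ->
    0 <= K ->
    (forall (alpha : R -> R) (M : R), test_fun `]t0, (t0 + tau)[%classic alpha ->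
      (forall t, `|alpha t| <= M) ->
      `|\int[leb6]_(p in Ccell6 t0 tau)
        (u p * partial_t (fun p => alpha p.1 * w p.2) p)| <= K * M) ->
    nrm leb6 (Ccell6 t0 tau) u <=
      kappa * Num.sqrt tau * `|\int[leb6]_(p in Ccell6 t0 tau) (u p * W p)| +
      32 * h * \sum_(i < 5) nrm leb6 (Ccell6 t0 tau) (du i) +
      2 * kappa * Num.sqrt tau * K].
Proof.
have [A [P [w [pw w0]]]] := space_poinc a h0.
have [pA [lP bP] pD PJ Vw] := pw.
have tw := Vcell_test Vw.
set nw := Num.sqrt (fine (sqn leb5 setT w)); have nw0 : 0 < nw by rewrite sqrtr_gt0.
(* The projection onto multiples of [w] has norm at most 32; dividing by the norm of [w] converts a
   bound on beta(t) w(x) into one on beta. *)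
exists w, (32 / nw); split => //; first by rewrite divr_ge0// ltW.
move=> t0 tau tau0.
have ttau : t0 < t0 + tau by rewrite ltrDl.
have [wt [twt wtb wti]] := weight_exists ttau.
have Bwt : Bcls t0 tau wt by [].
exists (fun p => wt p.1 * w p.2); split; first exact: test_fun_tensor.
move=> u du K Lu Ldu uD K0 uT.
set C := Ccell6 t0 tau; have mC := Ccell6_measurable t0 tau.
have Coo := Ccell6_lty t0 tau.
set N := \int[leb6]_(p in C) (u p * (wt p.1 * w p.2)).
set S := \sum_(i < 5) nrm leb6 C (du i).
have S0 : 0 <= S by apply: sumr_ge0 => i _; exact: nrm_ge0.
apply: (@dual_bound _ _ _ leb6 C (V6 t0 tau) mC (V6_vclass t0 tau) u _ (V6_dense t0 tau0) Lu).
  have k0 : 0 <= 32 / nw by rewrite divr_ge0// ltW.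
  have s0 : 0 <= Num.sqrt tau by exact: sqrtr_ge0.
  have h0' := ltW h0; have N0 := normr_ge0 N.
  apply: addr_ge0; last by rewrite mulr_ge0// mulr_ge0// mulr_ge0.
  by apply: addr_ge0; rewrite mulr_ge0// mulr_ge0.
move=> f Vf; have tf := V6_test Vf.
have L26 g : test_fun (Ocell6 t0 tau) g -> L2 leb6 C g by exact: test_fun_L2.
(* Averaging in space leaves beta(t) w(x). The one-dimensional decomposition is then repeated in
   time: beta = J wt + alpha', where J is the integral of beta. *)
have [beta [Bbeta Ebeta]] := ls_weight (Bcls_vclass t0 tau) (Vcell_vclass a h) lP PJ Vf.
pose alpha := prim_op wt beta; pose J := \int[leb1]_t beta t.
have Balpha : Bcls t0 tau alpha by exact: (prim_opB twt wti Bbeta).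
have dalpha t : 'D_(1 : R) alpha t = beta t - J * wt t.
  by have [_ ->] := prim_derive twt t Bbeta.
pose psi i := ls (A i) f.
have Vpsi (i : 'I_5) : V6 t0 tau (psi i).
  by have [lA _ _] := linop_ls (Bcls t0 tau) (Vcell_vclass a h) (pA i (ltn_ord i)).1; exact: lA.
have Ef p : f p = J * (wt p.1 * w p.2) +
    (\sum_(i < 5) partial i (psi i) p + partial_t (fun p => alpha p.1 * w p.2) p).
  case: p => t x /=.
  have dt : partial_t (fun p => alpha p.1 * w p.2) (t, x) = (beta t - J * wt t) * w x.
    by rewrite partial_t_tensor ?dalpha//; apply: smooth_derivable; case: Balpha.
  have Vs : Vcell a h (fun y => f (t, y)) by exact: tens_slice2 (Vcell_vclass a h) Vf.
  have := pD _ x Vs.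
  have -> : P (fun y => f (t, y)) x = beta t * w x.
    exact: (congr1 (fun F => F (t, x)) Ebeta).
  have E : \sum_(i < 5) 'D_(basis5 (inord i)) (A i (fun y => f (t, y))) x =
      \sum_(i < 5) partial i (psi i) (t, x).
    by apply: eq_bigr => i _; rewrite inord_val; exact: (partial_ls (A i) f i t x).
  by rewrite E dt => /eqP; rewrite subr_eq => /eqP ->; ring.
have Lpsi (i : 'I_5) : L2 leb6 C (partial i (psi i)).
  by apply: L26; apply: test_fun_derive; exact: V6_test.
have LW : L2 leb6 C (fun p => wt p.1 * w p.2) by apply: L26; exact: test_fun_tensor.
have Lt : L2 leb6 C (partial_t (fun p => alpha p.1 * w p.2)).
  by apply: L26; apply: test_fun_derive; exact: test_fun_tensor.
have main := @norm_integral_decomp _ _ _ leb6 C 5 u f (fun p => wt p.1 * w p.2)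
  (partial_t (fun p => alpha p.1 * w p.2)) (fun i => partial i (psi i)) J mC Lu LW Lt Lpsi Ef.
set F := nrm leb6 C f; have F0 : 0 <= F by exact: nrm_ge0.
(* 32^2 = 4^5: the averaging operator of each coordinate costs a factor 4. *)
have bpsi (i : 'I_5) : nrm leb6 C (psi i) <= 32 * h * F.
  have [lA bA] := pA i (ltn_ord i).
  apply: V6_nrm_ls => //; first by rewrite mulr_ge0// ltW.
  by rewrite (_ : (32 * h) ^+ 2 = 4 ^+ 5 * h ^+ 2)//; ring.
have s0 : 0 <= Num.sqrt tau by exact: sqrtr_ge0.
(* Here the factor tau^(1/2) appears: it is the price of Cauchy-Schwarz from the L^2 to the L^1 norm
   of beta on an interval of length tau. The bounds on J and on the supremum of alpha both follow
   from it. *)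
have bbeta : \int[leb1]_t `|beta t| <= 32 / nw * Num.sqrt tau * F.
  have h1 : fine (sqn leb1 setT beta) * nw ^+ 2 <= (32 * F) ^+ 2.
    rewrite sqr_sqrtr ?(ltW w0)// (V6_sqn_tensor Bbeta Vw) -Ebeta.
    rewrite ler_pXn2r ?nnegrE ?nrm_ge0 ?mulr_ge0//; apply: V6_nrm_ls => //.
    by rewrite (_ : 32 ^+ 2 = 4 ^+ 5)//; ring.
  have := int_norm_sqr ttau Bbeta; rewrite (_ : t0 + tau - t0 = tau); last by ring.
  have {}h1 : fine (sqn leb1 setT beta) <= (32 * F) ^+ 2 / nw ^+ 2.
    by rewrite ler_pdivlMr// exprn_gt0.
  move=> h2; have {h1 h2} := le_trans h2 (ler_wpM2l (ltW tau0) h1).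
  have -> : tau * ((32 * F) ^+ 2 / nw ^+ 2) = (32 / nw * Num.sqrt tau * F) ^+ 2.
    rewrite -{1}(sqr_sqrtr (ltW tau0)); field; exact: lt0r_neq0.
  rewrite ler_pXn2r// ?nnegrE ?Rintegral_ge0//.
  by rewrite mulr_ge0// mulr_ge0// divr_ge0// ltW.
have bJ : `|J| <= 32 / nw * Num.sqrt tau * F.
  apply: le_trans bbeta; apply: le_normr_Rintegral => //.
  exact: test_fun_integrable Bbeta.
have balpha t : `|alpha t| <= 2 * (32 / nw * Num.sqrt tau * F).
  have pb : `|alpha t| <= 2 * \int[leb1]_x `|beta x| by exact: (prim_bound twt wtb wti t Bbeta).
  by apply: (le_trans pb); apply: ler_wpM2l bbeta.
have b3 := uT alpha _ Balpha balpha.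
have b2 (i : 'I_5) : `|\int[leb6]_(p in C) (u p * partial i (psi i) p)| <=
    nrm leb6 C (du i) * (32 * h * F).
  exact: (@norm_integral_by_parts _ _ _ leb6 C u (du i) (partial i (psi i)) (psi i) _ _ mC (Ldu i)
    (V6_L2 (Vpsi i)) (uD i (psi i) (V6_test (Vpsi i))) (bpsi i) (lexx _)).
exact: (@combine_bounds R 5 _ `|J| `|N| _ (32 / nw) (Num.sqrt tau) (32 * h) F K _
  (fun i => nrm leb6 C (du i)) main (normr_ge0 N) bJ b2 b3).
Qed.

End cell_estimate.

(** * Cylinders and energy bounds *)

Section cylinders.
Context {R : realType}.
Implicit Types (x : space5 R) (p : spacetime5 R) (rho : R).

Lemma rad5E x : rad5 x =
  Num.sqrt (x.1.1.1.1 ^+ 2 + x.1.1.1.2 ^+ 2 + x.1.1.2 ^+ 2 + x.1.2 ^+ 2).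
Proof.
rewrite /rad5 big_mkcond !big_ord_recl big_ord0 /= /coord5 /= !addr0.
by rewrite /bump/= !addrA.
Qed.

Lemma rad5_ge0 x : 0 <= rad5 x. Proof. exact: sqrtr_ge0. Qed.

Lemma rad5_continuous : continuous (@rad5 R).
Proof.
have -> : @rad5 R = fun x => Num.sqrt (x.1.1.1.1 ^+ 2 + x.1.1.1.2 ^+ 2 + x.1.1.2 ^+ 2 + x.1.2 ^+ 2).
  by apply/funext => x; exact: rad5E.
move=> x.
have f1 : x.1 @[x --> x] --> x.1 by exact: cvg_fst.
have f2 : x.1.1 @[x --> x] --> x.1.1 by apply: (cvg_comp _ _ f1); exact: cvg_fst.
have f3 : x.1.1.1 @[x --> x] --> x.1.1.1 by apply: (cvg_comp _ _ f2); exact: cvg_fst.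
have sq (g : space5 R -> R) : g y @[y --> x] --> g x -> g y ^+ 2 @[y --> x] --> g x ^+ 2.
  by move=> gx; rewrite expr2; apply: cvgM.
have S : y.1.1.1.1 ^+ 2 + y.1.1.1.2 ^+ 2 + y.1.1.2 ^+ 2 + y.1.2 ^+ 2 @[y --> x] -->
    x.1.1.1.1 ^+ 2 + x.1.1.1.2 ^+ 2 + x.1.1.2 ^+ 2 + x.1.2 ^+ 2.
  apply: cvgD; [apply: cvgD; [apply: cvgD|]|]; apply: sq.
  - by apply: (cvg_comp _ _ f3); exact: cvg_fst.
  - by apply: (cvg_comp _ _ f3); exact: cvg_snd.
  - by apply: (cvg_comp _ _ f2); exact: cvg_snd.
  - by apply: (cvg_comp _ _ f1); exact: cvg_snd.
by apply: (cvg_comp _ _ S); exact: sqrt_continuous.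
Qed.

Lemma rad5_cont6 : continuous (fun p : spacetime5 R => rad5 p.2).
Proof. by move=> p; apply: (cvg_comp _ _ (@cvg_snd _ _ _ _ _)); exact: rad5_continuous. Qed.

Lemma z_cont6 : continuous (fun p : spacetime5 R => `|p.2.2|).
Proof.
move=> p; apply: cvg_norm.
by apply: (cvg_comp _ _ (@cvg_snd _ _ _ _ _)); exact: cvg_snd.
Qed.

Lemma t_cont6 : continuous (fun p : spacetime5 R => p.1).
Proof. by move=> p; exact: cvg_fst. Qed.

Lemma coord_le_rad5 x : [/\ `|x.1.1.1.1| <= rad5 x, `|x.1.1.1.2| <= rad5 x,
  `|x.1.1.2| <= rad5 x & `|x.1.2| <= rad5 x].
Proof.
rewrite rad5E.
by split; rewrite -sqrtr_sqr ler_wsqrtr//;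
  have := sqr_ge0 x.1.1.1.1; have := sqr_ge0 x.1.1.1.2; have := sqr_ge0 x.1.1.2;
  have := sqr_ge0 x.1.2; lra.
Qed.

Lemma Qcyl_measurable rho : measurable (Qcyl rho : set (spacetime5 (measurableTypeR R))).
Proof.
have mlt (f : spacetime5 R -> R) c : continuous f ->
    measurable ([set p | f p < c] : set (spacetime5 (measurableTypeR R))).
  move=> cf; rewrite (_ : [set p | _] = f @^-1` `]-oo, c[); last first.
    by apply/seteqP; split => p; rewrite /= in_itv.
  rewrite -[X in measurable X]setTI.
  by apply: (spacetime_continuous_measurable cf) => //; exact: measurable_itv.
have -> : Qcyl rho = [set p | rad5 p.2 < rho] `&` [set p | `|p.2.2| < rho] `&`
    ([set p | - p.1 < rho ^+ 2] `&` [set p | p.1 < 0]) :> set (spacetime5 R).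
  apply/seteqP; split => p; rewrite /Qcyl /Dcyl /tI /=.
    by move=> [[-> ->] /andP[h ->]]; rewrite ltrNl.
  by move=> [[-> ->] [h ->]]; rewrite -ltrNl h.
apply: measurableI; apply: measurableI; apply: mlt.
- exact: rad5_cont6.
- exact: z_cont6.
- by move=> p; apply: cvgN; exact: t_cont6.
- exact: t_cont6.
Qed.

Lemma Dcyl_measurable rho : measurable (Dcyl rho : set (space5 (measurableTypeR R))).
Proof.
have mlt (f : space5 R -> R) c : continuous f ->
    measurable ([set p | f p < c] : set (space5 (measurableTypeR R))).
  move=> cf; rewrite (_ : [set p | _] = f @^-1` `]-oo, c[); last first.
    by apply/seteqP; split => p; rewrite /= in_itv.
  rewrite -[X in measurable X]setTI.
  by apply: (space_continuous_measurable cf) => //; exact: measurable_itv.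
have -> : Dcyl rho = [set x | rad5 x < rho] `&` [set x | `|x.2| < rho] :> set (space5 R) by [].
apply: measurableI; apply: mlt; first exact: rad5_continuous.
by move=> x; apply: cvg_norm; exact: cvg_snd.
Qed.

Lemma Dcyl_box rho : Dcyl rho `<=` Ccell (fun=> - rho) (2 * rho).
Proof.
move=> [[[[x0 x1] x2] x3] x4] [/= r z].
have [/= h0 h1 h2 h3] := coord_le_rad5 (x0, x1, x2, x3, x4).
rewrite /Ccell /= !in_itv/= (_ : - rho + 2 * rho = rho); last by ring.
have H y : `|y| < rho -> - rho <= y < rho by rewrite ltr_norml => /andP[/ltW -> ->].
by do ![split]; apply: H => //; apply: le_lt_trans r.
Qed.

Lemma Qcyl_box rho : Qcyl rho `<=` Ccell6 (fun=> - rho) (2 * rho) (- rho ^+ 2) (rho ^+ 2).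
Proof.
move=> [t x] [Dx tI]; split; last exact: Dcyl_box.
by move: tI; rewrite /tI /= in_itv/= addNr => /andP[/ltW -> ->].
Qed.

Lemma Qcyl_lty rho : (leb6 (Qcyl rho) < +oo)%E.
Proof.
apply: le_lt_trans (Ccell6_lty (fun=> - rho) (2 * rho) (- rho ^+ 2) (rho ^+ 2)).
apply: le_measure; rewrite ?inE; last exact: Qcyl_box.
  exact: Qcyl_measurable.
exact: Ccell6_measurable.
Qed.

Lemma Dcyl_lty rho : (leb5 (Dcyl rho) < +oo)%E.
Proof.
apply: le_lt_trans (Ccell_lty (fun=> - rho) (2 * rho)).
apply: le_measure; rewrite ?inE; last exact: Dcyl_box.
  exact: Dcyl_measurable.
exact: Ccell_measurable.
Qed.

Lemma sub_Qcyl rho rho' : 0 <= rho -> rho <= rho' -> Qcyl rho `<=` (Qcyl rho' : set (spacetime5 R)).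
Proof.
move=> r0 rr p [[h1 h2] /andP[h3 h4]]; split; first by split; exact: lt_le_trans rr.
apply/andP; split => //; apply: le_lt_trans h3.
by rewrite lerN2 lerXn2r// nnegrE// (le_trans r0).
Qed.

Lemma measurable_fun_Qcyl rho rho' (f : spacetime5 R -> R) : 0 <= rho -> rho <= rho' ->
  measurable_fun (Qcyl rho' : set (spacetime5 (measurableTypeR R))) f ->
  measurable_fun (Qcyl rho : set (spacetime5 (measurableTypeR R))) f.
Proof.
move=> r0 rr; apply: measurable_funS; first exact: Qcyl_measurable.
exact: sub_Qcyl.
Qed.

(** The continuous function max(|y|, |z|, -t) is below 1 on K, hence by compactness below 1 by a
    fixed margin. *)
Lemma compact_sub_Qcyl (K : set (spacetime5 R)) : compact K -> K `<=` Qcyl 1 ->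
  exists rho, 0 < rho < 1 /\ K `<=` Qcyl rho.
Proof.
move=> cK K1.
pose g p := Num.max (rad5 p.2) (Num.max `|p.2.2| (- p.1)).
have cg : continuous g.
  have ct : continuous (fun p : spacetime5 R => - p.1).
    by move=> q; apply: cvgN; exact: t_cont6.
  move=> p; have m1 := continuous_max (@z_cont6 p) (ct p).
  exact: (continuous_max (@rad5_cont6 p) m1).
have K0 : compact (g @` K).
  by apply: continuous_compact => //; exact: continuous_subspaceT.
have hK : \forall e \near 0^'+, (g @` K) `<=` (fun s => is_true (s <= 1 - e)).
  apply: ((compact_near_coveringP (g @` K)).1 K0 R (0^'+) (fun e s => is_true (s <= 1 - e))).
  move=> s [p Kp <-]; have [[h1 h2] /andP[h3 h4]] := K1 p Kp.
  have gp1 : g p < 1 by rewrite /g !gt_max h1 h2/= ltrNl; rewrite expr1n in h3.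
  pose e := (1 - g p) / 2; have e0 : 0 < e by rewrite divr_gt0// subr_gt0.
  exists (ball (g p) e, [set e' | e' < e]).
    by split; [exact: nbhsx_ballx|exact: nbhs_right_lt].
  move=> [s' e'] /= [+ e'e]; rewrite /ball/= ltr_distl => /andP[s1 s2].
  by rewrite /e in e'e s1 s2; lra.
near (0 : R)^'+ => e.
have e0 : 0 < e by near: e; exact: nbhs_right_gt.
have e1 : e < 1 by near: e; exact: nbhs_right_lt.
have he : forall s, (g @` K) s -> s <= 1 - e by near: e.
(* Half the margin suffices also for the quadratic time condition: (1 - e/2)^2 exceeds 1 - e, which
   bounds -t. *)
exists (1 - e / 2); split; first by apply/andP; split; lra.
move=> p Kp; have := he _ (ex_intro2 _ _ p Kp erefl).
rewrite /g !ge_max => /and3P[h1 h2 h3].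
have [_ /andP[_ h4]] := K1 p Kp.
split; first by split; lra.
by apply/andP; split => //; nra.
Unshelve. all: by end_near. Qed.

End cylinders.

Section norm_bounds.
Context d (T : measurableType d) (R : realType).
Variable mu : {measure set T -> \bar R}.
Local Open Scope ereal_scope.

Lemma poweR2 (x : \bar R) : 0 <= x -> x `^ 2 = x * x.
Proof.
case: x => [r| |]// r0.
  by rewrite poweR_EFin powR_mulrn ?expr2 ?EFinM.
by rewrite mulyy poweRyr// pnatr_eq0.
Qed.

Lemma Lnorm_infty (f : T -> \bar R) : 0 < mu setT ->
  Lnorm mu +oo f = ess_sup mu (abse \o f).
Proof. by move=> mu0; rewrite unlock /= mu0. Qed.

Lemma Lnorm2_sqr (f : T -> R) : Lnorm mu 2%:E (EFin \o f) `^ 2 = sqn mu setT f.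
Proof.
rewrite poweR_Lnorm//; apply: eq_integral => x _.
by rewrite poweR2//= -EFinM -expr2 real_normK// num_real.
Qed.

(** With N the L^{10/3} norm, |h|^2 <= N^2 1_D + N^(2 - 10/3) |h|^{10/3} holds pointwise: the first
    term wins where |h| <= N, the second elsewhere. Integrating gives N^2 mu(D) + N^2. *)
Lemma sqn_le_Lnorm (D : set T) (h : T -> R) : measurable D -> mu D < +oo ->
  measurable_fun setT h -> (forall x, ~ D x -> h x = 0%R) ->
  sqn mu setT h <= (1 + mu D) * Lnorm mu (10 / 3)%:E (EFin \o h) `^ 2.
Proof.
move=> mD Doo mh h0; have p0 : (0 < 10 / 3 :> R)%R by rewrite divr_gt0.
have : 0 <= Lnorm mu (10 / 3)%:E (EFin \o h) by exact: Lnorm_ge0.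
have muD : mu D = (fine (mu D))%:E by rewrite fineK// ge0_fin_numE.
have v0 : (0 <= fine (mu D))%R by rewrite fine_ge0.
have hp : (\int[mu]_x (`|h x| `^ (10 / 3))%:E) = Lnorm mu (10 / 3)%:E (EFin \o h) `^ (10 / 3).
  by rewrite poweR_Lnorm// gt_eqF.
case EN : (Lnorm mu (10 / 3)%:E (EFin \o h)) hp => [N| |]// hp; last first.
  by rewrite muD -EFinD poweRyr ?gt_eqF// gt0_muley ?leey// lte_fin ltr_wpDr.
(* The case N = 0 is separate, since the pointwise bound divides by a power of N; there [h] vanishes
   almost everywhere. *)
rewrite lee_fin le_eqVlt => /predU1P[N0|N0].
  rewrite -N0 in EN.
  have := Lnorm_eq0_eq0 _ _ EN; rewrite lte_fin => /(_ _ p0) h00.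
  have -> : sqn mu setT h = \int[mu]_x (cst 0 x).
    apply: ae_eq_integral => //; first exact: measurable_sqr.
    have : EFin \o h = \0 %[ae mu] by apply: h00; exact/measurable_EFinP.
    apply: filterS => x /= hx _; have := hx I; move=> [->].
    by rewrite expr2 mulr0.
  rewrite integral0 -N0 muD -EFinD poweR_EFin -EFinM lee_fin.
  by rewrite mulr_ge0 ?powR_ge0// addr_ge0.
have mD1 : measurable_fun setT (\1_D : T -> R) by exact: measurable_indic.
have mp : measurable_fun setT (fun x => `|h x| `^ (10 / 3))%R.
  apply: (measurableT_comp (f := fun y : R => y `^ (10 / 3))%R) => //.
  exact: measurableT_comp.
apply: (@le_trans _ _ (\int[mu]_x ((N ^+ 2)%:E * (\1_D x)%:E +
    (N ^+ 2 / N `^ (10 / 3))%:E * (`|h x| `^ (10 / 3))%:E))).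
  apply: ge0_le_integralW => x _; first by rewrite lee_fin sqr_ge0.
  rewrite -!EFinM -EFinD lee_fin -(real_normK (num_real (h x))).
  have hx0 := normr_ge0 (h x).
  have pN0 : (0 < N `^ (10 / 3))%R by rewrite powR_gt0.
  have q0 : (0 <= N ^+ 2 / N `^ (10 / 3) * `|h x| `^ (10 / 3))%R.
    by rewrite mulr_ge0 ?powR_ge0// divr_ge0 ?sqr_ge0// ltW.
  have [Dx|nDx] := pselect (D x); last first.
    rewrite h0// normr0 in q0 *.
    by rewrite expr0n addr_ge0// mulr_ge0 ?sqr_ge0.
  rewrite indicE (mem_set Dx) /= mulr1.
  have [hN|Nh] := leP `|h x|%R N.
    by rewrite -[leLHS]addr0 lerD// lerXn2r// nnegrE ltW.
  apply: (@le_trans _ _ (N ^+ 2 / N `^ (10 / 3) * `|h x| `^ (10 / 3)))%R; last first.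
    by rewrite lerDr sqr_ge0.
  have h1 : (0 < `|h x|)%R by exact: lt_trans Nh.
  rewrite mulrAC ler_pdivlMr//.
  have E (y : R) : (0 < y)%R -> (y `^ (10 / 3) = y ^+ 2 * y `^ (4 / 3))%R.
    move=> y0; rewrite -powR_mulrn ?ltW// -powRD; last by rewrite (gt_eqF y0) implybT.
    by congr (_ `^ _)%R; field.
  rewrite (E _ N0) (E _ h1) [leRHS]mulrCA.
  apply: ler_wpM2l; first exact: sqr_ge0.
  apply: ler_wpM2l; first exact: sqr_ge0.
  have q34 : (0 <= 4 / 3 :> R)%R by rewrite divr_ge0.
  apply: (ge0_ler_powR q34); rewrite ?nnegrE; exact: ltW.
rewrite ge0_integralD//; last 4 first.
- by move=> x _; rewrite mule_ge0// lee_fin ?sqr_ge0.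
- by apply/measurable_EFinP; apply: measurable_funM.
- by move=> x _; rewrite -EFinM lee_fin mulr_ge0 ?powR_ge0// divr_ge0 ?sqr_ge0 ?powR_ge0.
- by apply/measurable_EFinP; apply: measurable_funM.
rewrite ge0_integralZl//; last 2 first.
- exact/measurable_EFinP.
- by rewrite lee_fin sqr_ge0.
rewrite ge0_integralZl//; last 2 first.
- by apply/measurable_EFinP; exact: mp.
- by rewrite lee_fin divr_ge0 ?sqr_ge0 ?powR_ge0.
rewrite integral_indic// setIT hp muD !poweR_EFin -!EFinM -!EFinD lee_fin (powR_mulrn _ (ltW N0)).
by rewrite divfK ?gt_eqF ?powR_gt0//; lra.
Qed.

End norm_bounds.

Section uniform_bounds.
Context {R : realType}.
Implicit Types (rho X : R) (f h : spacetime5 R -> R).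
Local Open Scope ereal_scope.

Lemma leb1_tI rho : leb1 (tI rho) = (rho ^+ 2)%:E.
Proof.
rewrite (_ : tI rho = `](- rho ^+ 2)%R, 0%R[%classic); last first.
  by apply/seteqP; split => t; rewrite /tI /= in_itv.
have [h|h] := ltP (- rho ^+ 2)%R 0%R; first by rewrite leb1_oo// sub0r opprK.
have -> : (rho ^+ 2 = 0)%R by apply/eqP; rewrite eq_le sqr_ge0 andbT -oppr_ge0.
by rewrite oppr0 set_itv_ge ?measure0// bnd_simp ltxx.
Qed.

Lemma leb1T_gt0 : 0 < leb1 (setT : set (measurableTypeR R)).
Proof.
apply: (@lt_le_trans _ _ (leb1 `]0%R, 1%R[%classic)); first by rewrite leb1_oo// lte_fin subr0.
by apply: le_measure; rewrite ?inE//; exact: measurable_itv.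
Qed.

Lemma tI_measurable rho : measurable (tI rho : set (measurableTypeR R)).
Proof.
rewrite (_ : tI rho = `](- rho ^+ 2)%R, 0%R[%classic); first exact: measurable_itv.
by apply/seteqP; split => t; rewrite /tI /= in_itv.
Qed.

Lemma measurable_cut rho f : measurable_fun (Qcyl rho : set (spacetime5 (measurableTypeR R))) f ->
  measurable_fun (setT : set (spacetime5 (measurableTypeR R))) (fun p => f p * \1_(Qcyl rho) p)%R.
Proof.
move=> mf; have -> : (fun p => f p * \1_(Qcyl rho) p)%R = f \_ (Qcyl rho).
  by apply/funext => p; rewrite patchE indicE; case: (p \in _); rewrite ?mulr1 ?mulr0.
by apply/(measurable_restrictT f (Qcyl_measurable rho)).
Qed.

Lemma measurable_spaceslice f t :
  measurable_fun (setT : set (spacetime5 (measurableTypeR R))) f ->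
  measurable_fun (setT : set (space5 (measurableTypeR R))) (fun x => f (t, x)).
Proof. by move=> mf; exact: measurableT_comp. Qed.

(** The essential supremum bounds almost every slice by X^2, and slices outside [tI rho] vanish; the
    factor rho^2 is the length of the time interval. *)
Lemma sqn_le_LL rho X f : (0 <= X)%R ->
  measurable_fun (Qcyl rho : set (spacetime5 (measurableTypeR R))) f ->
  normLL +oo 2%:E rho f <= X%:E -> sqn leb6 (Qcyl rho) f <= (X ^+ 2 * rho ^+ 2)%:E.
Proof.
move=> X0 mf hN; rewrite sqn_indic.
have mh := measurable_cut mf.
rewrite /leb6 sqn_prod2//.
set h := (fun p => f p * \1_(Qcyl rho) p)%R in mh *.
have N2 t : Lnorm leb5 2%:E (fun x => (h (t, x))%:E) `^ 2 = sqn leb5 setT (fun x => h (t, x)).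
  exact: Lnorm2_sqr.
have mN := @measurable_sqn_slice2 _ _ _ _ _ leb5 h mh.
have h0 t x : ~ tI rho t -> h (t, x) = 0%R.
  by move=> nt; rewrite /h indicE memNset ?mulr0// => -[].
have hE : ess_sup leb1 (abse \o (fun t => Lnorm leb5 2%:E (fun x => (h (t, x))%:E))) <= X%:E.
  apply: le_trans hN; rewrite /normLL -/h.
  by rewrite (Lnorm_infty _ leb1T_gt0).
have aeN : {ae leb1, forall t, setT t ->
    sqn leb5 setT (fun x => h (t, x)) <= (X ^+ 2)%:E * (\1_(tI rho) t)%:E}.
  have := ess_sup_ge leb1 (abse \o (fun t => Lnorm leb5 2%:E (fun x => (h (t, x))%:E))).
  apply: filterS => t /= ht _.
  rewrite indicE; have [It|nIt] := pselect (tI rho t); last first.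
    by rewrite memNset// mule0 /sqn integral0_eq// => x _; rewrite h0// expr0n.
  rewrite (mem_set It) mule1.
  have {}ht : Lnorm leb5 2%:E (fun x => (h (t, x))%:E) <= X%:E.
    rewrite -[leLHS]gee0_abs ?Lnorm_ge0//; apply: le_trans ht _.
    exact: hE.
  rewrite -N2 poweR2 ?Lnorm_ge0//.
  by rewrite expr2 EFinM lee_pmul// ?Lnorm_ge0.
apply: (@le_trans _ _ (\int[leb1]_t ((X ^+ 2)%:E * (\1_(tI rho) t)%:E))); last first.
  rewrite ge0_integralZl//.
  - by rewrite [leRHS]EFinM -(leb1_tI rho) integral_indic ?setIT ?lexx//; exact: tI_measurable.
  - by apply/measurable_EFinP; apply: measurable_indic; exact: tI_measurable.
  - by rewrite lee_fin sqr_ge0.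
apply: ae_ge0_le_integral => //.
- by move=> t _; exact: sqn_ge0.
- by move=> t _; rewrite -EFinM lee_fin mulr_ge0 ?sqr_ge0// indicE.
- apply/measurable_EFinP; apply: measurable_funM => //.
  by apply: measurable_indic; exact: tI_measurable.
Qed.

(** On each time slice [sqn_le_Lnorm] trades the exponent 10/3 for 2 on the finite-measure set
    [Dcyl rho]. The slice norm is measurable in time as a power of a Tonelli integral, so the
    constant can be taken out. *)
Lemma sqn_le_L2L rho X h : (0 <= X)%R ->
  measurable_fun (Qcyl rho : set (spacetime5 (measurableTypeR R))) h ->
  normLL 2%:E (10 / 3)%:E rho h <= X%:E ->
  sqn leb6 (Qcyl rho) h <= (1 + leb5 (Dcyl rho)) * (X ^+ 2)%:E.
Proof.
move=> X0 mf hN; rewrite sqn_indic.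
have mh := measurable_cut mf.
rewrite /leb6 sqn_prod2//.
set f := (fun p => h p * \1_(Qcyl rho) p)%R in mh *.
have f0 t x : ~ Dcyl rho x -> f (t, x) = 0%R.
  by move=> nx; rewrite /f indicE memNset ?mulr0// => -[].
have n0 : 0 <= normLL 2%:E (10 / 3)%:E rho h by exact: Lnorm_ge0.
have : normLL 2%:E (10 / 3)%:E rho h `^ 2 <= (X ^+ 2)%:E.
  by rewrite (poweR2 n0) expr2 [leRHS]EFinM lee_pmul.
rewrite /normLL poweR_Lnorm//= => hI.
have muD : leb5 (Dcyl rho) = (fine (leb5 (Dcyl rho)))%:E by rewrite fineK// ge0_fin_numE// Dcyl_lty.
have v0 : (0 <= 1 + fine (leb5 (Dcyl rho)))%R by rewrite addr_ge0// fine_ge0.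
apply: (@le_trans _ _ ((1 + leb5 (Dcyl rho)) * \int[leb1]_t
   (Lnorm leb5 (10 / 3)%:E (fun x => (f (t, x))%:E) `^ 2))); last first.
  rewrite muD -EFinD lee_wpmul2l ?lee_fin//.
  apply: le_trans hI; apply: ge0_le_integralW => t _; first by rewrite poweR_ge0.
  by rewrite gee0_abs ?Lnorm_ge0.
rewrite -ge0_integralZl//; last 3 first.
- apply: (measurableT_comp (measurable_poweR 2)).
  rewrite [X in measurable_fun _ X](_ : _ = fun t => (\int[leb5]_x (`|f (t, x)| `^ (10 / 3))%:E) `^ (10 / 3)^-1).
    apply: (measurableT_comp (measurable_poweR _)).
    apply: (@measurable_fun_fubini_tonelli_F _ _ _ _ _ leb5 (fun p => (`|f p| `^ (10 / 3))%:E)).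
      apply/measurable_EFinP; apply: (measurableT_comp (f := fun y : R => y `^ (10 / 3))%R) => //.
      exact: measurableT_comp.
    by move=> p; rewrite lee_fin powR_ge0.
  apply/funext => t; rewrite unlock /Lnorm/=; congr (_ `^ _).
- by move=> t _; exact: poweR_ge0.
- by rewrite muD -EFinD lee_fin.
apply: ge0_le_integralW => t _; first exact: sqn_ge0.
apply: sqn_le_Lnorm.
- exact: Dcyl_measurable.
- exact: Dcyl_lty.
- exact: (measurable_spaceslice t mh).
- by move=> x nx; exact: (f0 t x nx).
Qed.

Lemma measurable_vnorm rho (v : 'I_5 -> spacetime5 R -> R) :
  (forall i, measurable_fun (Qcyl rho : set (spacetime5 (measurableTypeR R))) (v i)) ->
  measurable_fun (Qcyl rho : set (spacetime5 (measurableTypeR R))) (vnorm v).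
Proof.
move=> mv; apply: (measurableT_comp (f := @Num.sqrt R)).
  exact: continuous_measurable_fun (@sqrt_continuous R).
by apply: measurable_sum => i; apply: measurable_funX.
Qed.

Lemma sqn_le_vnorm rho (v : 'I_5 -> spacetime5 R -> R) i :
  sqn leb6 (Qcyl rho) (v i) <= sqn leb6 (Qcyl rho) (vnorm v).
Proof.
apply: ge0_le_integralW => p _; rewrite lee_fin ?sqr_ge0//.
rewrite sqr_sqrtr ?sumr_ge0// => [|j _]; last exact: sqr_ge0.
by rewrite (bigD1 i)//= lerDl sumr_ge0// => j _; exact: sqr_ge0.
Qed.

(** The single constant [M] dominates the separate bounds X^2 rho^2 for G, X^2 for the gradient and
    X^2 (1 + |D_rho|) for the drift. *)
Lemma cyl_bounds rho X (G : spacetime5 R -> R) (dG b : 'I_5 -> spacetime5 R -> R) (h : \bar R) :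
  (0 <= X)%R -> 0 <= h ->
  measurable_fun (Qcyl rho : set (spacetime5 (measurableTypeR R))) G ->
  (forall i, measurable_fun (Qcyl rho : set (spacetime5 (measurableTypeR R))) (dG i)) ->
  (forall i, measurable_fun (Qcyl rho : set (spacetime5 (measurableTypeR R))) (b i)) ->
  normLL +oo 2%:E rho G + normL2 rho (vnorm dG) +
    normLL 2%:E (10 / 3)%:E rho (vnorm b) + h <= X%:E ->
  let M := (X ^+ 2 * (1 + rho ^+ 2 + fine (leb5 (Dcyl rho))))%R in
  [/\ sqn leb6 (Qcyl rho) G <= M%:E, forall i, sqn leb6 (Qcyl rho) (dG i) <= M%:E &
    forall i, sqn leb6 (Qcyl rho) (b i) <= M%:E].
Proof.
move=> X0 h0 mG mdG mb hX M.
have n1 : 0 <= normLL +oo 2%:E rho G by exact: Lnorm_ge0.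
have n2 : 0 <= normL2 rho (vnorm dG) by exact: Lnorm_ge0.
have n3 : 0 <= normLL 2%:E (10 / 3)%:E rho (vnorm b) by exact: Lnorm_ge0.
have h3 : normLL +oo 2%:E rho G + normL2 rho (vnorm dG) +
    normLL 2%:E (10 / 3)%:E rho (vnorm b) <= X%:E by apply: le_trans hX; rewrite leeDl.
have h2 : normLL +oo 2%:E rho G + normL2 rho (vnorm dG) <= X%:E by apply: le_trans h3; rewrite leeDl.
have v0 : (0 <= fine (leb5 (Dcyl rho)))%R by rewrite fine_ge0.
have r0 := sqr_ge0 rho; have x0 := sqr_ge0 X.
split.
- apply: le_trans (sqn_le_LL X0 mG _) _; first by apply: le_trans h2; rewrite leeDl.
  by rewrite lee_fin /M; nra.
- move=> i; apply: le_trans (sqn_le_vnorm _ _ _) _; rewrite sqn_indic.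
  apply: (@le_trans _ _ (X ^+ 2)%:E); last by rewrite lee_fin /M; nra.
  have h1 : normL2 rho (vnorm dG) <= X%:E by apply: le_trans h2; rewrite leeDr.
  move: n2 h1; rewrite /normL2 => n2 h1.
  apply: (@le_trans _ _ (normL2 rho (vnorm dG) `^ 2)).
    by rewrite /normL2 (Lnorm2_sqr leb6 (fun p => vnorm dG p * \1_(Qcyl rho) p)%R).
  by rewrite (poweR2 n2) expr2 [leRHS]EFinM lee_pmul.
move=> i; apply: le_trans (sqn_le_vnorm _ _ _) _.
have h1 : normLL 2%:E (10 / 3)%:E rho (vnorm b) <= X%:E by apply: le_trans h3; rewrite leeDr// adde_ge0.
apply: le_trans (sqn_le_L2L X0 (measurable_vnorm mb) h1) _.
have -> : leb5 (Dcyl rho) = (fine (leb5 (Dcyl rho)))%:E by rewrite fineK// ge0_fin_numE// Dcyl_lty.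
by rewrite -EFinD -EFinM lee_fin /M; nra.
Qed.

End uniform_bounds.

(** * The source and the weak form on a cell *)

Section source.
Context {R : realType}.

(* Neither [f] nor [g] is assumed measurable: below, [g t] is the H^{-m} norm of
   [s t], a supremum over an uncountable family. *)
Lemma Rintegral_normW d (T : measurableType d) (mu : {measure set T -> \bar R})
    (D : set T) (f : T -> R) (g : T -> \bar R) (N : R) :
  (forall x, D x -> (`|f x|%:E <= g x)%E) -> (\int[mu]_(x in D) g x <= N%:E)%E ->
  `|\int[mu]_(x in D) f x| <= N.
Proof.
move=> fg gN; rewrite /Rintegral integralE.
have hp : (\int[mu]_(x in D) (fun x => (f x)%:E)^\+ x <= N%:E)%E.
  apply: le_trans gN; apply: ge0_le_integralW => x Dx; first exact: funepos_ge0.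
  by apply: le_trans (fg x Dx); rewrite unlock/= ge_max !lee_fin ler_norm normr_ge0.
have hn : (\int[mu]_(x in D) (fun x => (f x)%:E)^\- x <= N%:E)%E.
  apply: le_trans gN; apply: ge0_le_integralW => x Dx; first exact: funeneg_ge0.
  by apply: le_trans (fg x Dx); rewrite unlock/= ge_max !lee_fin normr_ge0 andbT (le_trans (ler_norm _))// normrN.
have p0 : (0 <= \int[mu]_(x in D) (fun x => (f x)%:E)^\+ x)%E by exact: integral_ge0.
have n0 : (0 <= \int[mu]_(x in D) (fun x => (f x)%:E)^\- x)%E by exact: integral_ge0.
move: p0 n0 hp hn; set p := integral _ _ _; set n := integral _ _ _.
case: p => [p| |]//; case: n => [n| |]//=; rewrite !lee_fin => p0 n0 pN nN.
by rewrite ler_norml; apply/andP; split; lra.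
Qed.

Lemma iter_derive_bounded (V : normedModType R) (U : set V) (e : 'I_5 -> V) k (f : V -> R) :
  test_fun U f -> exists S : R, 0 <= S /\ forall s : seq 'I_5, (size s <= k)%N ->
    forall x, `|iter_derive (map e s) f x| <= S.
Proof.
elim: k f => [|k IH] f tf; have [M M0 fM] := test_fun_bounded tf.
  by exists M; split; [exact: ltW|case].
have /choice[S HS] : forall i, exists S : R, 0 <= S /\ forall s : seq 'I_5, (size s <= k)%N ->
    forall x, `|iter_derive (map e s) ('D_(e i) f) x| <= S.
  by move=> i; apply: IH; exact: test_fun_derive.
have S0 : 0 <= \sum_(i < 5) S i by apply: sumr_ge0 => i _; exact: (HS i).1.
exists (M + \sum_(i < 5) S i); split; first by rewrite addr_ge0// ltW.
case/lastP => [|s i] sk x; first by rewrite (le_trans (fM x))// lerDl.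
rewrite map_rcons iter_derive_rcons.
have {}sk : (size s <= k)%N by rewrite size_rcons in sk.
apply: le_trans ((HS i).2 s sk x) _.
rewrite (bigD1 i)//= addrCA lerDl addr_ge0 ?(ltW M0)// sumr_ge0// => j _; exact: (HS j).1.
Qed.

Lemma test_fun_spaceslice rho (phi : spacetime5 R -> R) t : test_fun (Qcyl rho) phi ->
  test_fun (Dcyl rho) (fun x => phi (t, x)).
Proof.
move=> /test_funP[sp [K [cK KU p0]]]; apply/test_funP; split; first exact: smooth_slice.
exists (snd @` K); split.
- by apply: continuous_compact => //; apply: continuous_subspaceT => p; exact: cvg_snd.
- by move=> _ [p Kp <-]; have [] := KU p Kp.
by move=> x nx; apply: p0 => Kp; apply: nx; exists (t, x).
Qed.

(** The squared H^m norm of a function whose derivatives up to order m are all 1 in absolute value;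
    kept as a double sum to be compared term by term with [sqHnorm]. *)
Definition deriv_vol m rho : R :=
  \sum_(k < m.+1) \sum_(w : k.-tuple 'I_5) fine (leb5 (Dcyl rho)).

Lemma sqHnorm_le m rho (psi : space5 R -> R) (B : R) : 0 <= B ->
  (forall s : seq 'I_5, (size s <= m)%N -> forall x, `|iter_derive (map basis5 s) psi x| <= B) ->
  sqHnorm m rho psi <= B ^+ 2 * deriv_vol m rho.
Proof.
move=> B0 hB; rewrite /sqHnorm /deriv_vol mulr_sumr; apply: ler_sum => k _.
rewrite mulr_sumr; apply: ler_sum => w _.
have Dfin : leb5 (Dcyl rho) = (fine (leb5 (Dcyl rho)))%:E by rewrite fineK// ge0_fin_numE// Dcyl_lty.
apply: le_trans (ler_norm _) _; apply: (@Rintegral_normW _ _ _ _ _ (cst (B ^+ 2)%:E)).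
  move=> x _; rewrite lee_fin ger0_norm ?sqr_ge0// -(real_normK (num_real _)).
  by rewrite lerXn2r ?nnegrE// hB// size_tuple -ltnS.
rewrite integral_cst; last exact: Dcyl_measurable.
by rewrite [leRHS]EFinM -Dfin.
Qed.

Lemma test_linear0 (V : normedModType R) (U : set V) T : test_linear U T -> T (fun=> 0) = 0.
Proof.
move=> lT; have t0 := @test_fun_cst0 R V U.
have := lT 1 _ _ t0 t0; rewrite (_ : (fun x => _) = fun=> 0); last first.
  by apply/funext => x; rewrite mulr0 addr0.
by rewrite mul1r => /eqP; rewrite -subr_eq0 opprD addrA subrr add0r oppr_eq0 => /eqP.
Qed.

Lemma test_linear_scale (V : normedModType R) (U : set V) T c f : test_linear U T ->
  test_fun U f -> T (fun x => c * f x) = c * T f.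
Proof.
move=> lT tf; have := lT c _ _ tf (@test_fun_cst0 R V U).
rewrite (test_linear0 lT) addr0 => <-; congr T.
by apply/funext => x; rewrite addr0.
Qed.

(** After division by B c, with c = 1 + [deriv_vol m rho], every time slice of phi lies in the unit
    ball of H^m, because c^2 is at least [deriv_vol m rho]. The functional at time t is then at most
    its H^{-m} norm, and integration in t gives N. *)
Lemma source_bound m rho : exists2 c : R, 0 < c & forall S s phi (B N : R),
  test_linear (Qcyl rho) S -> represents_L1Hneg m rho S s ->
  (normL1Hneg m rho s <= N%:E)%E -> test_fun (Qcyl rho) phi -> 0 <= B ->
  (forall l : seq 'I_5, (size l <= m)%N -> forall t x,
    `|iter_derive (map basis5 l) (fun x => phi (t, x)) x| <= B) ->
  `|S phi| <= B * (c * N).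
Proof.
have v0 : 0 <= deriv_vol m rho by do 2!apply: sumr_ge0 => *; rewrite fine_ge0.
exists (1 + deriv_vol m rho) => [|S s phi B N lS [ls ms Nfin repS] sN tphi B0 hB].
  by rewrite ltr_pwDl.
set c := 1 + _; have c0 : 0 < c by rewrite ltr_pwDl.
apply/ler_addgt0Pr => e e0.
(* The H^{-m} norm is nonnegative because the zero function belongs to the unit ball over which the
   supremum is taken. *)
have N0 : 0 <= N.
  rewrite -lee_fin; apply: le_trans sN; apply: integral_ge0 => t It.
  apply: ereal_sup_ubound; exists (fun=> 0).
    split; first exact: test_fun_cst0.
    apply: le_trans (@sqHnorm_le m rho _ 0 (lexx _) _) _; last by rewrite expr0n mul0r.
    move=> l _ x; have := @iter_derive_scale R _ 0 (fun=> 0) (map basis5 l).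
    rewrite (_ : (fun _ => 0 * 0) = fun=> 0); last by apply/funext => y; rewrite mulr0.
    by move=> ->; [rewrite mul0r normr0|exact: smooth_cst].
  by rewrite (test_linear0 (ls t It)) normr0.
(* A strictly positive replacement for B, which may be 0; the increase costs at most e in the final
   bound. *)
pose B' := B + e / (c * (N + 1)).
have B'0 : 0 < B' by rewrite /B' ltr_wpDl// divr_gt0// mulr_gt0// ltr_wpDl.
have -> : phi = fun p => (B' * c) * ((B' * c)^-1 * phi p).
  by apply/funext => p; rewrite mulVKf// gt_eqF// mulr_gt0.
have tp := test_fun_scale (B' * c)^-1 tphi.
rewrite (test_linear_scale _ lS tp) normrM (ger0_norm (mulr_ge0 (ltW B'0) (ltW c0))).
apply: (@le_trans _ _ (B' * c * N)).
  rewrite repS// ler_wpM2l//; first by rewrite mulr_ge0// ltW.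
  apply: Rintegral_normW sN => t It.
  have tpt := test_fun_spaceslice t tp.
  apply: ereal_sup_ubound; exists (fun x => (B' * c)^-1 * phi (t, x)) => //; split => //.
  apply: le_trans (@sqHnorm_le m rho _ c^-1 _ _) _; first by rewrite invr_ge0 ltW.
    move=> l lm x; rewrite iter_derive_scale; last exact: (smooth_slice _ (test_fun_smooth tphi)).
    have i0 : 0 <= (B' * c)^-1 by rewrite invr_ge0 mulr_ge0// ltW.
    rewrite normrM (ger0_norm i0) invfM mulrC mulrA.
    rewrite -[leRHS]mul1r ler_wpM2r ?invr_ge0 ?(ltW c0)// ler_pdivrMr// mul1r.
    by apply: le_trans (hB l lm t x) _; rewrite lerDl divr_ge0 ?(ltW e0)// mulr_ge0 ?addr_ge0 ?(ltW c0).
  rewrite exprVn ler_pdivrMl ?exprn_gt0// mulr1 /c.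
  by nra.
rewrite -mulrA /B' mulrDl lerD2l mulrAC ler_pdivrMr; last by rewrite mulr_gt0// ltr_wpDl.
rewrite ler_wpM2l ?(ltW e0)// ler_wpM2l ?(ltW c0)//.
by rewrite lerDl.
Qed.

End source.

Section integral_bound.
Context d (T : measurableType d) (R : realType).
Variables (mu : {measure set T -> \bar R}) (D : set T).
Hypothesis mD : measurable D.

Lemma Rintegral_mul_le (f g : T -> R) (B : R) : mu.-integrable D (EFin \o f) ->
  (forall x, D x -> `|g x| <= B) -> 0 <= B ->
  `|\int[mu]_(x in D) (f x * g x)| <= B * \int[mu]_(x in D) `|f x|.
Proof.
move=> intf gB B0; apply: (@Rintegral_normW _ _ _ _ _ _ (fun x => (B * `|f x|)%:E)).
  by move=> x Dx; rewrite lee_fin normrM mulrC ler_wpM2r// gB.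
have intn : mu.-integrable D (EFin \o (fun x => `|f x|)) by exact: integrable_norm.
rewrite -RintegralZl// fineK//.
by apply: integrable_fin_num => //; exact: (integrableZl mD B intn).
Qed.

End integral_bound.

Section weak_form.
Context {R : realType}.
Implicit Types (phi : spacetime5 R -> R).

Lemma partial_slice i phi t x : 'D_(basis5 i) (fun y => phi (t, y)) x = partial i phi (t, x).
Proof. exact: (@derive_snd _ R (space5 R) phi (basis5 i) (t, x)). Qed.

Lemma partial_tensor i (f : R -> R) (w : space5 R -> R) : smooth w ->
  partial i (fun p => f p.1 * w p.2) = (fun p => f p.1 * 'D_(basis5 i) w p.2).
Proof.
move=> sw; apply/funext => -[t x]; rewrite -partial_slice /=.
have -> : (fun y => f t * w y) = f t \*: w by [].
by rewrite deriveZ//; exact: smooth_derivable.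
Qed.

Lemma laplacian_tensor (f : R -> R) (w : space5 R -> R) : smooth w ->
  laplacian (fun p => f p.1 * w p.2) =
  (fun p => f p.1 * \sum_(i < 5) 'D_(basis5 i) ('D_(basis5 i) w) p.2).
Proof.
move=> sw; apply/funext => p; rewrite /laplacian mulr_sumr; apply: eq_bigr => i _.
have sdw : smooth ('D_(basis5 i) w) by exact: smooth_derive.
by rewrite (partial_tensor i f sw) (partial_tensor i f sdw).
Qed.

Lemma test_fun_laplacian (U : set (spacetime5 R)) phi : test_fun U phi -> test_fun U (laplacian phi).
Proof.
move=> tphi; have tp i : test_fun U (partial i (partial i phi)) by do 2!apply: test_fun_derive.
have -> : laplacian phi = fun p => \sum_(i <- index_enum 'I_5) partial i (partial i phi) p.
  by apply/funext.
elim: (index_enum _) => [|i s IH].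
  rewrite (_ : (fun p => _) = fun=> 0); first exact: test_fun_cst0.
  by apply/funext => p; rewrite big_nil.
rewrite (_ : (fun p => _) = fun p => partial i (partial i phi) p + \sum_(i <- s) partial i (partial i phi) p).
  exact: test_fun_add.
by apply/funext => p; rewrite big_cons.
Qed.

Lemma pairing_restrict (U C O : set (spacetime5 R)) f phi : C `<=` U -> O `<=` C ->
  test_fun O phi -> pairing U f phi = \int[leb6]_(p in C) (f p * phi p).
Proof.
move=> CU OC tphi; apply/esym; apply: Rintegral_restrict => // p _ nC.
by rewrite (test_fun0 tphi) ?mulr0// => /OC.
Qed.

(** The equation tested with alpha(t) w(x) expresses the time-derivative term by drift, Laplacian
    and source, each bounded by the supremum of the test function and its spatial derivatives. Order
    [m.+2] covers both the m derivatives for the source and the two of the Laplacian, whose five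
    terms give the factor 5. The constant [c] depends on m and the radius only, hence is the same
    for all cells. *)
Lemma weak_form_bound (m : nat) (rho1 : R) : 0 < rho1 < 1 -> exists2 c : R, 0 < c &
  forall (nu N Sw A t0 tau h : R) (a : nat -> R) G dG b S s w alpha,
  let C := Ccell6 a h t0 tau in
  0 < nu -> is_distribution (Qcyl 1) S -> solves (Qcyl 1) nu G dG b S ->
  represents_L1Hneg m rho1 S s -> (normL1Hneg m rho1 s <= N%:E)%E ->
  C `<=` Qcyl rho1 ->
  test_fun (Ocell a h) w -> 0 <= Sw ->
  (forall l : seq 'I_5, (size l <= m.+2)%N -> forall x, `|iter_derive (map basis5 l) w x| <= Sw) ->
  test_fun `]t0, (t0 + tau)[%classic alpha -> (forall t, `|alpha t| <= A) ->
  leb6.-integrable C (EFin \o G) -> leb6.-integrable C (EFin \o dotf b dG) ->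
  `|\int[leb6]_(p in C) (G p * partial_t (fun p => alpha p.1 * w p.2) p)| <=
  Sw * (\int[leb6]_(p in C) `|dotf b dG p| + 5 * nu * (\int[leb6]_(p in C) `|G p|) + c * N) * A.
Proof.
move=> /andP[r0 r1]; have [c c0 hc] := @source_bound R m rho1; exists c => //.
move=> nu N Sw A t0 tau h a G dG b S s w alpha C nu0 dS sol repS sN CQ tw Sw0 hw ta aA iG ib.
have A0 : 0 <= A by exact: le_trans (aA 0).
pose phi := fun p : spacetime5 R => alpha p.1 * w p.2.
have tphi : test_fun (Ocell6 a h t0 tau) phi by exact: (test_fun_tensor ta tw).
have OC : Ocell6 a h t0 tau `<=` C by exact: Ocell6_sub.
have Q1 : Qcyl rho1 `<=` (Qcyl 1 : set (spacetime5 R)) by apply: sub_Qcyl; exact: ltW.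
have C1 : C `<=` Qcyl 1 by exact: subset_trans CQ Q1.
have mC : measurable (C : set (spacetime5 (measurableTypeR R))) by exact: Ccell6_measurable.
have t1 : test_fun (Qcyl 1) phi by apply: test_fun_sub tphi; exact: subset_trans C1.
have tr : test_fun (Qcyl rho1) phi by apply: test_fun_sub tphi; exact: subset_trans CQ.
have tt : test_fun (Ocell6 a h t0 tau) (partial_t phi) by exact: test_fun_derive.
have tl := test_fun_laplacian tphi.
have := sol phi t1.
rewrite (pairing_restrict G C1 OC tt) (pairing_restrict _ C1 OC tphi) (pairing_restrict G C1 OC tl).
have bphi p : `|phi p| <= Sw * A.
  rewrite /phi normrM mulrC ler_pM//; exact: (hw [::]).
have blap p : `|laplacian phi p| <= 5 * Sw * A.
  rewrite laplacian_tensor; last exact: test_fun_smooth tw.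
  rewrite normrM [leLHS]mulrC; apply: ler_pM => //; apply: le_trans (ler_norm_sum _ _ _) _.
  apply: (@le_trans _ _ (\sum_(i < 5) Sw)); last by rewrite sumr_const card_ord mulr_natl.
  by apply: ler_sum => i _; exact: (hw [:: i; i]).
have E1 := @Rintegral_mul_le _ _ _ leb6 C mC _ phi _ ib (fun p _ => bphi p) (mulr_ge0 Sw0 A0).
have SA0 : 0 <= 5 * Sw * A by rewrite !mulr_ge0.
have E2 := @Rintegral_mul_le _ _ _ leb6 C mC _ (laplacian phi) _ iG (fun p _ => blap p) SA0.
have lS : test_linear (Qcyl rho1) S.
  by move=> k f g tf tg; apply: dS.1; apply: test_fun_sub Q1 _.
have E3 : `|S phi| <= Sw * A * (c * N).
  apply: (hc _ _ _ _ _ lS repS sN tr (mulr_ge0 Sw0 A0)) => l lm t x.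
  rewrite /phi /= iter_derive_scale; last exact: test_fun_smooth tw.
  by rewrite normrM mulrC ler_pM// hw// (leq_trans lm)// ltnW.
move: E1 E2 E3.
set I1 := Rintegral _ _ _; set I2 := Rintegral _ _ _; set I3 := Rintegral _ _ _; set I4 := Rintegral _ _ _.
set I5 := Rintegral _ _ _.
move: I1 I2 I3 I4 I5 (S phi) => I1 I2 I3 I4 I5 Sp.
rewrite !ler_norml => /andP[a1 a2] /andP[b1 b2] /andP[c1 c2] e.
have d1 : nu * I3 <= nu * (5 * Sw * A * I4) by rewrite ler_pM2l.
have d2 : nu * - (5 * Sw * A * I4) <= nu * I3 by rewrite ler_pM2l.
by apply/andP; split; lra.
Qed.

End weak_form.

(** * Compactness *)

Section disjoint_cells.
Context d (T : measurableType d) (R : realType).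
Variable mu : {measure set T -> \bar R}.
Local Open Scope ereal_scope.
Variables (I : finType) (C : I -> set T) (f : T -> \bar R).
Hypothesis mC : forall i, measurable (C i).
Hypothesis dC : forall i j x, C i x -> C j x -> i = j.
Hypothesis f0 : forall x, 0 <= f x.

Let trivC : trivIset [set` index_enum I] C.
Proof. by move=> i j _ _ [x [Cx Cy]]; exact: (dC Cx Cy). Qed.

Lemma sum_integral_cells (E : set T) : measurable E -> measurable_fun E f ->
  (forall i, C i `<=` E) ->
  \sum_i \int[mu]_(x in C i) f x = \int[mu]_(x in \big[setU/set0]_i C i) f x /\
  \big[setU/set0]_i C i `<=` E.
Proof.
move=> mE mf CE.
have UE : \big[setU/set0]_i C i `<=` E.
  by elim/big_ind: _ => // A B AE BE x [/AE|/BE].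
split => //; rewrite ge0_integral_bigsetU//; first exact: index_enum_uniq.
exact: measurable_funS mf.
Qed.

Lemma sum_integral_cells_le (E : set T) : measurable E -> measurable_fun E f ->
  (forall i, C i `<=` E) -> \sum_i \int[mu]_(x in C i) f x <= \int[mu]_(x in E) f x.
Proof.
move=> mE mf CE; have [-> UE] := sum_integral_cells mE mf CE.
by apply: ge0_subset_integral => //; exact: bigsetU_measurable.
Qed.

Lemma integral_le_sum_cells (D E : set T) : measurable D -> measurable E -> measurable_fun E f ->
  (forall i, C i `<=` E) -> (forall x, D x -> exists i, C i x) ->
  \int[mu]_(x in D) f x <= \sum_i \int[mu]_(x in C i) f x.
Proof.
move=> mD mE mf CE DC; have [-> UE] := sum_integral_cells mE mf CE.
have mU : measurable (\big[setU/set0]_i C i) by exact: bigsetU_measurable.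
apply: ge0_subset_integral => //; first exact: measurable_funS mf.
by move=> x /DC[i Cx]; rewrite (bigD1 i)//=; left.
Qed.

End disjoint_cells.

Section disjoint_cells_real.
Context d (T : measurableType d) (R : realType).
Variables (mu : {measure set T -> \bar R}) (I : finType) (C : I -> set T) (E : set T) (f : T -> R).
Hypotheses (mC : forall i, measurable (C i)) (dC : forall i j x, C i x -> C j x -> i = j)
  (f0 : forall x, 0 <= f x) (mE : measurable E) (CE : forall i, C i `<=` E)
  (fi : mu.-integrable E (EFin \o f)).

Let fin (A : set T) : measurable A -> A `<=` E ->
  (\int[mu]_(x in A) (f x)%:E = (\int[mu]_(x in A) f x)%:E)%E.
Proof.
move=> mA AE; rewrite fineK//; apply: integrable_fin_num => //.
exact: integrableS fi.
Qed.

Let sumE : (\sum_i \int[mu]_(x in C i) (f x)%:E)%E = (\sum_i \int[mu]_(x in C i) f x)%:E.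
Proof. by rewrite -sumEFin; apply: eq_bigr => i _; rewrite fin. Qed.

Let mf : measurable_fun E (EFin \o f). Proof. exact: measurable_int fi. Qed.

Let f0E x : (0 <= (f x)%:E)%E. Proof. by rewrite lee_fin. Qed.

Lemma sum_Rintegral_cells_le : \sum_i \int[mu]_(x in C i) f x <= \int[mu]_(x in E) f x.
Proof. by rewrite -lee_fin -sumE -fin//; exact: sum_integral_cells_le. Qed.

Lemma Rintegral_le_sum_cells (D : set T) : measurable D -> D `<=` E ->
  (forall x, D x -> exists i, C i x) ->
  \int[mu]_(x in D) f x <= \sum_i \int[mu]_(x in C i) f x.
Proof. by move=> mD DE DC; rewrite -lee_fin -sumE -fin//; exact: (@integral_le_sum_cells _ _ _ mu _ C _ mC dC f0E D E). Qed.

End disjoint_cells_real.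

(** * Covering a cylinder by cells *)

Section cover.
Context {R : realType}.
Implicit Types (x : space5 R) (rho h : R).

Lemma itv_index_inj (A h y : R) (k l : nat) : 0 < h ->
  A + h * k%:R <= y < A + h * k%:R + h -> A + h * l%:R <= y < A + h * l%:R + h -> k = l.
Proof.
move=> h0 /andP[k1 k2] /andP[l1 l2].
have kl : h * k%:R < h * (l%:R + 1) by rewrite mulrDr mulr1; lra.
have lk : h * l%:R < h * (k%:R + 1) by rewrite mulrDr mulr1; lra.
move: kl lk; rewrite !ltr_pM2l// !natr1 !ltr_nat !ltnS => kl lk.
by apply/eqP; rewrite eqn_leq kl.
Qed.

Lemma itv_index_ex (A h y : R) (n : nat) : 0 < h -> A <= y < A + h * n%:R ->
  exists k : 'I_n, A + h * k%:R <= y < A + h * k%:R + h.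
Proof.
move=> h0 /andP[Ay yn].
have y0 : 0 <= (y - A) / h by rewrite divr_ge0 ?subr_ge0// ltW.
have := truncn_itv y0; set k := Num.truncn _ => /andP[k1 k2].
rewrite ler_pdivlMr// in k1; rewrite ltr_pdivrMr// -natr1 mulrDl mul1r in k2.
have kn : (k < n)%N.
  by rewrite -(ltr_nat R) -(ltr_pM2l h0) mulrC; lra.
by exists (Ordinal kn); apply/andP; split => /=; rewrite [h * _]mulrC; lra.
Qed.

Definition corner (n : nat) rho h (k : 'I_n * 'I_n * 'I_n * 'I_n * 'I_n) (i : nat) : R :=
  - rho + h * (nth 0%N [:: val k.1.1.1.1; val k.1.1.1.2; val k.1.1.2; val k.1.2; val k.2] i)%:R.

(** Within a cell of side h each of the four squared y-coordinates grows by at most 2 rho h + h^2,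
    so |y|^2 stays below rho^2 + 8 rho h + 4 h^2, which is less than (rho + 8 h)^2. This is the
    origin of the 8. *)
Lemma Ccell_near rho rho1 h (a : nat -> R) : 0 < rho -> rho < rho1 -> 0 < h ->
  h <= (rho1 - rho) / 8 ->
  (exists2 x, Dcyl rho x & Ccell a h x) -> Ccell a h `<=` Dcyl rho1.
Proof.
move=> r0 r01 h0 hh [[[[[x0 x1] x2] x3] x4]] [/= xr xz].
have [/= c0 c1 c2 c3] := coord_le_rad5 (x0, x1, x2, x3, x4).
rewrite /Ccell /= !in_itv/= => -[[[[e0 e1] e2] e3] e4].
move=> [[[[y0 y1] y2] y3] y4]; rewrite /Ccell /= !in_itv/= => -[[[[f0 f1] f2] f3] f4].
have r00 := rad5_ge0 (x0, x1, x2, x3, x4).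
have sq : rad5 (x0, x1, x2, x3, x4) ^+ 2 = x0 ^+ 2 + x1 ^+ 2 + x2 ^+ 2 + x3 ^+ 2.
  by rewrite rad5E/= sqr_sqrtr// !addr_ge0// sqr_ge0.
have rr : rad5 (x0, x1, x2, x3, x4) ^+ 2 < rho ^+ 2 by rewrite ltrXn2r.
have H (a' u v : R) : a' <= u < a' + h -> a' <= v < a' + h -> `|u| <= rho ->
    v ^+ 2 <= u ^+ 2 + 2 * rho * h + h ^+ 2.
  move=> /andP[u1 u2] /andP[v1 v2]; rewrite ler_norml => /andP[u3 u4].
  have d1 : - h <= v - u by lra.
  have d2 : v - u <= h by lra.
  have -> : v = u + (v - u) by ring.
  move: (v - u) d1 d2 => e d1 d2.
  have s2 : e ^+ 2 <= h ^+ 2 by nra.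
  have s1 : u * e <= rho * h by nra.
  by rewrite sqrrD -mulr_natl; lra.
have le (u : R) : `|u| <= rad5 (x0, x1, x2, x3, x4) -> `|u| <= rho by move=> /le_trans; apply; exact: ltW.
split; rewrite /=.
  rewrite rad5E /= -(ger0_norm (ltW (lt_trans r0 r01))) -sqrtr_sqr ltr_sqrt; last by rewrite exprn_gt0// (lt_trans r0).
  have q0 := H _ _ _ e0 f0 (le _ c0); have q1 := H _ _ _ e1 f1 (le _ c1).
  have q2 := H _ _ _ e2 f2 (le _ c2); have q3 := H _ _ _ e3 f3 (le _ c3).
  apply: (@lt_le_trans _ _ (rho ^+ 2 + 8 * rho * h + 4 * h ^+ 2)); first lra.
  by nra.
move: xz; rewrite !ltr_norml => /andP[z1 z2]; move: e4 f4 => /andP[? ?] /andP[? ?].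
by apply/andP; split; lra.
Qed.

(** The spatial cells are fixed before the number N of time steps, as the constants of the cell
    estimate depend on them. The step rho^2/N divides the time interval exactly, so that no cell
    passes t = 0, where the cylinder ends. *)
Lemma cover_exists rho rho1 h : 0 < rho -> rho < rho1 -> 0 < h -> h <= (rho1 - rho) / 8 ->
  exists (I : finType) (a : I -> nat -> R), forall N : nat, (0 < N)%N ->
  let tau := rho ^+ 2 / N%:R in
  let C (c : I * 'I_N) := Ccell6 (a c.1) h (- rho ^+ 2 + tau * c.2%:R) tau in
  [/\ forall i j p, C i p -> C j p -> i = j,
      forall i, C i `<=` Qcyl rho1 &
      forall p, Qcyl rho p -> exists i, C i p].
Proof.
move=> r0 r01 h0 hh.
have [n hn] : exists n : nat, 2 * rho <= h * n%:R.
  exists (Num.truncn (2 * rho / h)).+1.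
  have y0 : 0 <= 2 * rho / h by rewrite divr_ge0 ?mulr_ge0// ltW.
  by have /andP[_ /ltW] := truncn_itv y0; rewrite ler_pdivrMr// [X in _ -> _ <= X]mulrC.
(* Of the cubes tiling a box around [Dcyl rho], those contained in [Dcyl rho1] are kept; by
   [Ccell_near] this includes every cube that meets [Dcyl rho]. *)
pose I := {k : 'I_n * 'I_n * 'I_n * 'I_n * 'I_n | `[< Ccell (corner rho h k) h `<=` Dcyl rho1 >]}.
exists I, (fun i : I => corner rho h (val i)).
move=> N N0 tau C.
have tau0 : 0 < tau by rewrite divr_gt0 ?exprn_gt0 ?ltr0n.
have tauN : tau * N%:R = rho ^+ 2 by rewrite /tau divfK// pnatr_eq0 -lt0n.
split.
- move=> [i k] [j l] [t x] [/= t1 x1] [/= t2 x2].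
  move: t1 t2; rewrite !in_itv/= => t1 t2.
  have kl : k = l by apply/val_inj; exact: itv_index_inj tau0 t1 t2.
  rewrite kl; congr (_, _); apply: val_inj.
  case: i j x1 x2 => [[[[[i0 i1] i2] i3] i4] gi] [[[[[j0 j1] j2] j3] j4] gj] /=.
  case: x => [[[[x0 x1] x2] x3] x4].
  rewrite /Ccell /corner /= !in_itv/= => -[[[[e0 e1] e2] e3] e4] [[[[f0 f1] f2] f3] f4].
  have E (u v : 'I_n) y : - rho + h * u%:R <= y < - rho + h * u%:R + h ->
     - rho + h * v%:R <= y < - rho + h * v%:R + h -> u = v.
    by move=> a b; apply/val_inj; exact: itv_index_inj h0 a b.
  by rewrite (E _ _ _ e0 f0) (E _ _ _ e1 f1) (E _ _ _ e2 f2) (E _ _ _ e3 f3) (E _ _ _ e4 f4).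
- move=> [[i /= /asboolP gi] k] [t x] [/= tI Cx]; split; first exact: gi.
  move: tI; rewrite in_itv/= => /andP[t1 t2]; apply/andP; split.
    apply: lt_le_trans t1; apply: (@lt_le_trans _ _ (- rho ^+ 2)).
      by rewrite ltrN2; nra.
    by rewrite lerDl mulr_ge0// ltW.
  apply: lt_le_trans t2 _; rewrite -tauN -addrA -[X in _ + (_ + X)]mulr1 -mulrDr addrC subr_le0.
  by rewrite ler_pM2l// natr1 ler_nat; exact: ltn_ord.
move=> [t [[[[x0 x1] x2] x3] x4]] [/= Dx /andP[/= t1 t2]].
have [k kt] : exists k : 'I_N, - rho ^+ 2 + tau * k%:R <= t < - rho ^+ 2 + tau * k%:R + tau.
  by apply: itv_index_ex => //; rewrite tauN addNr ltW.
have box := Dcyl_box Dx.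
have E (y : R) : - rho <= y < - rho + 2 * rho -> exists k : 'I_n, - rho + h * k%:R <= y < - rho + h * k%:R + h.
  move=> /andP[y1 y2]; apply: itv_index_ex => //; rewrite y1/=; apply: lt_le_trans y2 _.
  by rewrite lerD2l.
move: box.
rewrite /Ccell /= !in_itv/= => -[[[[/E[k0 e0] /E[k1 e1]] /E[k2 e2]] /E[k3 e3]] /E[k4 e4]].
have Cx : Ccell (corner rho h (k0, k1, k2, k3, k4)) h (x0, x1, x2, x3, x4).
  by rewrite /Ccell /corner /= !in_itv/=.
have g : `[< Ccell (corner rho h (k0, k1, k2, k3, k4)) h `<=` Dcyl rho1 >].
  apply/asboolP; apply: (Ccell_near r0 r01 h0 hh).
  by exists (x0, x1, x2, x3, x4).
by exists (exist _ (k0, k1, k2, k3, k4) g, k).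
Qed.

End cover.

Lemma sqr_add3_le (R : realType) (x a b c : R) : 0 <= x -> 0 <= a -> 0 <= b -> 0 <= c ->
  x <= a + b + c -> x ^+ 2 <= 3 * (a ^+ 2 + b ^+ 2 + c ^+ 2).
Proof.
move=> x0 a0 b0 c0 h; have := sqr_ge0 (a - b); have := sqr_ge0 (b - c).
by have := sqr_ge0 (a - c); nra.
Qed.

Lemma sqr_sum5_le (R : realType) (f : 'I_5 -> R) :
  (\sum_(i < 5) f i) ^+ 2 <= 5 * \sum_(i < 5) f i ^+ 2.
Proof.
rewrite !big_ord_recl !big_ord0 !addr0.
set x0 := f _; set x1 := f _; set x2 := f _; set x3 := f _; set x4 := f _.
have := sqr_ge0 (x0 - x1); have := sqr_ge0 (x0 - x2); have := sqr_ge0 (x0 - x3).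
have := sqr_ge0 (x0 - x4); have := sqr_ge0 (x1 - x2); have := sqr_ge0 (x1 - x3).
have := sqr_ge0 (x1 - x4); have := sqr_ge0 (x2 - x3); have := sqr_ge0 (x2 - x4).
by have := sqr_ge0 (x3 - x4); nra.
Qed.

(** The constants: squaring a sum of three terms costs 3, and a sum of five costs 5, so the
    gradients get 3 * 32^2 * 5 = 15360. The last term carries 3 * 2^2 = 12 times the square of a sum
    bounded by 2 Sw^2 (Fj + Fk)^2 + 8 Sw^2 c^2 N^2, whence 24 and 96. *)
Lemma cell_square_bound (R : realType) (x I h S tau kappa Sw c Fj Fk N : R) (d : 'I_5 -> R) :
  0 <= x -> 0 <= kappa -> 0 <= h -> (forall i, 0 <= d i) -> 0 <= tau -> 0 <= Sw -> 0 <= c ->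
  0 <= Fj -> 0 <= Fk -> 0 <= N ->
  x <= kappa * Num.sqrt tau * `|I| + 32 * h * \sum_(i < 5) d i +
    2 * kappa * Num.sqrt tau * (Sw * (Fj + c * N) + Sw * (Fk + c * N)) ->
  x ^+ 2 <= (3 * kappa ^+ 2 + 24 * kappa ^+ 2 * Sw ^+ 2 + 96 * kappa ^+ 2 * Sw ^+ 2 * c ^+ 2) * tau *
    (I ^+ 2 + (Fj + Fk) ^+ 2 + N ^+ 2) + 15360 * h ^+ 2 * \sum_(i < 5) d i ^+ 2.
Proof.
move=> x0 k0 h0 d0 t0 Sw0 c0 Fj0 Fk0 N0 hx.
have s0 : 0 <= Num.sqrt tau by exact: sqrtr_ge0.
have a0 : 0 <= kappa * Num.sqrt tau * `|I| by rewrite !mulr_ge0.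
have b0 : 0 <= 32 * h * \sum_(i < 5) d i by rewrite !mulr_ge0// sumr_ge0.
have K0 : 0 <= Sw * (Fj + c * N) + Sw * (Fk + c * N).
  by rewrite addr_ge0// mulr_ge0// addr_ge0// mulr_ge0.
have e0 : 0 <= 2 * kappa * Num.sqrt tau * (Sw * (Fj + c * N) + Sw * (Fk + c * N)).
  by rewrite !mulr_ge0.
apply: le_trans (sqr_add3_le x0 a0 b0 e0 hx) _.
rewrite !exprMn !(sqr_sqrtr t0) (real_normK (num_real I)).
have hd := sqr_sum5_le d; have := sqr_ge0 h.
have K2 : (Sw * (Fj + c * N) + Sw * (Fk + c * N)) ^+ 2 <=
    2 * Sw ^+ 2 * (Fj + Fk) ^+ 2 + 8 * Sw ^+ 2 * c ^+ 2 * N ^+ 2.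
  have -> : Sw * (Fj + c * N) + Sw * (Fk + c * N) = Sw * (Fj + Fk) + Sw * (2 * c * N) by ring.
  by have := sqr_ge0 (Sw * (Fj + Fk) - Sw * (2 * c * N)); nra.
move: K2 hd; set K := _ + _ * (Fk + _); set D := \sum_(i < 5) d i; set D2 := \sum_(i < 5) _.
move=> K2 hd h2.
have q1 : 0 <= kappa ^+ 2 * tau by rewrite mulr_ge0// sqr_ge0.
have q2 := ler_wpM2l q1 K2; have q3 := ler_wpM2l h2 hd.
have p1 : 0 <= kappa ^+ 2 * tau * I ^+ 2 by rewrite mulr_ge0// sqr_ge0.
have p2 : 0 <= kappa ^+ 2 * tau * (Fj + Fk) ^+ 2 by rewrite mulr_ge0// sqr_ge0.
have p3 : 0 <= kappa ^+ 2 * tau * N ^+ 2 by rewrite mulr_ge0// sqr_ge0.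
have s1 := sqr_ge0 Sw; have s2 := mulr_ge0 (sqr_ge0 Sw) (sqr_ge0 c).
have r1 := mulr_ge0 p1 s1; have r2 := mulr_ge0 p1 s2; have r3 := mulr_ge0 p2 s2.
have r4 := mulr_ge0 p3 s1.
rewrite expr2 in q2 |- *.
lra.
Qed.

Lemma cell_cst_ge0 (R : realType) (x y z : R) :
  0 <= 3 * x ^+ 2 + 24 * x ^+ 2 * y ^+ 2 + 96 * x ^+ 2 * y ^+ 2 * z ^+ 2.
Proof.
have h1 := mulr_ge0 (sqr_ge0 x) (sqr_ge0 y); have h2 := mulr_ge0 h1 (sqr_ge0 z).
by have := sqr_ge0 x; lra.
Qed.

Section integrable_products.
Context d (T : measurableType d) (R : realType).
Variables (mu : {measure set T -> \bar R}) (Q : set T).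
Hypotheses (mQ : measurable Q) (Qoo : (mu Q < +oo)%E).

Lemma L2_integrable (f : T -> R) : L2 mu Q f -> mu.-integrable Q (EFin \o f).
Proof.
move=> Lf; have L1 : L2 mu Q (cst 1).
  by apply: (L2_bounded (M := 1) mQ Qoo) => // p _; rewrite normr1.
have := L2_integrableM mQ Lf L1.
by apply: eq_integrable => // p _; rewrite /= mulr1.
Qed.

Lemma L2_subset (C : set T) (f : T -> R) : measurable C -> C `<=` Q ->
  L2 mu Q f -> L2 mu C f.
Proof.
move=> mC CQ [mf f2]; split; first exact: measurable_funS mf.
by apply: le_lt_trans f2; exact: sqn_subset.
Qed.

Lemma sqn_int (f : T -> R) : \int[mu]_(p in Q) (f p) ^+ 2 = nrm mu Q f ^+ 2.
Proof. by rewrite nrm_sqr. Qed.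

Lemma dot_integrable n (f g : 'I_n -> T -> R) :
  (forall i, L2 mu Q (f i)) -> (forall i, L2 mu Q (g i)) ->
  mu.-integrable Q (EFin \o (fun p => \sum_(i < n) f i p * g i p)).
Proof.
move=> Lf Lg.
exact: (Rintegral_sum (index_enum 'I_n) mQ (fun i => L2_integrableM mQ (Lf i) (Lg i))).1.
Qed.

Lemma dot_norm_le n (f g : 'I_n -> T -> R) (M : R) : 0 <= M ->
  (forall i, L2 mu Q (f i)) -> (forall i, L2 mu Q (g i)) ->
  (forall i, (sqn mu Q (f i) <= M%:E)%E) -> (forall i, (sqn mu Q (g i) <= M%:E)%E) ->
  \int[mu]_(p in Q) `|\sum_(i < n) f i p * g i p| <= n%:R * M.
Proof.
move=> M0 Lf Lg fM gM.
have iN i := integrable_norm (L2_integrableM mQ (Lf i) (Lg i)).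
have [iS ES] := Rintegral_sum (index_enum 'I_n) mQ iN.
apply: (@le_trans _ _ (\int[mu]_(p in Q) (\sum_(i < n) `|f i p * g i p|))).
  apply: le_Rintegral => //; first exact: (integrable_norm (dot_integrable Lf Lg)).
  by move=> p _; exact: ler_norm_sum.
rewrite ES (@le_trans _ _ (\sum_(i < n) M))//; last by rewrite sumr_const card_ord mulr_natl.
apply: ler_sum => i _.
have := cauchy_schwarz mQ (Lf i) (Lg i).
set x := Rintegral _ _ _ => hx; have x0 : 0 <= x by exact: Rintegral_ge0.
have h1 : fine (sqn mu Q (f i)) <= M by rewrite -lee_fin -L2_fin.
have h2 : fine (sqn mu Q (g i)) <= M by rewrite -lee_fin -L2_fin.
have g1 : 0 <= fine (sqn mu Q (f i)) by rewrite fine_ge0 ?sqn_ge0.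
have g2 : 0 <= fine (sqn mu Q (g i)) by rewrite fine_ge0 ?sqn_ge0.
by rewrite -ler_sqr ?nnegrE// (le_trans hx)// expr2 ler_pM.
Qed.

Lemma L1_norm_le (f : T -> R) (M : R) : L2 mu Q f -> (sqn mu Q f <= M%:E)%E ->
  \int[mu]_(p in Q) `|f p| <= M + fine (mu Q).
Proof.
move=> Lf fM.
have i1 := L2_integrableM mQ Lf Lf.
have L1 : L2 mu Q (cst 1).
  by apply: (L2_bounded (M := 1) mQ Qoo) => // p _; rewrite normr1.
have i2 := L2_integrable L1.
apply: (@le_trans _ _ (\int[mu]_(p in Q) (f p * f p + cst 1 p))).
  apply: le_Rintegral => //; first exact: (integrable_norm (L2_integrable Lf)).
    exact: (integrableD mQ i1 i2).
  move=> p _ /=; rewrite -expr2 -(real_normK (num_real (f p))).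
  by have := sqr_ge0 (`|f p| - 1); nra.
rewrite RintegralD// Rintegral_cst// mul1r lerD2r.
by rewrite -lee_fin -[X in (X <= _)%E](L2_fin Lf).
Qed.

Lemma Rintegral_subM (f g phi : T -> R) : L2 mu Q f -> L2 mu Q g -> L2 mu Q phi ->
  \int[mu]_(p in Q) ((f p - g p) * phi p) =
  \int[mu]_(p in Q) (f p * phi p) - \int[mu]_(p in Q) (g p * phi p).
Proof.
move=> Lf Lg Lp; rewrite -RintegralB//; try exact: L2_integrableM.
by apply: eq_Rintegral => p _; rewrite mulrBl.
Qed.

End integrable_products.

(** For nonnegative terms the sum of squares is at most the square of the sum, so the L^1 masses
    contribute [Ft ^+ 2] however many cells there are; only N, common to all cells, is multiplied by
    their number. *)
Lemma sum_cells_bound (R : realType) (K : finType) (X P F D Lc : K -> R) (L L' tau N Ft Dt : R) :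
  (forall c, X c <= Lc c * tau * (P c ^+ 2 + F c ^+ 2 + N ^+ 2) + L' * D c) ->
  (forall c, Lc c <= L) -> 0 <= tau -> (forall c, 0 <= F c) -> 0 <= L -> 0 <= L' ->
  \sum_c F c <= Ft -> \sum_c D c <= Dt ->
  \sum_c X c <= L * tau * (\sum_c P c ^+ 2 + Ft ^+ 2 + #|K|%:R * N ^+ 2) + L' * Dt.
Proof.
move=> hX hL t0 F0 L0 L'0 FT DT.
have S0 : 0 <= \sum_c F c by apply: sumr_ge0.
have F2 : \sum_c F c ^+ 2 <= Ft ^+ 2.
  apply: (@le_trans _ _ ((\sum_c F c) ^+ 2)); last by rewrite lerXn2r// nnegrE// (le_trans S0).
  rewrite [leRHS]expr2 mulr_suml; apply: ler_sum => c _; rewrite expr2 ler_wpM2l//.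
  by rewrite (bigD1 c)//= lerDl sumr_ge0.
apply: (@le_trans _ _ (\sum_c (L * tau * (P c ^+ 2 + F c ^+ 2 + N ^+ 2) + L' * D c))).
  apply: ler_sum => c _; apply: le_trans (hX c) _; rewrite lerD2r.
  by rewrite ler_wpM2r ?addr_ge0 ?sqr_ge0// ler_wpM2r.
rewrite big_split/= -!mulr_sumr lerD ?ler_wpM2l ?mulr_ge0//.
rewrite !big_split/= lerD ?lerD2l//.
by rewrite sumr_const mulr_natl.
Qed.

Lemma choice2_fun (I A : Type) (P : A -> Prop) (Q : I -> A -> Prop) :
  (forall i, exists2 a, P a & Q i a) -> exists f : I -> A, forall i, P (f i) /\ Q i (f i).
Proof.
move=> h; have /choice[f hf] : forall i, exists a, P a /\ Q i a by move=> i; have [a] := h i; exists a.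
by exists f.
Qed.

Section sqr_sub.
Context d (T : measurableType d) (R : realType).
Variables (mu : {measure set T -> \bar R}) (Q : set T).
Hypothesis (mQ : measurable Q).

Lemma sqr_sub_integrable (f g : T -> R) : L2 mu Q f -> L2 mu Q g ->
  mu.-integrable Q (EFin \o (fun p => (f p - g p) ^+ 2)).
Proof. by move=> Lf Lg; apply: L2_integrableM => //; exact: L2_sub. Qed.

Lemma sqr_sub_le (f g : T -> R) (M : R) : L2 mu Q f -> L2 mu Q g ->
  (sqn mu Q f <= M%:E)%E -> (sqn mu Q g <= M%:E)%E ->
  \int[mu]_(p in Q) (f p - g p) ^+ 2 <= 4 * M.
Proof.
move=> Lf Lg fM gM.
have i1 := integrableZl mQ 2 (L2_integrableM mQ Lf Lf).
have i2 := integrableZl mQ 2 (L2_integrableM mQ Lg Lg).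
apply: (@le_trans _ _ (\int[mu]_(p in Q) (2 * (f p * f p) + 2 * (g p * g p)))).
  apply: le_Rintegral => //; first exact: sqr_sub_integrable.
    exact: (integrableD mQ i1 i2).
  by move=> p _; have := sqr_ge0 (f p + g p); nra.
rewrite RintegralD// !RintegralZl//; try exact: L2_integrableM.
have h1 : \int[mu]_(p in Q) (f p * f p) <= M by rewrite -lee_fin -[X in (X <= _)%E](L2_fin Lf).
have h2 : \int[mu]_(p in Q) (g p * g p) <= M by rewrite -lee_fin -[X in (X <= _)%E](L2_fin Lg).
by move: h1 h2; move: (Rintegral _ _ _) (Rintegral _ _ _) => x y; lra.
Qed.

End sqr_sub.

(** The image filter has a cluster point in the compact segment [-B, B], and for an ultrafilter a
    cluster point is a limit. *)
Lemma ultra_bounded_cvg (R : realType) (F : set_system nat) (x : nat -> R) (B : R) :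
  UltraFilter F -> (forall n, `|x n| <= B) -> exists l : R, x n @[n --> F] --> l.
Proof.
move=> UF xB.
have PF : ProperFilter (x n @[n --> F]) by apply: fmap_proper_filter; exact: ultra_proper.
have /(_ _ PF)[|l [_ cl]] := @segment_compact R (- B) B.
  by apply: (@filterE _ F) => n; rewrite /= in_itv/= -ler_norml.
exists l => U Ul; have [//|h] := in_ultra_setVsetC (x @^-1` U) UF.
by have [y []] := cl (~` U) U h Ul.
Qed.

(** The requirement h <= 1 gives h^2 <= h, so that smallness of a linear expression in h also
    controls the quadratic ones. *)
Lemma split_constants (R : realType) (eps B0 d : R) : 0 < eps -> 0 <= B0 -> 0 < d ->
  exists2 h : R, 0 < h <= d & h <= 1 /\ B0 * h <= eps.
Proof.
move=> e0 B00 d0; exists (Num.min d (Num.min 1 (eps / (B0 + 1)))).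
  by rewrite !lt_min d0 ltr01 divr_gt0 ?ltr_wpDl//= ge_min lexx.
split; first by rewrite !ge_min lexx orbT.
set h := Num.min _ _; have h1 : h <= eps / (B0 + 1) by rewrite /h !ge_min lexx !orbT.
have h0 : 0 < h by rewrite !lt_min d0 ltr01 divr_gt0 ?ltr_wpDl.
by move: h1; rewrite ler_pdivlMr ?ltr_wpDl//; nra.
Qed.

Lemma sqr_le_self (R : realDomainType) (x : R) : 0 < x -> x <= 1 -> x ^+ 2 <= x.
Proof. by move=> x0 x1; rewrite expr2 ler_piMl// ltW. Qed.

Lemma sqr_dist_le (R : realFieldType) (l x y e : R) : 0 < e -> e <= 1 ->
  `|l - x| <= e / 2 -> `|l - y| <= e / 2 -> (x - y) ^+ 2 <= e.
Proof.
move=> e0 e1; rewrite !ler_norml => /andP[x1 x2] /andP[y1 y2].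
have a1 : - e <= x - y by lra.
have a2 : x - y <= e by lra.
by nra.
Qed.

Lemma quarters_le (R : realFieldType) (x y z w e : R) : x <= e / 4 -> y <= e / 4 -> z <= e / 4 ->
  w <= e / 4 -> x + y + z + w <= e.
Proof. by lra. Qed.

Section compactness.
Context {R : realType}.
Variables (nu : R) (m : nat) (G : nat -> spacetime5 R -> R)
  (dG b : nat -> 'I_5 -> spacetime5 R -> R) (src : nat -> (spacetime5 R -> R) -> R).
Hypotheses (nu0 : 0 < nu) (wG : forall j, weak_gradient (Qcyl 1) (G j) (dG j))
  (dS : forall j, is_distribution (Qcyl 1) (src j))
  (sol : forall j, solves (Qcyl 1) nu (G j) (dG j) (b j) (src j))
  (mb : forall j i, measurable_fun (Qcyl 1 : set (spacetime5 (measurableTypeR R))) (b j i)).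

Section fixed_radius.
Variables (rho1 M : R) (s : nat -> R -> (space5 R -> R) -> R).
Hypotheses (r1 : 0 < rho1 < 1) (M0 : 0 <= M)
  (bG : forall j, (sqn leb6 (Qcyl rho1) (G j) <= M%:E)%E)
  (bdG : forall j i, (sqn leb6 (Qcyl rho1) (dG j i) <= M%:E)%E)
  (bb : forall j i, (sqn leb6 (Qcyl rho1) (b j i) <= M%:E)%E)
  (repS : forall j, represents_L1Hneg m rho1 (src j) (s j)).

Let Q1 : Qcyl rho1 `<=` (Qcyl 1 : set (spacetime5 R)).
Proof. by have /andP[r10 r11] := r1; apply: sub_Qcyl; exact: ltW. Qed.

Let mQ : measurable (Qcyl rho1 : set (spacetime5 (measurableTypeR R))) := Qcyl_measurable rho1.

Let mfS (f : spacetime5 R -> R) :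
  measurable_fun (Qcyl 1 : set (spacetime5 (measurableTypeR R))) f ->
  measurable_fun (Qcyl rho1 : set (spacetime5 (measurableTypeR R))) f.
Proof. by have /andP[r10 r11] := r1; apply: measurable_fun_Qcyl; exact: ltW. Qed.

Lemma L2_G j : L2 leb6 (Qcyl rho1) (G j).
Proof.
split; last by apply: le_lt_trans (bG j) _; exact: ltry.
by apply: mfS; have [[]] := wG j.
Qed.

Lemma L2_dG j i : L2 leb6 (Qcyl rho1) (dG j i).
Proof.
split; last by apply: le_lt_trans (bdG j i) _; exact: ltry.
by apply: mfS; have [_ /(_ i)[]] := wG j.
Qed.

Lemma L2_b j i : L2 leb6 (Qcyl rho1) (b j i).
Proof. by split; [exact: mfS|apply: le_lt_trans (bb j i) _; exact: ltry]. Qed.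

Lemma drift_integrable j : leb6.-integrable (Qcyl rho1) (EFin \o dotf (b j) (dG j)).
Proof. exact: (@dot_integrable _ _ _ leb6 (Qcyl rho1) mQ 5 (b j) (dG j) (L2_b j) (L2_dG j)). Qed.

(** The part of the bound in [weak_form_bound] that is additive over disjoint cells; the factor 5 nu
    comes from the Laplacian. *)
Definition flux (C : set (spacetime5 R)) j : R :=
  \int[leb6]_(p in C) `|dotf (b j) (dG j) p| + 5 * nu * (\int[leb6]_(p in C) `|G j p|).

Lemma flux_ge0 C j : 0 <= flux C j.
Proof.
by rewrite addr_ge0 ?Rintegral_ge0// mulr_ge0 ?Rintegral_ge0// mulr_ge0// ltW.
Qed.

Definition flux_bound := 5 * M + 5 * nu * (M + fine (leb6 (Qcyl rho1))).

Lemma flux_le j : flux (Qcyl rho1) j <= flux_bound.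
Proof.
have h1 := @dot_norm_le _ _ _ leb6 (Qcyl rho1) mQ 5 (b j) (dG j) M M0 (L2_b j) (L2_dG j) (bb j) (bdG j).
have h2 := @L1_norm_le _ _ _ leb6 (Qcyl rho1) mQ (Qcyl_lty rho1) (G j) M (L2_G j) (bG j).
by apply: lerD => //; apply: ler_wpM2l => //; rewrite mulr_ge0// ltW.
Qed.

(** The cell estimate is applied to the difference G_j - G_k. This difference solves no equation of
    the same type, as the drifts differ, so the time derivative is bounded for j and k separately
    and the two bounds are added. The constant [L] is found before the time step. *)
Lemma cell_sqn (a : nat -> R) (h : R) : 0 < h -> exists2 L : R, 0 <= L &
  forall t0 tau, 0 < tau -> let C := Ccell6 a h t0 tau in C `<=` Qcyl rho1 ->
  exists2 W, test_fun (Qcyl rho1) W & forall j k (N : R), 0 <= N ->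
    (normL1Hneg m rho1 (s j) <= N%:E)%E -> (normL1Hneg m rho1 (s k) <= N%:E)%E ->
    \int[leb6]_(p in C) (G j p - G k p) ^+ 2 <= L * tau *
      ((pairing (Qcyl rho1) (G j) W - pairing (Qcyl rho1) (G k) W) ^+ 2 +
       (flux C j + flux C k) ^+ 2 + N ^+ 2) +
      15360 * h ^+ 2 * \sum_(i < 5) \int[leb6]_(p in C) (dG j i p - dG k i p) ^+ 2.
Proof.
move=> h0; have [w [kappa [tw k0 hW]]] := @cell_estimate R a h h0.
have [Sw [Sw0 hSw]] := iter_derive_bounded basis5 m.+2 tw.
have [c c0 hc] := @weak_form_bound R m rho1 r1.
exists (3 * kappa ^+ 2 + 24 * kappa ^+ 2 * Sw ^+ 2 + 96 * kappa ^+ 2 * Sw ^+ 2 * c ^+ 2).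
  exact: cell_cst_ge0.
move=> t0 tau tau0 C CQ; have [W [tW est]] := hW t0 tau tau0.
have OC : Ocell6 a h t0 tau `<=` C by exact: Ocell6_sub.
have C1 : C `<=` Qcyl 1 by exact: subset_trans CQ Q1.
have mC : measurable (C : set (spacetime5 (measurableTypeR R))) by exact: Ccell6_measurable.
exists W; first by apply: test_fun_sub tW; exact: subset_trans CQ.
move=> j k N N0 Nj Nk.
have Coo : (leb6 C < +oo)%E by exact: Ccell6_lty.
have LG l := @L2_subset _ _ _ leb6 (Qcyl rho1) mQ C (G l) mC CQ (L2_G l).
have LdG l i := @L2_subset _ _ _ leb6 (Qcyl rho1) mQ C (dG l i) mC CQ (L2_dG l i).
have iG l := @L2_integrable _ _ _ leb6 C mC Coo (G l) (LG l).
have iD l := @integrableS _ _ _ leb6 (Qcyl rho1) C (EFin \o dotf (b l) (dG l)) mQ mC CQ (drift_integrable l).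
have sub (f g phi : spacetime5 R -> R) : L2 leb6 C f -> L2 leb6 C g -> test_fun (Ocell6 a h t0 tau) phi ->
    \int[leb6]_(p in C) ((f p - g p) * phi p) =
    \int[leb6]_(p in C) (f p * phi p) - \int[leb6]_(p in C) (g p * phi p).
  move=> Lf Lg tphi; have Lp := test_fun_L2 mC Coo tphi.
  exact: (@Rintegral_subM _ _ _ leb6 C mC f g phi Lf Lg Lp).
pose Kj l := Sw * (flux C l + c * N).
have wf l : (normL1Hneg m rho1 (s l) <= N%:E)%E -> forall alpha A,
    test_fun `]t0, (t0 + tau)[%classic alpha -> (forall t, `|alpha t| <= A) ->
    `|\int[leb6]_(p in C) (G l p * partial_t (fun p => alpha p.1 * w p.2) p)| <= Kj l * A.
  move=> Nl alpha A ta aA.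
  exact: (hc _ _ _ _ _ _ _ _ _ _ _ _ _ _ _ nu0 (dS l) (sol l) (repS l) Nl CQ tw Sw0 hSw ta aA (iG l) (iD l)).
have Kj0 l : 0 <= Kj l by rewrite mulr_ge0// addr_ge0 ?flux_ge0// mulr_ge0// ltW.
have := est (fun p => G j p - G k p) (fun i p => dG j i p - dG k i p) (Kj j + Kj k).
move=> /(_ (@L2_sub _ _ _ leb6 C mC (G j) (G k) (LG j) (LG k)) (fun i => @L2_sub _ _ _ leb6 C mC (dG j i) (dG k i) (LdG j i) (LdG k i))).
have wd i phi : test_fun (Ocell6 a h t0 tau) phi ->
    \int[leb6]_(p in C) ((G j p - G k p) * partial i phi p) =
    - \int[leb6]_(p in C) ((dG j i p - dG k i p) * phi p).
  move=> tphi; have tp : test_fun (Ocell6 a h t0 tau) (partial i phi) by exact: test_fun_derive.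
  rewrite (sub _ _ _ (LG j) (LG k) tp) (sub _ _ _ (LdG j i) (LdG k i) tphi).
  rewrite -(pairing_restrict (dG j i) C1 OC tphi) -(pairing_restrict (dG k i) C1 OC tphi).
  rewrite -(pairing_restrict (G j) C1 OC tp) -(pairing_restrict (G k) C1 OC tp).
  have t1 : test_fun (Qcyl 1) phi by apply: test_fun_sub tphi; exact: subset_trans C1.
  have [_ _ ->//] := wG j; have [_ _ ->//] := wG k.
  by rewrite opprB addrC opprK.
move=> /(_ wd (addr_ge0 (Kj0 j) (Kj0 k))).
have wt alpha A : test_fun `]t0, (t0 + tau)[%classic alpha -> (forall t, `|alpha t| <= A) ->
    `|\int[leb6]_(p in C) ((G j p - G k p) * partial_t (fun p => alpha p.1 * w p.2) p)| <=
    (Kj j + Kj k) * A.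
  move=> ta aA.
  have tp : test_fun (Ocell6 a h t0 tau) (partial_t (fun p => alpha p.1 * w p.2)).
    by apply: test_fun_derive; exact: (test_fun_tensor ta tw).
  rewrite (sub _ _ _ (LG j) (LG k) tp) mulrDl; apply: le_trans (ler_normB _ _) _.
  by rewrite lerD ?wf.
move=> /(_ wt) hx.
have c00 := ltW c0; have h00 := ltW h0; have t00 := ltW tau0.
have E1 := @cell_square_bound R (nrm leb6 C (fun p => G j p - G k p)) _ h 0 tau kappa Sw c
  (flux C j) (flux C k) N (fun i => nrm leb6 C (fun p => dG j i p - dG k i p))
  (nrm_ge0 _ _ _) k0 h00 (fun i => nrm_ge0 _ _ _) t00 Sw0 c00 (flux_ge0 C j) (flux_ge0 C k) N0 hx.
have sqE f := @sqn_int _ _ _ leb6 C f.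
rewrite sqE; apply: le_trans E1 _.
rewrite (sub _ _ _ (LG j) (LG k) tW).
rewrite -(pairing_restrict (G j) CQ OC tW) -(pairing_restrict (G k) CQ OC tW).
by under eq_bigr do rewrite -sqE.
Qed.

Lemma flux_sum_le (K : finType) (C : K -> set (spacetime5 R)) j :
  (forall c, measurable (C c : set (spacetime5 (measurableTypeR R)))) ->
  (forall c c' p, C c p -> C c' p -> c = c') -> (forall c, C c `<=` Qcyl rho1) ->
  \sum_c flux (C c) j <= flux_bound.
Proof.
move=> mC dC CQ.
apply: le_trans _ (flux_le j).
rewrite /flux big_split/= -mulr_sumr.
have i1 : leb6.-integrable (Qcyl rho1) (EFin \o (fun p => `|dotf (b j) (dG j) p|)).
  exact: (@integrable_norm _ _ _ leb6 (Qcyl rho1) _ (drift_integrable j)).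
have i2 : leb6.-integrable (Qcyl rho1) (EFin \o (fun p => `|G j p|)).
  apply: (@integrable_norm _ _ _ leb6 (Qcyl rho1)).
  exact: (@L2_integrable _ _ _ leb6 (Qcyl rho1) mQ (Qcyl_lty rho1) (G j) (L2_G j)).
have h1 := @sum_Rintegral_cells_le _ _ _ leb6 K C (Qcyl rho1) _ mC dC (fun p => normr_ge0 _) mQ CQ i1.
have h2 := @sum_Rintegral_cells_le _ _ _ leb6 K C (Qcyl rho1) _ mC dC (fun p => normr_ge0 _) mQ CQ i2.
apply: (lerD h1); apply: ler_wpM2l; last exact: h2.
by rewrite mulr_ge0// ltW.
Qed.

(** Summation over the cells: the sum of the finitely many spatial constants serves for all of them
    and does not depend on n. The 20 M is 4 M for the difference of two gradient components, times
    five components. *)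
Lemma cylinder_sqn (rho h : R) : 0 < rho -> rho < rho1 -> 0 < h -> h <= (rho1 - rho) / 8 ->
  exists2 L : R, 0 <= L & forall n, (0 < n)%N ->
  exists (K : finType) (W : K -> spacetime5 R -> R), (forall c, test_fun (Qcyl rho1) (W c)) /\
  forall j k (N : R), 0 <= N ->
    (normL1Hneg m rho1 (s j) <= N%:E)%E -> (normL1Hneg m rho1 (s k) <= N%:E)%E ->
    \int[leb6]_(p in Qcyl rho) (G j p - G k p) ^+ 2 <= L * (rho ^+ 2 / n%:R) *
      (\sum_c (pairing (Qcyl rho1) (G j) (W c) - pairing (Qcyl rho1) (G k) (W c)) ^+ 2 +
       (2 * flux_bound) ^+ 2 + #|K|%:R * N ^+ 2) + 15360 * h ^+ 2 * (20 * M).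
Proof.
move=> r0 r01 h0 hh; have [I [a hI]] := cover_exists r0 r01 h0 hh.
have cellI i := @cell_sqn (a i) h h0.
have [Lc hLc] := choice2_fun cellI.
have Lc0 i : 0 <= Lc i := (hLc i).1.
have L0 : 0 <= \sum_i Lc i by apply: sumr_ge0.
exists (\sum_i Lc i) => // n n0.
have := hI n n0; set tau := rho ^+ 2 / n%:R => -[].
pose C (c : I * 'I_n) := Ccell6 (a c.1) h (- rho ^+ 2 + tau * c.2%:R) tau.
rewrite -/C => dC CQ QC.
have tau0 : 0 < tau by rewrite divr_gt0 ?exprn_gt0 ?ltr0n.
have hW (c : I * 'I_n) : exists W, test_fun (Qcyl rho1) W /\ forall j k (N : R), 0 <= N ->
    (normL1Hneg m rho1 (s j) <= N%:E)%E -> (normL1Hneg m rho1 (s k) <= N%:E)%E ->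
    \int[leb6]_(p in C c) (G j p - G k p) ^+ 2 <= Lc c.1 * tau *
      ((pairing (Qcyl rho1) (G j) W - pairing (Qcyl rho1) (G k) W) ^+ 2 +
       (flux (C c) j + flux (C c) k) ^+ 2 + N ^+ 2) +
      15360 * h ^+ 2 * \sum_(i < 5) \int[leb6]_(p in C c) (dG j i p - dG k i p) ^+ 2.
  by have [W tW est] := (hLc c.1).2 (- rho ^+ 2 + tau * c.2%:R) tau tau0 (CQ c); exists W.
have {hW}[W hW] := choice hW.
exists (I * 'I_n)%type, W; split => [c|j k N N0 Nj Nk]; first exact: (hW c).1.
have mC c : measurable (C c : set (spacetime5 (measurableTypeR R))) by exact: Ccell6_measurable.
have LG l := L2_G l.
have LdG l i := L2_dG l i.
have iu := @sqr_sub_integrable _ _ _ leb6 (Qcyl rho1) mQ (G j) (G k) (LG j) (LG k).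
have idu i := @sqr_sub_integrable _ _ _ leb6 (Qcyl rho1) mQ (dG j i) (dG k i) (LdG j i) (LdG k i).
have QQ : Qcyl rho `<=` (Qcyl rho1 : set (spacetime5 R)) by apply: sub_Qcyl; exact: ltW.
apply: le_trans (@Rintegral_le_sum_cells _ _ _ leb6 _ C (Qcyl rho1) _ mC dC
  (fun p => sqr_ge0 _) mQ CQ iu (Qcyl rho) (Qcyl_measurable rho) QQ QC) _.
pose X c := \int[leb6]_(p in C c) (G j p - G k p) ^+ 2.
pose P c := pairing (Qcyl rho1) (G j) (W c) - pairing (Qcyl rho1) (G k) (W c).
pose F c := flux (C c) j + flux (C c) k.
pose D c := \sum_(i < 5) \int[leb6]_(p in C c) (dG j i p - dG k i p) ^+ 2.
have H c : X c <= Lc c.1 * tau * (P c ^+ 2 + F c ^+ 2 + N ^+ 2) + 15360 * h ^+ 2 * D c.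
  exact: ((hW c).2 j k N N0 Nj Nk).
have LcL (c : I * 'I_n) : Lc c.1 <= \sum_i Lc i.
  by rewrite (bigD1 c.1)//= lerDl sumr_ge0.
have F0 c : 0 <= F c by apply: addr_ge0; apply: flux_ge0.
have h20 : 0 <= 15360 * h ^+ 2 := mulr_ge0 (ler0n _ _) (sqr_ge0 h).
have FT : \sum_c F c <= 2 * flux_bound.
  have S1 := flux_sum_le j mC dC CQ; have S2 := flux_sum_le k mC dC CQ.
  have -> : \sum_c F c = \sum_c flux (C c) j + \sum_c flux (C c) k.
    exact: big_split.
  by apply: le_trans (lerD S1 S2) _; rewrite [leRHS]mulrDl mul1r.
have DT : \sum_c D c <= 20 * M; last first.
  exact: (@sum_cells_bound R _ X P F D (fun c => Lc c.1) _ _ tau N _ _ H LcL (ltW tau0) F0 L0 h20 FT DT).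
rewrite /D exchange_big/=; apply: (@le_trans _ _ (\sum_(i < 5) (4 * M))); last first.
  by rewrite sumr_const card_ord -mulrnAl -mulrnA.
apply: ler_sum => i _.
apply: le_trans (@sum_Rintegral_cells_le _ _ _ leb6 _ C (Qcyl rho1) _ mC dC
  (fun p => sqr_ge0 _) mQ CQ (idu i)) _.
exact: (@sqr_sub_le _ _ _ leb6 (Qcyl rho1) mQ (dG j i) (dG k i) M (LdG j i) (LdG k i) (bdG j i) (bdG k i)).
Qed.

End fixed_radius.

Hypotheses
  (bnd : forall rho : R, 0 < rho < 1 -> exists2 M : R, 0 <= M & forall j,
    [/\ (sqn leb6 (Qcyl rho) (G j) <= M%:E)%E,
        forall i, (sqn leb6 (Qcyl rho) (dG j i) <= M%:E)%E &
        forall i, (sqn leb6 (Qcyl rho) (b j i) <= M%:E)%E])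
  (hS : forall rho : R, 0 < rho < 1 -> cvg0_L1Hneg m rho src).

(** Order of choices: a radius halfway to 1, then h for the gradient term, then the number n of time
    steps for the L^1 term, and finally eta for the cell numbers and the source. Each of the four
    terms receives eps / 4. *)
Lemma cauchy_along (F : set_system nat) (rho eps : R) : UltraFilter F -> \oo `<=` F ->
  0 < rho < 1 -> 0 < eps -> exists2 A, F A & forall j k, A j -> A k ->
    \int[leb6]_(p in Qcyl rho) (G j p - G k p) ^+ 2 <= eps.
Proof.
move=> UF Foo /andP[r0 r1] e0.
have FF : ProperFilter F by exact: ultra_proper.
pose rho1 := (1 + rho) / 2.
have r01 : rho < rho1 by rewrite /rho1; lra.
have h1 : 0 < rho1 < 1 by rewrite /rho1; lra.
have [M M0 hM] := bnd h1.
have bG j : (sqn leb6 (Qcyl rho1) (G j) <= M%:E)%E by have [] := hM j.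
have bdG j i : (sqn leb6 (Qcyl rho1) (dG j i) <= M%:E)%E by have [] := hM j.
have bb j i : (sqn leb6 (Qcyl rho1) (b j i) <= M%:E)%E by have [] := hM j.
have [s [repS s0]] := hS h1.
have e4 : 0 < eps / 4 by rewrite divr_gt0.
have B00 : 0 <= 15360 * (20 * M) by exact: (mulr_ge0 (ler0n _ _) (mulr_ge0 (ler0n _ _) M0)).
have d0 : 0 < (rho1 - rho) / 8 by rewrite divr_gt0// subr_gt0.
have [h /andP[h0 hh] [hle1 hB]] := split_constants e4 B00 d0.
have := cylinder_sqn h1 M0 bG bdG bb repS r0 r01 h0 hh.
move=> [L L0]; set fb := flux_bound rho1 M => hL.
have [n n0 hn] : exists2 n : nat, (0 < n)%N & L * (rho ^+ 2 / n%:R) * (2 * fb) ^+ 2 <= eps / 4.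
  pose y := L * rho ^+ 2 * (2 * fb) ^+ 2 / (eps / 4).
  have y0 : 0 <= y := divr_ge0 (mulr_ge0 (mulr_ge0 L0 (sqr_ge0 _)) (sqr_ge0 _)) (ltW e4).
  exists (Num.truncn y).+1 => //.
  have /andP[_ /ltW] := truncn_itv y0.
  rewrite ler_pdivrMr// => hy.
  by rewrite mulrA mulrAC ler_pdivrMr ?ltr0n// [leRHS]mulrC.
have [K [W [tW est]]] := hL n n0.
set LT := L * (rho ^+ 2 / n%:R) in est hn.
have LT0 : 0 <= LT by rewrite mulr_ge0// divr_ge0 ?sqr_ge0.
have LTK : 0 <= LT * #|K|%:R by rewrite mulr_ge0.
(* Only now is the number of cells known; eta has to beat it, because both the squared differences
   of the cell numbers and the source norm are summed over all cells. *)
have [eta /andP[eta0 _] [eta1 hL4]] := split_constants e4 LTK ltr01.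
have eta2 : 0 < eta / 2 by rewrite divr_gt0.
have Pcvg c : exists l : R, pairing (Qcyl rho1) (G j) (W c) @[j --> F] --> l.
  apply: (@ultra_bounded_cvg R F _ (Num.sqrt M * nrm leb6 (Qcyl rho1) (W c))) => // j.
  have LW := test_fun_L2 (Qcyl_measurable rho1) (Qcyl_lty rho1) (tW c).
  have LG := L2_G h1 bG j.
  apply: le_trans (@cauchy_schwarzW _ _ _ leb6 (Qcyl rho1) (Qcyl_measurable rho1) (G j) (W c) LG LW) _.
  rewrite ler_wpM2r ?nrm_ge0// ler_wsqrtr//.
  by rewrite -lee_fin -[X in (X <= _)%E](L2_fin LG).
have /choice[l hl] := Pcvg.
(* A filter is stable only under finite intersections, so the finiteness of the set of cells is
   essential here. *)
have FP : \forall j \near F, forall c, `|l c - pairing (Qcyl rho1) (G j) (W c)| <= eta / 2.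
  apply: filter_forall => c; have /cvgrPdist_le := hl c; exact.
have FN : \forall j \near F, (normL1Hneg m rho1 (s j) <= eta%:E)%E.
  apply: Foo; have nb : nbhs (0 : \bar R)%E [set y | (y < eta%:E)%E].
    by apply: open_nbhs_nbhs; split; [exact: open_ereal_lt_ereal|rewrite /= lte_fin].
  have := s0 _ nb; apply: (@filterS _ \oo) => j; exact: ltW.
exists [set j | (forall c, `|l c - pairing (Qcyl rho1) (G j) (W c)| <= eta / 2) /\
  (normL1Hneg m rho1 (s j) <= eta%:E)%E].
  exact: filterI FP FN.
move=> j k [Pj Nj] [Pk Nk].
apply: le_trans (est j k eta (ltW eta0) Nj Nk) _.
have hP c : (pairing (Qcyl rho1) (G j) (W c) - pairing (Qcyl rho1) (G k) (W c)) ^+ 2 <= eta.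
  exact: sqr_dist_le eta0 eta1 (Pj c) (Pk c).
have hs : \sum_c (pairing (Qcyl rho1) (G j) (W c) - pairing (Qcyl rho1) (G k) (W c)) ^+ 2 <= #|K|%:R * eta.
  apply: le_trans (ler_sum _ (fun c _ => hP c)) _.
  by rewrite sumr_const mulr_natl.
move: hs; move: (\sum_c _) => S hs.
have e2 := sqr_le_self eta0 eta1; have hh2 := sqr_le_self h0 hle1.
have t1 : LT * S <= eps / 4 by apply: le_trans hL4; rewrite -mulrA ler_wpM2l.
have t2 : LT * (#|K|%:R * eta ^+ 2) <= eps / 4.
  by apply: le_trans hL4; rewrite -mulrA ler_wpM2l// ler_wpM2l.
have t3 : 15360 * h ^+ 2 * (20 * M) <= eps / 4.
  apply: le_trans hB; rewrite mulrAC; exact: ler_wpM2l.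
rewrite 2!mulrDr; exact: quarters_le t1 hn t2 t3.
Qed.

End compactness.

(** * Passage to the limit *)

(** As F refines the filter at infinity, every finite intersection of the sets [A i] contains
    arbitrarily large indices. The index [n k] is taken in the first k + 1 sets and beyond its
    predecessor. *)
Lemma diagonal_subseq (F : set_system nat) (A : nat -> set nat) : ProperFilter F -> \oo `<=` F ->
  (forall i, F (A i)) -> exists n : nat -> nat,
  {homo n : i j / (i < j)%N} /\ forall i k, (i <= k)%N -> A i (n k).
Proof.
move=> FF Foo FA.
have FB k : F (\bigcap_(i in `I_k.+1) A i).
  elim: k => [|k IH].
    apply: filterS (FA 0%N) => x Ax i /=; by rewrite ltnS leqn0 => /eqP ->.
  apply: filterS (filterI IH (FA k.+1)) => x [Bx Ax] i /=.
  by rewrite ltnS leq_eqVlt => /predU1P[->//|]; exact: Bx.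
have /choice[f hf] (kp : nat * nat) : exists q, (kp.2 < q)%N /\ (\bigcap_(i in `I_kp.1.+1) A i) q.
  have Fp : F [set q | (kp.2 < q)%N] by apply: Foo; exact: nbhs_infty_gt.
  by have [q [? ?]] := @filter_ex _ _ FF _ (filterI Fp (FB kp.1)); exists q.
pose n := fix n k := if k is l.+1 then f (l.+1, n l) else f (0%N, 0%N).
exists n; split.
  apply: homo_ltn; [exact: ltn_trans|move=> i /=; exact: (hf (i.+1, n i)).1].
by move=> i [|k] ik; [have := (hf (0%N, 0%N)).2|have := (hf (k.+1, n k)).2]; apply; rewrite /= ltnS.
Qed.

(** The exponent starts at 1: the terms then sum to 1, and the radii 1 - [dyadic i] used below are
    all positive. *)
Definition dyadic {R : realType} (i : nat) : R := (2 ^ i.+1)%:R^-1.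

Lemma dyadic_gt0 (R : realType) i : 0 < dyadic i :> R.
Proof. by rewrite invr_gt0 ltr0n expn_gt0. Qed.

Lemma dyadic_cvg (R : realType) : (dyadic i : R) @[i --> \oo] --> 0.
Proof.
have -> : (fun i => dyadic i : R) = geometric 2^-1 2^-1.
  by apply/funext => i; rewrite /dyadic /geometric/= natrX exprS invfM exprVn.
by apply: cvg_geometric; rewrite ger0_norm ?invr_ge0// invf_lt1// ltr1n.
Qed.

(** * Rapidly Cauchy sequences and their pointwise limits *)

Section fast_convergence.
Context d (T : measurableType d) (R : realType).
Variable mu : {measure set T -> \bar R}.
Local Open Scope ereal_scope.

(** The increments have summable L^1 norms on a set of finite measure, so the series of their
    absolute values is finite almost everywhere and the telescoping series converges. *)
Lemma fast_cvg_ae (D : set T) (h : nat -> T -> R) : measurable D -> mu D < +oo ->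
  (forall k, measurable_fun D (h k)) ->
  (forall k, sqn mu D (fun x => h k.+1 x - h k x)%R <= (dyadic k ^+ 2)%:E) ->
  {ae mu, forall x, D x -> cvgn (h ^~ x)}.
Proof.
move=> mD Doo mh hk.
pose a k x := (h k.+1 x - h k x)%R.
have ma k : measurable_fun D (a k) by apply: measurable_funB.
have man k : measurable_fun D (fun x => `|a k x|%:E).
  by apply/measurable_EFinP; exact: measurableT_comp.
have muD : mu D = (fine (mu D))%:E by rewrite fineK// ge0_fin_numE.
have ai k : \int[mu]_(x in D) `|a k x|%:E <= ((1 + fine (mu D)) / (2 ^ k.+1)%:R)%:E.
  have d0 := @dyadic_gt0 R k.
  (* Young in the form |a| <= a^2 / delta + delta with delta = [dyadic k]: the hypothesis bounds the
     integral of the first term by delta, and the second contributes delta times the measure of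
     [D]. *)
  apply: (@le_trans _ _ (\int[mu]_(x in D) (((dyadic k)^-1)%:E * ((a k x) ^+ 2)%:E + (dyadic k)%:E))).
    apply: ge0_le_integralW => x _; first by rewrite lee_fin.
    rewrite -EFinM -EFinD lee_fin -(real_normK (num_real (a k x))).
    rewrite -(ler_pM2l d0) mulrDr mulVKf ?gt_eqF//.
    by have := sqr_ge0 (`|a k x| - dyadic k)%R; have := sqr_ge0 (`|a k x|)%R; nra.
  rewrite ge0_integralD//; last 3 first.
  - by move=> x _; rewrite mule_ge0// lee_fin ?sqr_ge0// invr_ge0 ltW.
  - by apply: measurable_funeM; exact: measurable_sqr.
  - by move=> x _; rewrite lee_fin ltW.
  rewrite ge0_integralZl//; last 3 first.
  - exact: measurable_sqr.
  - by move=> x _; rewrite lee_fin sqr_ge0.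
  - by rewrite lee_fin invr_ge0 ltW.
  rewrite integral_cst// mulrDl mul1r EFinD -/(@dyadic R k) leeD//.
    apply: le_trans (lee_wpmul2l _ (hk k)) _; first by rewrite lee_fin invr_ge0 ltW.
    by rewrite -EFinM lee_fin expr2 mulKf// gt_eqF.
  by rewrite [X in _ * X]muD -EFinM lee_fin mulrC.
have iS : \int[mu]_(x in D) \sum_(k <oo) `|a k x|%:E < +oo.
  rewrite integral_nneseries//.
  apply: (@le_lt_trans _ _ (1 + fine (mu D))%:E); last exact: ltry.
  apply: le_trans (lee_nneseries _ (fun k _ => ai k)) _.
    by move=> k _ _; exact: integral_ge0.
  by apply: epsilon_trick0; rewrite addr_ge0// fine_ge0.
have mS : measurable_fun D (fun x => \sum_(k <oo) `|a k x|%:E).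
  by apply: ge0_emeasurable_sum.
have : mu.-integrable D (fun x => \sum_(k <oo) `|a k x|%:E).
  apply/integrableP; split => //.
  by under eq_integral do rewrite gee0_abs ?nneseries_ge0//.
move=> /(integrable_ae mD); apply: filterS => x hx Dx.
have Sfin : \sum_(k <oo) `|a k x|%:E < +oo.
  by have := hx Dx; rewrite ge0_fin_numE// nneseries_ge0.
have cs : cvgn (series (a ^~ x)).
  by apply: normed_cvg; apply: (nnseries_is_cvg _ Sfin).
have -> : h ^~ x = (fun n => h 0%N x + series (a ^~ x) n)%R.
  by apply/funext => n; rewrite (eq_sum_telescope (h ^~ x) n).
by apply: is_cvgD => //; exact: is_cvg_cst.
Qed.

(** Fatou, with the pointwise limit identified almost everywhere with the lower limit of the
    squares. *)
Lemma sqn_limit_le (D : set T) (f : nat -> T -> R) (g : T -> R) (M : \bar R) : measurable D ->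
  (forall k, measurable_fun D (f k)) -> measurable_fun D g ->
  {ae mu, forall x, D x -> f k x @[k --> \oo] --> g x} ->
  (forall k, sqn mu D (f k) <= M) -> sqn mu D g <= M.
Proof.
move=> mD mf mg fg fM.
have mf2 k := measurable_sqr (mf k).
apply: (@le_trans _ _ (\int[mu]_(x in D) limn_einf (fun k => ((f k x) ^+ 2)%:E))).
  apply: ae_ge0_le_integral => //.
  - by move=> x _; rewrite lee_fin sqr_ge0.
  - exact: measurable_sqr.
  - move=> x _; rewrite limn_einf_lim; apply: lime_ge; first exact: is_cvg_einfs.
    by apply: nearW => n; apply: le_ereal_inf_tmp => _ [k _ <-]; rewrite lee_fin sqr_ge0.
  - apply: (@emeasurable_fun_cvg _ _ _ _ (fun n x => einfs (fun k => ((f k x) ^+ 2)%:E) n)).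
      exact: (measurable_fun_einfs mf2).
    by move=> x Dx; rewrite limn_einf_lim; exact: is_cvg_einfs.
  move: fg; apply: filterS => x hx Dx.
  have c : ((f k x) ^+ 2)%:E @[k --> \oo] --> ((g x) ^+ 2)%:E.
    apply: cvg_EFin; first exact: nearW.
    by under eq_fun do rewrite /= expr2; rewrite expr2; apply: cvgM; exact: hx.
  by rewrite is_cvg_limn_einfE; [rewrite (cvg_lim _ c)|apply/cvg_ex; exists ((g x) ^+ 2)%:E].
apply: le_trans (fatou mu mD mf2 _) _; first by move=> k x _; rewrite lee_fin sqr_ge0.
rewrite limn_einf_lim; apply: lime_le; first exact: is_cvg_einfs.
apply: nearW => n; apply: le_trans (fM n).
by apply: ereal_inf_lbound; exists n => /=.
Qed.

(* The upper limit makes this measurable whether or not the sequence converges. *)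
Definition ptlim (h : nat -> T -> R) (x : T) : R := fine (limn_esup (fun k => (h k x)%:E)).

Lemma ptlim_cvg (h : nat -> T -> R) x : cvgn (h ^~ x) -> h k x @[k --> \oo] --> ptlim h x.
Proof.
move=> hx; have c : (h k x)%:E @[k --> \oo] --> (limn (h ^~ x))%:E.
  by apply: cvg_EFin => //; exact: nearW.
rewrite /ptlim is_cvg_limn_esupE; last by apply/cvg_ex; exists (limn (h ^~ x))%:E.
by rewrite (cvg_lim _ c).
Qed.

Lemma measurable_ptlim (E : set T) (h : nat -> T -> R) : measurable E ->
  (forall k, measurable_fun E (h k)) -> measurable_fun E (ptlim h).
Proof.
move=> mE mh; apply: measurableT_comp; first exact: fine_measurable.
by apply: measurable_fun_limn_esup => k; apply/measurable_EFinP.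
Qed.

(** For fixed k the bound on h_k - h_(l+k) holds on the larger set [D k] for every l; restricting to
    [D i] and letting l tend to infinity with [sqn_limit_le] gives the rate. *)
Lemma fast_cvg_sqn (E : set T) (D : nat -> set T) (h : nat -> T -> R) : measurable E ->
  (forall i, measurable (D i)) -> (forall i, mu (D i) < +oo) -> (forall i, D i `<=` E) ->
  (forall i j, (i <= j)%N -> D i `<=` D j) ->
  (forall k, measurable_fun E (h k)) ->
  (forall i k l, (i <= k)%N -> (i <= l)%N ->
    sqn mu (D i) (fun x => h k x - h l x)%R <= (dyadic i ^+ 2)%:E) ->
  forall i k, (i <= k)%N -> sqn mu (D i) (fun x => h k x - ptlim h x)%R <= (dyadic k ^+ 2)%:E.
Proof.
move=> mE mD Doo DE Dle mh hh i k ik.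
have mDh j l : measurable_fun (D j) (h l) by exact: measurable_funS (mh l).
have aeD : {ae mu, forall x, D i x -> cvgn (h ^~ x)}.
  have := @fast_cvg_ae (D i) (fun n => h (n + i)%N) (mD i) (Doo i) (fun n => mDh i _).
  have hi n : sqn mu (D i) (fun x => h (n.+1 + i)%N x - h (n + i)%N x)%R <= (dyadic n ^+ 2)%:E.
    (* The hypothesis on [D i] itself gives no decay; enlarging the domain to [D (n + i)] makes the
       increment at most [dyadic (n + i)], hence at most [dyadic n]. *)
    apply: (@le_trans _ _ (sqn mu (D (n + i)%N) (fun x => h (n.+1 + i)%N x - h (n + i)%N x)%R)).
      by apply: sqn_subset => //; [apply: Dle; exact: leq_addl|exact: measurable_funB].
    apply: le_trans (hh (n + i)%N _ _ (leq_add (leqnSn n) (leqnn i)) (leqnn _)) _.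
    rewrite lee_fin lerXn2r ?nnegrE ?(ltW (dyadic_gt0 _ _))//.
    rewrite /dyadic lef_pV2 ?posrE ?ltr0n ?expn_gt0// ler_nat leq_exp2l//.
    by rewrite ltnS leq_addr.
  move=> /(_ hi); apply: filterS => x hx Dx; have /cvg_ex[l hl] := hx Dx.
  apply/cvg_ex; exists l; rewrite -(@cvg_shiftn i _ (h ^~ x)).
  exact: hl.
apply: (@sqn_limit_le _ (fun l x => h k x - h (l + k)%N x)%R) => //.
- by move=> l; exact: measurable_funB.
- by apply: measurable_funB => //; apply: measurable_funS (measurable_ptlim mE mh).
- move: aeD; apply: filterS => x hx Dx.
  apply: cvgB; first exact: cvg_cst.
  have := ptlim_cvg (hx Dx); rewrite -(@cvg_shiftn k _ (h ^~ x)); exact.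
move=> l; apply: (@le_trans _ _ (sqn mu (D k) (fun x => h k x - h (l + k)%N x)%R)).
  by apply: sqn_subset => //; [exact: Dle|exact: measurable_funB].
by apply: hh => //; exact: leq_addl.
Qed.

End fast_convergence.

Section parallelogram.
Context d (T : measurableType d) (R : realType).
Variables (mu : {measure set T -> \bar R}) (D : set T).
Hypothesis mD : measurable D.
Implicit Types f g : T -> R.

Lemma parallelogram f g : L2 mu D f -> L2 mu D g ->
  fine (sqn mu D (fun x => f x - g x)) =
  2 * fine (sqn mu D f) + 2 * fine (sqn mu D g) -
  4 * fine (sqn mu D (fun x => (f x + g x) / 2)).
Proof.
move=> Lf Lg.
have ff := L2_integrableM mD Lf Lf; have gg := L2_integrableM mD Lg Lg.
have fg := L2_integrableM mD Lf Lg.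
have E (a b c : R) : \int[mu]_(x in D) (a * (f x * f x) + (b * (f x * g x) + c * (g x * g x))) =
    a * fine (sqn mu D f) + (b * \int[mu]_(x in D) (f x * g x) + c * fine (sqn mu D g)).
  have i1 := integrableZl mD a ff; have i2 := integrableZl mD b fg.
  have i3 := integrableZl mD c gg; have i4 := integrableD mD i2 i3.
  by rewrite RintegralD// RintegralD// !RintegralZl.
have -> : fine (sqn mu D (fun x => f x - g x)) = 1 * fine (sqn mu D f) +
    (-2 * \int[mu]_(x in D) (f x * g x) + 1 * fine (sqn mu D g)).
  by rewrite -E; apply: eq_Rintegral => x _; ring.
have -> : fine (sqn mu D (fun x => (f x + g x) / 2)) = 4^-1 * fine (sqn mu D f) +
    (2^-1 * \int[mu]_(x in D) (f x * g x) + 4^-1 * fine (sqn mu D g)).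
  by rewrite -E; apply: eq_Rintegral => x _; field.
by field.
Qed.

Lemma L2_mid f g : L2 mu D f -> L2 mu D g -> L2 mu D (fun x => (f x + g x) / 2).
Proof.
move=> Lf Lg; have := L2_scale mD 2^-1 (L2_add mD Lf Lg).
by under eq_fun do rewrite mulrC.
Qed.

End parallelogram.

(** * Strongly convergent midpoints of a bounded sequence *)

Section mazur.
Context d (T : measurableType d) (R : realType) (n : nat).
Variables (mu : {measure set T -> \bar R}) (D : nat -> set T) (M : nat -> R).
Hypotheses (mD : forall k, measurable (D k)) (M0 : forall k, 0 <= M k).
Notation field := ('I_n -> T -> R).
Implicit Types u v : field.

(** Convex combinations with dyadic coefficients. Midpoints suffice because the argument below
    minimises over the hull and uses only the parallelogram identity. *)
Inductive midhull (P : field -> Prop) : field -> Prop :=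
| midhull_base v : P v -> midhull P v
| midhull_mid u v : midhull P u -> midhull P v ->
    midhull P (fun i x => (u i x + v i x) / 2).

Lemma midhull_sub (P Q : field -> Prop) v : (forall u, P u -> Q u) -> midhull P v -> midhull Q v.
Proof. by move=> PQ; elim=> [u /PQ|u w _ Hu _ Hw]; [exact: midhull_base|exact: midhull_mid]. Qed.

Definition energy k v : R := \sum_(i < n) fine (sqn mu (D k) (v i)).

Definition bounded_field v := forall k, (forall i, L2 mu (D k) (v i)) /\ energy k v <= M k.

Lemma energy_ge0 k v : 0 <= energy k v.
Proof. by apply: sumr_ge0 => i _; rewrite fine_ge0 ?sqn_ge0. Qed.

Lemma energy_parallelogram k u v : bounded_field u -> bounded_field v ->
  energy k (fun i x => u i x - v i x) =
  2 * energy k u + 2 * energy k v - 4 * energy k (fun i x => (u i x + v i x) / 2).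
Proof.
move=> bu bv; rewrite /energy !mulr_sumr -big_split/= -sumrB; apply: eq_bigr => i _.
exact: (parallelogram (mD k) ((bu k).1 i) ((bv k).1 i)).
Qed.

(** The energy is convex at midpoints: this is the parallelogram identity together with the
    nonnegativity of the energy of the difference. *)
Lemma midhull_bounded (P : field -> Prop) v : (forall u, P u -> bounded_field u) ->
  midhull P v -> bounded_field v.
Proof.
move=> Pb; elim=> [u /Pb//|u w _ bu _ bw] k; split => [i|].
  exact: (L2_mid (mD k) ((bu k).1 i) ((bw k).1 i)).
have := energy_parallelogram k bu bw; have := energy_ge0 k (fun i x => u i x - w i x).
have := (bu k).2; have := (bw k).2; lra.
Qed.

(** Weights under which the sum over k of c_k times the k-th energy converges for every bounded
    field. The resulting functional [q] controls all the domains [D k] at once, so a single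
    minimisation serves every one of them. *)
Let c k : R := dyadic k / (1 + M k).

Let c_gt0 k : 0 < c k.
Proof. by rewrite divr_gt0 ?dyadic_gt0// ltr_pwDl. Qed.

Let ce_le v k : bounded_field v -> c k * energy k v <= dyadic k.
Proof.
move=> bv; rewrite /c mulrAC ler_pdivrMr ?ltr_pwDl// ler_wpM2l ?(ltW (dyadic_gt0 _ _))//.
by apply: le_trans (bv k).2 _; rewrite lerDr.
Qed.

Let dyadic_series_cvg : cvgn (series (@dyadic R)).
Proof.
have -> : @dyadic R = geometric 2^-1 2^-1.
  by apply/funext => i; rewrite /dyadic /geometric/= natrX exprS invfM exprVn.
by apply: is_cvg_geometric_series; rewrite ger0_norm ?invr_ge0// invf_lt1// ltr1n.
Qed.

Let ce_cvg v : bounded_field v -> cvgn (series (fun k => c k * energy k v)).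
Proof.
move=> bv; apply: series_le_cvg dyadic_series_cvg.
- by move=> k; rewrite mulr_ge0 ?energy_ge0// ltW.
- by move=> k; rewrite ltW ?dyadic_gt0.
- by move=> k; exact: ce_le.
Qed.

Let q v : R := limn (series (fun k => c k * energy k v)).

Let q_ge0 v : bounded_field v -> 0 <= q v.
Proof.
move=> bv; apply: limr_ge; first exact: ce_cvg.
by apply: nearW => N; apply: sumr_ge0 => k _; rewrite mulr_ge0 ?energy_ge0// ltW.
Qed.

Let q_le v : bounded_field v -> q v <= limn (series (@dyadic R)).
Proof.
move=> bv; apply: ler_lim; [exact: ce_cvg|exact: dyadic_series_cvg|].
by apply: nearW => N; apply: ler_sum => k _; exact: ce_le.
Qed.

(** The weighted parallelogram identity summed over all k; the left side keeps one term of a series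
    with nonnegative terms. *)
Let q_gap u v k : bounded_field u -> bounded_field v ->
  bounded_field (fun i x => (u i x + v i x) / 2) ->
  c k * energy k (fun i x => u i x - v i x) <=
  2 * q u + 2 * q v - 4 * q (fun i x => (u i x + v i x) / 2).
Proof.
move=> bu bv bm.
pose t k := c k * energy k (fun i x => u i x - v i x).
have tE : series t = (fun N => 2 * series (fun k => c k * energy k u) N +
    2 * series (fun k => c k * energy k v) N -
    4 * series (fun k => c k * energy k (fun i x => (u i x + v i x) / 2)) N).
  apply/funext => N; rewrite /series/= !mulr_sumr -big_split/= -sumrB.
  by apply: eq_bigr => l _; rewrite /t energy_parallelogram//; ring.
have ct : series t N @[N --> \oo] --> 2 * q u + 2 * q v - 4 * q (fun i x => (u i x + v i x) / 2).
  rewrite tE; apply: cvgB; first apply: cvgD.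
  - by apply: cvgMr; exact: ce_cvg.
  - by apply: cvgMr; exact: ce_cvg.
  - by apply: cvgMr; exact: ce_cvg.
have t0 l : 0 <= t l by rewrite mulr_ge0 ?energy_ge0// ltW.
rewrite -(cvg_lim _ ct)//; apply: limr_ge; first by apply/cvg_ex; eexists; exact: ct.
near=> N.
have kN : (k < N)%N by near: N; exact: nbhs_infty_gt.
by rewrite /series/= (bigD1_seq k) ?mem_index_iota ?iota_uniq//= lerDl sumr_ge0.
Unshelve. all: by end_near. Qed.

(** Let d_N be the infimum of [q] over the hull of the tail from N; it increases to a finite limit
    d. Take v_N within [dyadic N] of the infimum. For l, l' >= N the midpoint of v_l and v_l' still
    lies in the hull from N, so its [q] is at least d_N, and [q_gap] bounds the weighted energy of
    v_l - v_l' by 4 (d - d_N + [dyadic N]). *)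
Lemma mazur (S : nat -> field) : (forall j, bounded_field (S j)) ->
  exists v : nat -> field, (forall N, midhull (fun u => exists2 j, (N <= j)%N & u = S j) (v N)) /\
  forall k (e : R), 0 < e -> \forall N \near \oo, forall l l', (N <= l)%N -> (N <= l')%N ->
    energy k (fun i x => v l i x - v l' i x) <= e.
Proof.
move=> bS; pose H N := midhull (fun u => exists2 j, (N <= j)%N & u = S j).
have bH N v : H N v -> bounded_field v by apply: midhull_bounded => u [j _ ->].
have HH N N' v : (N <= N')%N -> H N' v -> H N v.
  by move=> NN; apply: midhull_sub => u [j Nj ->]; exists j => //; exact: leq_trans Nj.
pose A N := [set q v | v in H N].
have A0 N : A N !=set0 by exists (q (S N)), (S N) => //; apply: midhull_base; exists N.
have Ab N : has_lbound (A N) by exists 0 => _ [v /bH bv <-]; exact: q_ge0.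
pose dd N := inf (A N).
have dle N v : H N v -> dd N <= q v by move=> Hv; apply: ge_inf => //; exists v.
have /choice[v hv] N : exists v, H N v /\ q v < dd N + dyadic N.
  have [_ [v Hv <-] hv] := inf_adherent (@dyadic_gt0 R N) (conj (A0 N) (Ab N)).
  by exists v.
have ddinc : nondecreasing_seq dd.
  move=> N N' NN; apply: lb_le_inf => // _ [u Hu <-]; apply: dle; exact: HH Hu.
have ddcvg : cvgn dd.
  apply: nondecreasing_is_cvgn => //; exists (limn (series (@dyadic R))) => _ [N _ <-].
  by apply: le_trans (dle N _ (hv N).1) (q_le (bH _ _ (hv N).1)).
have ddlim N : dd N <= limn dd by exact: nondecreasing_cvgn_le.
exists v; split => [N|k e e0]; first exact: (hv N).1.
have gap : 4 * (limn dd - dd N + dyadic N) @[N --> \oo] --> 0.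
  rewrite -[X in _ --> X](mulr0 4); apply: cvgMr.
  rewrite -[X in _ --> X](addr0 0); apply: cvgD; last exact: dyadic_cvg.
  by rewrite -[X in _ --> X](subrr (limn dd)); apply: cvgB => //; exact: cvg_cst.
have ce0 : 0 < c k * e by rewrite mulr_gt0.
have gapN : \forall N \near \oo, 4 * (limn dd - dd N + dyadic N) < c k * e.
  exact: (cvgr_lt 0 gap).
near=> N.
have hN : 4 * (limn dd - dd N + dyadic N) < c k * e by near: N.
move=> l l' Nl Nl'.
have Hl := HH _ _ _ Nl (hv l).1; have Hl' := HH _ _ _ Nl' (hv l').1.
rewrite -(ler_pM2l (c_gt0 k)).
apply: le_trans (q_gap k (bH _ _ Hl) (bH _ _ Hl') (bH _ _ (midhull_mid Hl Hl'))) _.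
have h1 := dle _ _ (midhull_mid Hl Hl').
have dm p : (N <= p)%N -> dyadic p <= dyadic N :> R.
  by move=> Np; rewrite /dyadic lef_pV2 ?posrE ?ltr0n ?expn_gt0// ler_nat leq_exp2l.
have := (hv l).2; have := (hv l').2; have := ddlim l; have := ddlim l'.
have := dm _ Nl; have := dm _ Nl'.
move: h1 hN; move: (c k * e) (q _) (q _) (q _) => a q1 q2 q3.
move: (dd N) (dd l) (dd l') (limn dd) (dyadic N) (dyadic l) (dyadic l') => d0 d1 d2 dl y0 y1 y2.
lra.
Unshelve. all: by end_near. Qed.

End mazur.

Section abstract_pairing.
Context d (T : measurableType d) (R : realType).
Variables (mu : {measure set T -> \bar R}) (D : set T).
Hypotheses (mD : measurable D) (Doo : (mu D < +oo)%E).
Implicit Types f g psi : T -> R.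

Lemma pairing_dist f g psi (e : R) : 0 <= e -> L2 mu D f -> L2 mu D g -> L2 mu D psi ->
  (sqn mu D (fun x => f x - g x)%R <= (e ^+ 2)%:E)%E ->
  `|\int[mu]_(p in D) (f p * psi p) - \int[mu]_(p in D) (g p * psi p)| <= e * nrm mu D psi.
Proof.
move=> e0 Lf Lg Lp h; rewrite -(Rintegral_subM mD Lf Lg Lp).
have Lfg := L2_sub mD Lf Lg.
apply: le_trans (cauchy_schwarzW mD Lfg Lp) _.
rewrite ler_wpM2r ?nrm_ge0// -(ger0_norm e0) -sqrtr_sqr ler_wsqrtr//.
by rewrite -lee_fin -(L2_fin Lfg).
Qed.

Lemma Rintegral_midM f g psi : L2 mu D f -> L2 mu D g -> L2 mu D psi ->
  \int[mu]_(p in D) ((f p + g p) / 2 * psi p) =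
  (\int[mu]_(p in D) (f p * psi p) + \int[mu]_(p in D) (g p * psi p)) / 2.
Proof.
move=> Lf Lg Lp.
have i1 := L2_integrableM mD Lf Lp; have i2 := L2_integrableM mD Lg Lp.
rewrite -RintegralD// [RHS]mulrC -RintegralZl//; last exact: (integrableD mD i1 i2).
by apply: eq_Rintegral => p _; field.
Qed.

Lemma L2_of_dist f g : measurable_fun D g -> L2 mu D f ->
  (sqn mu D (fun x => f x - g x)%R < +oo)%E -> L2 mu D g.
Proof.
move=> mg Lf fg.
have Lfg : L2 mu D (fun x => f x - g x)%R.
  by split => //; apply: measurable_funB => //; exact: Lf.1.
have := L2_sub mD Lf Lfg.
by under eq_fun do rewrite subKr.
Qed.

Lemma L2_locally_integrable (K : set T) f : K `<=` D -> L2 mu D f ->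
  (\int[mu]_(p in K) (`|f p|)%:E < +oo)%E.
Proof.
move=> KD Lf; apply: (@le_lt_trans _ _ (\int[mu]_(p in D) (`|f p|)%:E)%E).
  rewrite integral_mkcond [leRHS]integral_mkcond.
  apply: ge0_le_integralW => x _; rewrite !patchE; first by case: ifP => _ //; rewrite lee_fin.
  case: ifPn => [/set_mem/KD Dx|_]; first by rewrite mem_set.
  by case: ifP => _ //; rewrite lee_fin.
by have /integrableP[_] := L2_integrable mD Doo Lf.
Qed.

(** Pairing with psi is linear and an interval around l is convex, so the bound survives
    midpoints. *)
Lemma midhull_pairing (n : nat) (P : ('I_n -> T -> R) -> Prop) v i psi (l e : R) :
  (forall u, P u -> L2 mu D (u i) /\ `|\int[mu]_(p in D) (u i p * psi p) - l| <= e) ->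
  L2 mu D psi -> midhull P v ->
  L2 mu D (v i) /\ `|\int[mu]_(p in D) (v i p * psi p) - l| <= e.
Proof.
move=> HP Lp; elim=> [u /HP//|u w _ [Lu hu] _ [Lw hw]]; split; first exact: L2_mid.
rewrite Rintegral_midM//; move: hu hw; move: (Rintegral _ _ _) (Rintegral _ _ _) => x y.
rewrite !ler_norml => /andP[x1 x2] /andP[y1 y2].
by apply/andP; split; lra.
Qed.

End abstract_pairing.

Lemma midhull_measurable d (T : measurableType d) (R : realType) (n : nat) (E : set T)
    (P : ('I_n -> T -> R) -> Prop) v i : (forall u, P u -> measurable_fun E (u i)) ->
  midhull P v -> measurable_fun E (v i).
Proof.
move=> HP; elim=> [u /HP//|u w _ mu_ _ mw].
by apply: measurable_funM => //; exact: measurable_funD.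
Qed.

Section exhaustion.
Context {R : realType}.
Implicit Types (psi : spacetime5 R -> R).

Definition rad_seq (i : nat) : R := 1 - dyadic i.

Lemma dyadic_le1 i : dyadic i < 1 :> R.
Proof. by rewrite /dyadic invf_lt1 ?ltr0n ?expn_gt0// ltr1n -{1}(expn0 2) ltn_exp2l. Qed.

Lemma dyadic_homo i j : (i <= j)%N -> dyadic j <= dyadic i :> R.
Proof. by move=> ij; rewrite /dyadic lef_pV2 ?posrE ?ltr0n ?expn_gt0// ler_nat leq_exp2l. Qed.

Lemma rad_seq_itv i : 0 < rad_seq i < 1.
Proof. by have := dyadic_gt0 R i; have := dyadic_le1 i; rewrite /rad_seq; lra. Qed.

Lemma Qcyl_rad_seq (rho : R) : 0 < rho < 1 -> exists i, Qcyl rho `<=` (Qcyl (rad_seq i) : set (spacetime5 R)).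
Proof.
move=> /andP[r0 r1]; have r10 : 0 < 1 - rho by rewrite subr_gt0.
have /cvgrPdist_lt/(_ _ r10) := @dyadic_cvg R => h.
have [i] := filter_ex h; rewrite sub0r normrN (ger0_norm (ltW (dyadic_gt0 _ _))) => hi.
by exists i; apply: sub_Qcyl; rewrite /rad_seq; lra.
Qed.

Lemma Qcyl_rad_seq_homo i j : (i <= j)%N ->
  Qcyl (rad_seq i) `<=` (Qcyl (rad_seq j) : set (spacetime5 R)).
Proof.
move=> /dyadic_homo ij; have /andP[r0 _] := rad_seq_itv i.
by apply: sub_Qcyl; rewrite /rad_seq in r0 *; lra.
Qed.

Lemma Qcyl_rad_seq1 i : Qcyl (rad_seq i) `<=` (Qcyl 1 : set (spacetime5 R)).
Proof. by have /andP[r0 r1] := rad_seq_itv i; apply: sub_Qcyl; exact: ltW. Qed.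

Lemma measurable_fun_rad_seq i (f : spacetime5 R -> R) :
  measurable_fun (Qcyl 1 : set (spacetime5 (measurableTypeR R))) f ->
  measurable_fun (Qcyl (rad_seq i) : set (spacetime5 (measurableTypeR R))) f.
Proof. by have /andP[r0 r1] := rad_seq_itv i; apply: measurable_fun_Qcyl; exact: ltW. Qed.

Lemma compact_rad_seq (K : set (spacetime5 R)) : compact K -> K `<=` Qcyl 1 ->
  exists i, K `<=` Qcyl (rad_seq i).
Proof.
move=> cK K1; have [rho [r01 Kr]] := compact_sub_Qcyl cK K1.
by have [i hi] := Qcyl_rad_seq r01; exists i; exact: subset_trans hi.
Qed.

Lemma test_fun_rad_seq psi : test_fun (Qcyl 1) psi -> exists i, test_fun (Qcyl (rad_seq i)) psi.
Proof.
move=> [sp cp s1]; have [i hi] := compact_rad_seq cp s1.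
by exists i; split.
Qed.

Lemma source_cvg0 (m : nat) (src : nat -> (spacetime5 R -> R) -> R) psi :
  (forall j, is_distribution (Qcyl 1) (src j)) ->
  (forall rho : R, 0 < rho < 1 -> cvg0_L1Hneg m rho src) ->
  test_fun (Qcyl 1) psi -> src j psi @[j --> \oo] --> 0.
Proof.
move=> dS hS t1; have [i ti] := test_fun_rad_seq t1.
have [s [repS s0]] := hS _ (rad_seq_itv i).
have [c c0 hc] := @source_bound R m (rad_seq i).
have [B [B0 hB]] := iter_derive_bounded (fun i => (0, basis5 i) : spacetime5 R) m ti.
have hB' (l : seq 'I_5) : (size l <= m)%N -> forall t x,
    `|iter_derive (map basis5 l) (fun x => psi (t, x)) x| <= B.
  move=> lm t x.
  rewrite (@iter_derive_comp_affine R _ _ (fun x => (t, x)) (fun v => (0, v))); last first.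
    by move=> k v y; congr (_, _); rewrite /= scaler0 add0r.
  by rewrite -map_comp; exact: hB.
apply/cvgrPdist_le => /= e e0.
have d0 : 0 < e / (B * c + 1) by rewrite divr_gt0// ltr_wpDl// mulr_ge0// ltW.
have nb : nbhs (0 : \bar R)%E [set y | (y < (e / (B * c + 1))%:E)%E].
  by apply: open_nbhs_nbhs; split; [exact: open_ereal_lt_ereal|rewrite /= lte_fin].
have sN : \forall j \near \oo, (normL1Hneg m (rad_seq i) (s j) < (e / (B * c + 1))%:E)%E by exact: (s0 _ nb).
near=> j; have hj : (normL1Hneg m (rad_seq i) (s j) < (e / (B * c + 1))%:E)%E by near: j.
rewrite sub0r normrN.
have lS : test_linear (Qcyl (rad_seq i)) (src j).
  by move=> k f g tf tg; apply: (dS j).1; apply: test_fun_sub (@Qcyl_rad_seq1 i) _.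
apply: le_trans (hc _ _ _ _ _ lS (repS j) (ltW hj) ti B0 hB') _.
have K0 : 0 < B * c + 1 by rewrite ltr_wpDl// mulr_ge0// ltW.
rewrite mulrA mulrA ler_pdivrMr// [leLHS]mulrC.
by apply: ler_wpM2l; [exact: ltW|rewrite lerDl].
Unshelve. all: by end_near. Qed.

End exhaustion.

Section local_limits.
Context {R : realType}.
Local Notation D i := (Qcyl (rad_seq i) : set (spacetime5 R)).
Local Notation Q1 := (Qcyl 1 : set (spacetime5 (measurableTypeR R))).
Implicit Types (f : nat -> spacetime5 R -> R) (flim psi : spacetime5 R -> R).

Definition loc_cvg f flim : Prop := [/\ forall i k, L2 leb6 (D i) (f k), forall i, L2 leb6 (D i) flim &
  forall i k, (i <= k)%N -> (sqn leb6 (D i) (fun p => f k p - flim p)%R <= (dyadic k ^+ 2)%:E)%E].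

Lemma pairing_cvg f flim psi : loc_cvg f flim -> test_fun (Qcyl 1) psi ->
  pairing (Qcyl 1) (f k) psi @[k --> \oo] --> pairing (Qcyl 1) flim psi.
Proof.
move=> [Lf L0 ff] /test_fun_rad_seq[i ti].
have mD : measurable (Qcyl (rad_seq i) : set (spacetime5 (measurableTypeR R))) := Qcyl_measurable (rad_seq i).
have Lp := test_fun_L2 mD (Qcyl_lty (rad_seq i)) ti.
have E g := pairing_restrict g (@Qcyl_rad_seq1 R i) (@subset_refl _ (Qcyl (rad_seq i))) ti.
rewrite E (_ : (fun k => _) = fun k => \int[leb6]_(p in D i) (f k p * psi p)); last by apply/funext => k; exact: E.
apply/cvgrPdist_le => /= e e0.
have c0 : (dyadic k * nrm leb6 (D i) psi) @[k --> \oo] --> 0.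
  by rewrite -[X in _ --> X](mul0r (nrm leb6 (D i) psi)); apply: cvgMl; exact: dyadic_cvg.
have hc : \forall k \near \oo, dyadic k * nrm leb6 (D i) psi < e by exact: (cvgr_lt 0 c0).
near=> k; rewrite distrC.
apply: le_trans (@pairing_dist _ _ _ leb6 (D i) mD (f k) flim psi (dyadic k) (ltW (dyadic_gt0 _ _)) (Lf i k) (L0 i) Lp (ff i k _)) _.
  by near: k; exact: nbhs_infty_ge.
by apply: ltW; near: k.
Unshelve. all: by end_near. Qed.

Lemma L2_loc_int flim : measurable_fun Q1 flim -> (forall i, L2 leb6 (D i) flim) -> loc_int (Qcyl 1) flim.
Proof.
move=> m0 L0; split=> // K K1 cK; have [i Ki] := compact_rad_seq cK K1.
exact: (@L2_locally_integrable _ _ _ leb6 (D i) (Qcyl_measurable (rad_seq i)) (Qcyl_lty (rad_seq i)) K flim Ki (L0 i)).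
Qed.

Lemma local_limit f : (forall k, measurable_fun Q1 (f k)) -> (forall i k, L2 leb6 (D i) (f k)) ->
  (forall i k l, (i <= k)%N -> (i <= l)%N ->
    (sqn leb6 (D i) (fun p => f k p - f l p)%R <= (dyadic i ^+ 2)%:E)%E) ->
  measurable_fun Q1 (ptlim f) /\ loc_cvg f (ptlim f).
Proof.
move=> mf Lf ff.
have m0 := @measurable_ptlim _ _ _ Q1 f (Qcyl_measurable 1) mf.
have h := @fast_cvg_sqn _ _ _ leb6 Q1 (fun i => D i) f (Qcyl_measurable 1)
  (fun i => Qcyl_measurable (rad_seq i)) (fun i => Qcyl_lty (rad_seq i)) (@Qcyl_rad_seq1 R)
  (@Qcyl_rad_seq_homo R) mf ff.
split => //; split => // i.
apply: (@L2_of_dist _ _ _ leb6 (D i) (Qcyl_measurable (rad_seq i)) (f i) (ptlim f) _ (Lf i i)).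
  exact: measurable_fun_rad_seq.
exact: le_lt_trans (h i i (leqnn i)) (ltry _).
Qed.

Lemma normL2_cvg0 f flim (rho : R) : measurable_fun Q1 flim -> (forall k, measurable_fun Q1 (f k)) ->
  loc_cvg f flim -> 0 < rho < 1 -> normL2 rho (f k \- flim) @[k --> \oo] --> 0%E.
Proof.
move=> m0 mf [_ _ ff] r01; have [i ri] := Qcyl_rad_seq r01.
have dE : (dyadic k)%:E @[k --> \oo] --> (0 : R)%:E.
  by apply: cvg_EFin; [exact: nearW|exact: dyadic_cvg].
apply: (@squeeze_cvge _ _ _ _ (fun=> 0%E) _ (fun k => (dyadic k)%:E)) => //; last exact: cvg_cst.
near=> k; have ik : (i <= k)%N by near: k; exact: nbhs_infty_ge.
have n0 : (0 <= normL2 rho (f k \- flim)%R)%E by exact: Lnorm_ge0.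
rewrite n0/=.
have h : (normL2 rho (f k \- flim)%R `^ 2 <= (dyadic k ^+ 2)%:E)%E.
  rewrite /normL2 (Lnorm2_sqr leb6 (fun p => (f k \- flim) p * \1_(Qcyl rho) p)) -sqn_indic.
  apply: le_trans (ff i k ik); apply: (@sqn_subset _ _ _ leb6 (Qcyl rho) (D i)) => //.
  - exact: Qcyl_measurable.
  - exact: Qcyl_measurable.
  - by apply: measurable_fun_rad_seq; exact: measurable_funB.
have d0 : 0 <= dyadic k :> R by exact: ltW (dyadic_gt0 _ _).
move: n0 h; move: (normL2 _ _) => x x0 h.
rewrite leNgt; apply/negP => dx; move: h; apply/negP; rewrite -ltNge (poweR2 x0) expr2 EFinM.
by apply: lte_pmul => //; rewrite lee_fin.
Unshelve. all: by end_near. Qed.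

End local_limits.

Lemma increasing_ge (n : nat -> nat) : {homo n : i j / (i < j)%N} -> forall k, (k <= n k)%N.
Proof. by move=> ninc; elim=> // k IH; apply: leq_ltn_trans IH _; exact: ninc. Qed.

Section weak_limit_of_gradients.
Context {R : realType}.
Local Notation D i := (Qcyl (rad_seq i) : set (spacetime5 R)).
Local Notation Q1 := (Qcyl 1 : set (spacetime5 (measurableTypeR R))).
Variables (G : nat -> spacetime5 R -> R) (dG : nat -> 'I_5 -> spacetime5 R -> R)
  (Gl : spacetime5 R -> R).
Hypotheses (wG : forall j, weak_gradient (Qcyl 1) (G j) (dG j)) (mGl : measurable_fun Q1 Gl)
  (cG : loc_cvg G Gl)
  (bdG : forall i, exists2 M : R, 0 <= M & forall j a, (sqn leb6 (D i) (dG j a) <= M%:E)%E).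

(** The gradients are only bounded, so their limit is replaced by that of midpoints of tails, which
    converge strongly after [mazur]. Being made of tails, these midpoints keep the limit of the
    pairings, and that limit is prescribed by the convergence of [G]. *)
Lemma weak_gradient_limit : exists dGl, weak_gradient (Qcyl 1) Gl dGl.
Proof.
have mD i : measurable (Qcyl (rad_seq i) : set (spacetime5 (measurableTypeR R))) := Qcyl_measurable (rad_seq i).
have [M0 hM] := choice2_fun bdG.
have mdG j a : measurable_fun Q1 (dG j a) by have [_ /(_ a)[]] := wG j.
have LdG i j a : L2 leb6 (D i) (dG j a).
  split; last by apply: le_lt_trans ((hM i).2 j a) _; exact: ltry.
  exact: measurable_fun_rad_seq.
pose M i := 5 * M0 i.
have M00 i : 0 <= M i by rewrite mulr_ge0//; exact: (hM i).1.
have bS j : bounded_field leb6 (fun i => D i) M (dG j).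
  move=> i; split => [a|]; first exact: LdG.
  rewrite /energy (@le_trans _ _ (\sum_(a < 5) M0 i))//; last by rewrite sumr_const card_ord /M mulr_natl.
  by apply: ler_sum => a _; rewrite -lee_fin -(L2_fin (LdG i j a)); exact: ((hM i).2 j a).
have [v [hv cv]] := @mazur _ _ _ 5 leb6 (fun i => D i) M mD M00 dG bS.
have bv k : bounded_field leb6 (fun i => D i) M (v k).
  by apply: (midhull_bounded (mu := leb6) (D := fun i => D i) mD _ (hv k)) => u [j _ ->].
pose A i : set nat := [set N | forall l l', (N <= l)%N -> (N <= l')%N ->
  energy leb6 (fun i => D i) i (fun a x => v l a x - v l' a x) <= dyadic i ^+ 2].
have [n [ninc nA]] : exists n : nat -> nat, {homo n : i j / (i < j)%N} /\ forall i k, (i <= k)%N -> A i (n k).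
  apply: (@diagonal_subseq \oo A) => // i.
  by apply: cv; rewrite exprn_gt0// dyadic_gt0.
have nge := increasing_ge ninc.
have nle k l : (k <= l)%N -> (n k <= n l)%N.
  by rewrite leq_eqVlt => /predU1P[->//|/ninc]; exact: ltnW.
pose f a k := v (n k) a.
have mf a k : measurable_fun Q1 (f a k).
  by apply: (midhull_measurable (E := Q1) _ (hv (n k))) => u [j _ ->].
have Lf a i k : L2 leb6 (D i) (f a k) by exact: ((bv (n k)) i).1.
have ff a i k l : (i <= k)%N -> (i <= l)%N ->
    (sqn leb6 (D i) (fun p => f a k p - f a l p)%R <= (dyadic i ^+ 2)%:E)%E.
  move=> ik il; have := nA i i (leqnn i) (n k) (n l) (nle _ _ ik) (nle _ _ il).
  have Lkl := @L2_sub _ _ _ leb6 (D i) (mD i) (f a k) (f a l) (Lf a i k) (Lf a i l).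
  rewrite (L2_fin Lkl) lee_fin; apply: le_trans.
  rewrite /energy (bigD1 a)//= lerDl sumr_ge0// => b _.
  by rewrite fine_ge0 ?sqn_ge0.
have lim a := local_limit (mf a) (Lf a) (ff a).
exists (fun a => ptlim (f a)); split.
- by apply: L2_loc_int => //; have [_ +] := cG; exact.
- by move=> a; apply: L2_loc_int; [exact: (lim a).1|have [_ [_ +]] := lim a; exact].
move=> a phi tphi.
have tp : test_fun (Qcyl 1) (partial a phi) by exact: test_fun_derive.
have c1 := pairing_cvg (lim a).2 tphi.
have c2 : - pairing (Qcyl 1) (dG j a) phi @[j --> \oo] --> pairing (Qcyl 1) Gl (partial a phi).
  rewrite (_ : (fun j => _) = fun j => pairing (Qcyl 1) (G j) (partial a phi)).
    exact: pairing_cvg.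
  by apply/funext => j; have [_ _ ->] := wG j.
have [i ti] := test_fun_rad_seq tphi.
have Lp := test_fun_L2 (mD i) (Qcyl_lty (rad_seq i)) ti.
have E g := pairing_restrict g (@Qcyl_rad_seq1 R i) (@subset_refl _ (Qcyl (rad_seq i))) ti.
set l := pairing (Qcyl 1) Gl (partial a phi) in c2 *.
(* The field [v (n k)] is built from gradients of index at least n k, all of whose pairings are
   already within e of -l. *)
have c3 : pairing (Qcyl 1) (f a k) phi @[k --> \oo] --> - l.
  apply/cvgrPdist_le => e e0; have /cvgrPdist_le/(_ _ e0) := c2.
  case=> N _ hN; exists N => // k /= Nk.
  rewrite distrC opprK E; have Nn : (N <= n k)%N by exact: leq_trans Nk (nge k).
  have := @midhull_pairing _ _ _ leb6 (D i) (mD i) 5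
    (fun u => exists2 j, (n k <= j)%N & u = dG j) (v (n k)) a phi (- l) e _ Lp (hv (n k)).
  rewrite opprK => /(_ _)[|//] u [j nj ->]; split; first exact: LdG.
  have := hN j (leq_trans Nn nj); rewrite -E /= opprK addrC.
  by [].
by rewrite -[LHS]opprK; congr (- _); apply: (cvg_unique _ c3 c1).
Qed.

End weak_limit_of_gradients.

Lemma limit_identity (R : realType) (nu : R) (x y z s : nat -> R) (X Y Z S : R) :
  (forall j, - x j + y j = nu * z j + s j) ->
  x j @[j --> \oo] --> X -> y j @[j --> \oo] --> Y -> z j @[j --> \oo] --> Z ->
  s j @[j --> \oo] --> S -> - X + Y = nu * Z + S.
Proof.
move=> E xX yY zZ sS.
have l1 : - x j + y j @[j --> \oo] --> - X + Y by apply: cvgD => //; exact: cvgN.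
have l2 : nu * z j + s j @[j --> \oo] --> nu * Z + S by apply: cvgD => //; exact: cvgMr.
have e : (fun j => - x j + y j) = (fun j => nu * z j + s j) by exact/funext.
by rewrite e in l1; exact: (cvg_unique _ l1 l2).
Qed.

Section source_free_limit.
Context {R : realType}.
Variables (nu : R) (m : nat) (G : nat -> spacetime5 R -> R) (dG b : nat -> 'I_5 -> spacetime5 R -> R)
  (src : nat -> (spacetime5 R -> R) -> R) (Gl : spacetime5 R -> R) (dGl bl : 'I_5 -> spacetime5 R -> R).

Lemma solves_limit : (forall j, solves (Qcyl 1) nu (G j) (dG j) (b j) (src j)) -> loc_cvg G Gl ->
  (forall phi, test_fun (Qcyl 1) phi -> src j phi @[j --> \oo] --> 0) ->
  (forall phi, test_fun (Qcyl 1) phi ->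
    pairing (Qcyl 1) (dotf (b j) (dG j)) phi @[j --> \oo] --> pairing (Qcyl 1) (dotf bl dGl) phi) ->
  solves (Qcyl 1) nu Gl dGl bl (fun=> 0).
Proof.
move=> sol cG cS cb phi tphi.
have tt : test_fun (Qcyl 1) (partial_t phi) by exact: test_fun_derive.
apply: (limit_identity (fun j => sol j phi tphi)); last exact: cS.
- exact: pairing_cvg cG tt.
- exact: cb.
- exact: pairing_cvg cG (test_fun_laplacian tphi).
Qed.

End source_free_limit.

Theorem proposition8p1 (R : realType) (nu : R) (m : nat)
    (g br bz : nat -> R -> R -> R -> R)
    (dG : nat -> 'I_5 -> spacetime5 R -> R)
    (divb : nat -> spacetime5 R -> R)
    (src : nat -> (spacetime5 R -> R) -> R) :
  let G j := axi (g j) in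
  let b j := axi_field (br j) (bz j) in
  0 < nu ->
  (forall j, weak_gradient (Qcyl 1) (G j) (dG j)) ->
  (forall j, weak_div5 (Qcyl 1) (b j) (divb j)) ->
  (forall j, is_distribution (Qcyl 1) (src j)) ->
  (forall j, solves (Qcyl 1) nu (G j) (dG j) (b j) (src j)) ->
  (forall rho, 0 < rho < 1 ->
    (ereal_sup (range (fun j =>
       normLL +oo 2%:E rho (G j) +
       normL2 rho (vnorm (dG j)) +
       normLL 2%:E (10 / 3)%:E rho (vnorm (b j)) +
       normLL 2%:E (10 / 3)%:E rho (divb j))) < +oo)%E) ->
  (forall rho, 0 < rho < 1 -> cvg0_L1Hneg m rho src) ->
  exists n : nat -> nat, {homo n : i j / (i < j)%N} /\
  exists (ginf : R -> R -> R -> R) (dGinf : 'I_5 -> spacetime5 R -> R),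
    let Ginf := axi ginf in
    [/\ weak_gradient (Qcyl 1) Ginf dGinf,
        forall rho, 0 < rho < 1 ->
          normL2 rho (G (n k) \- Ginf) @[k --> \oo] --> 0%E &
        forall brinf bzinf : R -> R -> R -> R,
          let binf := axi_field brinf bzinf in
          (forall i, measurable_fun (Qcyl 1) (binf i)) ->
          loc_int (Qcyl 1) (dotf binf dGinf) ->
          (forall phi, test_fun (Qcyl 1) phi ->
            pairing (Qcyl 1) (dotf (b (n k)) (dG (n k))) phi @[k --> \oo] -->
            pairing (Qcyl 1) (dotf binf dGinf) phi) ->
          solves (Qcyl 1) nu Ginf dGinf binf (fun=> 0)].
Proof.
move=> G b nu0 wG wb dS sol hsup hS.
have mG j : measurable_fun (Qcyl 1 : set (spacetime5 (measurableTypeR R))) (G j) by have [[]] := wG j.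
have mdG j i : measurable_fun (Qcyl 1 : set (spacetime5 (measurableTypeR R))) (dG j i).
  by have [_ /(_ i)[]] := wG j.
have mb j i : measurable_fun (Qcyl 1 : set (spacetime5 (measurableTypeR R))) (b j i).
  by have [/(_ i)[]] := wb j.
have bnd (rho : R) : 0 < rho < 1 -> exists2 M : R, 0 <= M & forall j,
    [/\ (sqn leb6 (Qcyl rho) (G j) <= M%:E)%E,
        forall i, (sqn leb6 (Qcyl rho) (dG j i) <= M%:E)%E &
        forall i, (sqn leb6 (Qcyl rho) (b j i) <= M%:E)%E].
  move=> r01; have := hsup rho r01; set E := ereal_sup _ => hA.
  have h j : (normLL +oo 2%:E rho (G j) + normL2 rho (vnorm (dG j)) +
       normLL 2%:E (10 / 3)%:E rho (vnorm (b j)) +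
       normLL 2%:E (10 / 3)%:E rho (divb j) <= E)%E.
    by apply: ereal_sup_ubound; exists j.
  have A0 : (0 <= E)%E by apply: le_trans (h 0%N); rewrite !adde_ge0 ?Lnorm_ge0.
  have AX : E = (fine (E))%:E by rewrite fineK// ge0_fin_numE.
  have X0 : 0 <= fine (E) by exact: fine_ge0.
  have v0 : 0 <= fine (leb5 (Dcyl rho)) by rewrite fine_ge0.
  exists (fine (E) ^+ 2 * (1 + rho ^+ 2 + fine (leb5 (Dcyl rho)))).
    by rewrite mulr_ge0 ?sqr_ge0// !addr_ge0// sqr_ge0.
  have mS (f : spacetime5 R -> R) : measurable_fun (Qcyl 1 : set (spacetime5 (measurableTypeR R))) f ->
      measurable_fun (Qcyl rho : set (spacetime5 (measurableTypeR R))) f.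
    by have /andP[ra rb] := r01; apply: measurable_fun_Qcyl; exact: ltW.
  move=> j; have n0 : (0 <= normLL 2%:E (10 / 3)%:E rho (divb j))%E by exact: Lnorm_ge0.
  have hj := h j; rewrite AX in hj.
  exact: (@cyl_bounds R rho (fine (E)) (G j) (dG j) (b j) _ X0 n0
    (mS _ (mG j)) (fun i => mS _ (mdG j i)) (fun i => mS _ (mb j i)) hj).
(* One ultrafilter is fixed for all radii and accuracies; the pairs ([rad_seq i], [dyadic i ^+ 2])
   are then treated together by a single diagonal subsequence. *)
have [F [UF Foo]] := @ultraFilterLemma nat \oo _.
have cF i := @cauchy_along R nu m G dG b src nu0 wG dS sol mb bnd hS F (rad_seq i) (dyadic i ^+ 2)
  UF Foo (rad_seq_itv i) (exprn_gt0 2 (dyadic_gt0 R i)).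
have [A hA] := choice2_fun cF.
have [n [ninc nA]] := diagonal_subseq (@ultra_proper _ _ UF) Foo (fun i => (hA i).1).
have LG i k : L2 leb6 (Qcyl (rad_seq i)) (G (n k)).
  have [M _ hM] := bnd _ (rad_seq_itv i).
  split; last by have [h _ _] := hM (n k); exact: le_lt_trans h (ltry _).
  exact: measurable_fun_rad_seq.
have ff i k l : (i <= k)%N -> (i <= l)%N ->
    (sqn leb6 (Qcyl (rad_seq i)) (fun p => G (n k) p - G (n l) p)%R <= (dyadic i ^+ 2)%:E)%E.
  move=> ik il; have Lkl := @L2_sub _ _ _ leb6 (Qcyl (rad_seq i)) (Qcyl_measurable (rad_seq i))
    (G (n k)) (G (n l)) (LG i k) (LG i l).
  by rewrite (L2_fin Lkl) lee_fin; exact: ((hA i).2 _ _ (nA i k ik) (nA i l il)).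
have [mGl cG] := local_limit (fun k => mG (n k)) LG ff.
have bdG i : exists2 M : R, 0 <= M & forall j a, (sqn leb6 (Qcyl (rad_seq i)) (dG (n j) a) <= M%:E)%E.
  by have [M M0 hM] := bnd _ (rad_seq_itv i); exists M => // j a; have [_ + _] := hM (n j); exact.
have [dGl wGl] := weak_gradient_limit (fun j => wG (n j)) mGl cG bdG.
exists n; split => //.
(* The upper limit is taken before lifting to R x R^5. Lifting commutes with it by computation, so
   the lift is exactly [ptlim] of the sequence [G (n k)] and the results on pointwise limits apply
   unchanged. *)
exists (fun t r z => fine (limn_esup (fun k => (g (n k) t r z)%:E))), dGl.
split => [|rho r01|brinf bzinf binf _ _ cb].
- exact: wGl.
- exact: (normL2_cvg0 mGl (fun k => mG (n k)) cG r01).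
apply: (solves_limit (fun j => sol (n j)) cG) => // phi tphi.
have := source_cvg0 dS hS tphi; move=> h.
apply: (cvg_comp _ _ _ h).
apply/cvgnyPge => N; near=> k; apply: (@leq_trans k); first by near: k; exact: nbhs_infty_ge.
exact: increasing_ge.
Unshelve. all: by end_near. Qed.
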